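(* Fix $\rho\in(0,1)$ and $\kappa>0$. Let $\boldsymbol\sigma\sim\mathbb P$, where $\mathbb P$ is the quadratic interaction model with coupling matrix $A_n$, field vector $c\in\mathbb R^n$ and base measures $\mu_1,\dots,\mu_n$, and suppose $\|A_n\|_4\le\rho$. Let $q\in\mathbb R^n$ with $\|q\|=1$ and let $u$ be the Mean-Field optimizer. Let $\nu_i=\sum_{j=1}^nA_n(i,j)\psi_j'(c_j)$ and $\upsilon_n=\sum_{i=1}^nq_i^2\psi_i''(c_i)$; assume $\upsilon_n\ge\kappa$. Let $\lambda_n\in\mathbb R$ with $|\lambda_n|\le\rho$, $\boldsymbol\epsilon=A_nq-\lambda_nq$, $W_n\sim N\big(0,\frac{\upsilon_n}{1-\lambda_n\upsilon_n}\big)$, $\Psi'(c)=(\psi_1'(c_1),\dots,\psi_n'(c_n))^\top$, and $$R_{1n}=\sum_{i=1}^n\Big(\sum_{j=1}^nA_n(i,j)q_j(\psi_j''(c_j)-\upsilon_n)\Big)^2,\quad R_{2n}=\sum_{i=1}^n\nu_i^2,\quad R_{3n}=\sum_{i=1}^n\nu_i^4,$$ $$R_{4n}=\Big|\sum_{1\le i,j\le n}A_n(i,j)q_i(\psi_i''(c_i)-\upsilon_n)\psi_j'(c_j)\Big|.$$ (a) We have $$\Big|q^\top\Big(u-\frac{\Psi'(c)}{1-\lambda_n\upsilon_n}\Big)\Big|\lesssim\sqrt{R_{1n}R_{2n}}+\sqrt{R_{3n}}+R_{4n}+\sqrt{R_{2n}}\,\|\boldsymbol\epsilon\|+|\boldsymbol\epsilon^\top\Psi'(c)|.$$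 (b) Further, $$d_{KS}\Big(\sum_{i=1}^nq_i\Big(\sigma_i-\frac{\psi_i'(c_i)}{1-\lambda_n\upsilon_n}\Big),W_n\Big)\lesssim\sqrt{R_{2n}}\big(\sqrt{R_{1n}}+\sqrt{\alpha_n}+\|\boldsymbol\epsilon\|\big)+\sqrt{R_{1n}}+\sqrt{R_{3n}}+\sqrt n\,\alpha_n+\|q\|_\infty+R_{4n}+|\boldsymbol\epsilon^\top\Psi'(c)|+\|\boldsymbol\epsilon\|.$$ In both parts the implicit constant depends only on $\rho$ and $\kappa$.
   Context: Model: $\mu_1,\dots,\mu_n$ are non-degenerate probability measures supported on $[-1,1]$, with both $-1$ and $1$ in the support of each $\mu_i$; $A_n$ is a real symmetric $n\times n$ matrix with zero diagonal; $c\in\mathbb R^n$ is deterministic. The quadratic interaction model $\mathbb P$ is the probability measure on $[-1,1]^n$ with $$\frac{d\mathbb P}{d\prod_{i=1}^n\mu_i}(\boldsymbol\sigma)=\frac1{Z_n}\exp\Big(\tfrac12\boldsymbol\sigma^\top A_n\boldsymbol\sigma+c^\top\boldsymbol\sigma\Big).$$ Norms: $\|\cdot\|,\|\cdot\|_\infty$ are the $\ell_2$ and $\ell_\infty$ norms of vectors; $\|A_n\|_4$ is the $\ell_4\to\ell_4$ operator norm. Put $\alpha_n=\max_{1\le i\le n}\sum_{j=1}^nA_n(i,j)^2$. $d_{KS}(X,Y)=\sup_{t\in\mathbb R}|P(X\le t)-P(Y\le t)|$. Mean-Field optimizer: let $\psi_i(\theta)=\log\int e^{\theta z}\,d\mu_i(z)$,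 let $\phi_i:(-1,1)\to\mathbb R$ be the inverse of $\psi_i':\mathbb R\to(-1,1)$, and let $I_i(z)=z\phi_i(z)-\psi_i(\phi_i(z))$ (extended to $z=\pm1$ by its limits in $[0,\infty]$). Let $F(z)=\frac12z^\top A_nz+z^\top c-\sum_iI_i(z_i)$ on $[-1,1]^n$. When $\|A_n\|<1$ in $\ell_2$ operator norm (in particular when $\|A_n\|_4<1$), $F$ has a unique maximizer $u\in(-1,1)^n$, and it satisfies $u_i=\psi_i'(s_i+c_i)$ with $s_i=\sum_jA_n(i,j)u_j$. *)

(* Defs.v *)
From HB Require Import structures.
From mathcomp Require Import all_boot all_order all_algebra.
From mathcomp Require Import all_classical all_reals all_analysis.

Set Implicit Arguments.
Unset Strict Implicit.
Unset Printing Implicit Defensive.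

Import Order.TTheory GRing.Theory Num.Theory.
Import numFieldNormedType.Exports.

Local Open Scope classical_set_scope.
Local Open Scope ring_scope.

Section norms.
Context {R : realType}.

Definition lpnorm (p : nat) (n : nat) (x : 'cV[R]_n) : R :=
  (\sum_(i < n) `|x i 0| ^+ p) `^ p%:R^-1.

Definition linfnorm (n : nat) (x : 'cV[R]_n) : R :=
  \big[Num.max/0]_(i < n) `|x i 0|.

(* The set is nonempty and, for 0 < p, bounded, so the real supremum is the
   genuine one. *)
Definition opnorm (p : nat) (n : nat) (A : 'M[R]_n) : R :=
  sup [set lpnorm p (A *m x) | x in [set x : 'cV[R]_n | lpnorm p x <= 1]].

End norms.

Section product_measure.
Context {R : realType}.

Definition tuple_cons (n : nat) (x : R * n.-tuple R) : n.+1.-tuple R :=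
  [tuple of x.1 :: x.2].

Lemma measurable_tuple_cons (n : nat) :
  measurable_fun [set: R * n.-tuple R] (@tuple_cons n).
Proof. exact: measurable_cons. Qed.

HB.instance Definition _ (n : nat) := isMeasurableFun.Build _ _ _ _
  (@tuple_cons n) (@measurable_tuple_cons n).

Fixpoint product_prob (n : nat) :
    ('I_n -> probability R R) -> probability (n.-tuple R) R :=
  match n with
  | 0 => fun=> \d_[tuple]
  | m.+1 => fun mu => distribution
      (mu ord0 \x product_prob (fun i => mu (lift ord0 i)))%E (@tuple_cons m)
  end.

Lemma product_probE (n : nat) (mu : 'I_n -> probability R R)
    (B : 'I_n -> set R) : (forall i, measurable (B i)) ->
  product_prob mu [set x | forall i, B i (tnth x i)] =
  (\prod_(i < n) mu i (B i))%E.
Proof.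
elim: n mu B => [|n IHn] mu B mB /=.
  by rewrite big_ord0 diracE mem_set//= => -[].
rewrite big_ord_recl -(IHn (fun i => mu (lift ord0 i)) (fun i => B (lift ord0 i)))//.
rewrite -product_measure1E//; last first.
  rewrite (_ : mkset _ = \bigcap_(i in [set: 'I_n])
      ((fun x : n.-tuple R => tnth x i) @^-1` B (lift ord0 i))).
    apply: fin_bigcap_measurable => // i _.
    by rewrite -[X in measurable X]setTI; exact: measurable_tnth.
  by apply/seteqP; split => x /= h i; [move=> _|]; exact: h.
rewrite /distribution /pushforward; congr (_ _).
apply/seteqP; split => -[x y] /=.
  move=> h; split; first exact: (h ord0).
  by move=> i; have := h (lift ord0 i); rewrite /tuple_cons tnthS.
move=> [h0 h] i; rewrite /tuple_cons; case: (unliftP ord0 i) => [j|] ->.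
  by rewrite tnthS.
by rewrite tnth0.
Qed.

End product_measure.

Section base_measures.
Context {R : realType}.
Implicit Types mu : probability R R.

Definition msupport mu : set R :=
  [set x | forall U : set R, open U -> U x -> (0 < mu U)%E].

Record base_measure mu : Prop := BaseMeasure {
  base_nondegenerate : forall a : R, mu [set a] <> 1%E;
  base_supported : mu `[-1, 1]%classic = 1%E;
  base_supportN1 : msupport mu (-1);
  base_support1 : msupport mu 1 }.

(* The integral is finite as soon as mu has bounded support. *)
Definition psi mu (theta : R) : R := ln (\int[mu]_z expR (theta * z)).

(* Any of the values sent to z by psi', and 0 when z is not a value of psi';
   for a base measure psi' is a bijection from R to ]-1, 1[. *)
Definition phi mu : R -> R := 'pinv_(fun=> 0) [set: R] ((psi mu)^`())%classic.

Definition rate_int mu (z : R) : R := z * phi mu z - psi mu (phi mu z).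

(* Only used on [-1, 1]. *)
Definition rate mu (z : R) : \bar R :=
  if z == 1 then lim ((rate_int mu x)%:E @[x --> (1 : R)^'-])
  else if z == -1 then lim ((rate_int mu x)%:E @[x --> (-1 : R)^'+])
  else (rate_int mu z)%:E.

End base_measures.

Section model.
Context {R : realType} {n : nat}.
Implicit Types (mu : 'I_n -> probability R R) (A : 'M[R]_n) (c q u z : 'cV[R]_n).

Definition hamiltonian A c z : R :=
  2^-1 * (z^T *m A *m z) 0 0 + (c^T *m z) 0 0.

Definition vec (x : n.-tuple R) : 'cV[R]_n := \col_(i < n) tnth x i.

Definition partition_function mu A c : R :=
  \int[product_prob mu]_x expR (hamiltonian A c (vec x)).

(* For base measures the product measure, hence the model, is carried by the
   cube [-1, 1]^n, so there is no need to restrict the ambient space. *)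
Definition quadratic_model mu A c (B : set (n.-tuple R)) : \bar R :=
  (\int[product_prob mu]_(x in B)
    ((partition_function mu A c)^-1 * expR (hamiltonian A c (vec x)))%:E)%E.

Definition in_cube z : Prop := forall i, -1 <= z i 0 <= 1.

Definition mean_field_functional mu A c z : \bar R :=
  ((hamiltonian A c z)%:E - \sum_(i < n) rate (mu i) (z i 0%R))%E.

Definition mean_field_optimizer mu A c u : Prop :=
  in_cube u /\ forall z, in_cube z ->
    (mean_field_functional mu A c z <= mean_field_functional mu A c u)%E.

Definition alpha A : R :=
  \big[Num.max/0]_(i < n) \sum_(j < n) A i j ^+ 2.

Definition dpsi mu i : R -> R := ((psi (mu i))^`())%classic.
Definition ddpsi mu i : R -> R := ((psi (mu i))^`(2))%classic.

Definition dPsi mu c : 'cV[R]_n := \col_(i < n) dpsi mu i (c i 0).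

Definition nu mu A c (i : 'I_n) : R := \sum_(j < n) A i j * dpsi mu j (c j 0).

Definition upsilon mu c q : R := \sum_(i < n) q i 0 ^+ 2 * ddpsi mu i (c i 0).

Definition R1 mu A c q : R :=
  \sum_(i < n) (\sum_(j < n)
    A i j * q j 0 * (ddpsi mu j (c j 0) - upsilon mu c q)) ^+ 2.

Definition R2 mu A c : R := \sum_(i < n) nu mu A c i ^+ 2.

Definition R3 mu A c : R := \sum_(i < n) nu mu A c i ^+ 4.

Definition R4 mu A c q : R :=
  `| \sum_(i < n) \sum_(j < n)
       A i j * q i 0 * (ddpsi mu i (c i 0) - upsilon mu c q)
       * dpsi mu j (c j 0) |.

End model.

Section laws.
Context {R : realType} d (T : measurableType d) (P : probability T R).

Definition has_quadratic_law n (sigma : {RV P >-> n.-tuple R})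
    (mu : 'I_n -> probability R R) (A : 'M[R]_n) (c : 'cV[R]_n) : Prop :=
  forall B : set (n.-tuple R), measurable B ->
    distribution P sigma B = quadratic_model mu A c B.

(* The second argument of normal_prob is the standard deviation. *)
Definition has_centered_normal_law (W : {RV P >-> R}) (v : R) : Prop :=
  forall B : set R, measurable B ->
    distribution P W B = normal_prob 0 (Num.sqrt v) B.

Definition dKS d' (T' : measurableType d') (Q : probability T' R)
    (X : T -> R) (Y : T' -> R) : R :=
  sup (range (fun t : R =>
    `| fine (P [set w | X w <= t]) - fine (Q [set w | Y w <= t]) |)).

End laws.

(* Main.v *)
Require Import Defs.
From HB Require Import structures.
From mathcomp Require Import all_boot all_order all_algebra.
From mathcomp Require Import all_classical all_reals all_analysis.
From mathcomp Require Import measurable_realfun ring lra.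

Import Order.TTheory GRing.Theory Num.Theory.
Import numFieldNormedType.Exports.

Local Open Scope classical_set_scope.
Local Open Scope ring_scope.

(* Let b_i = psi_i'(c_i), d_i = psi_i''(c_i), m_i(s) = sum_j A_ij s_j, and let
   xi_i = s_i - psi_i'(m_i + c_i) be the residual of s_i with respect to its
   conditional mean given the other coordinates.  Expanding psi_i' at c_i and
   using A q = lam q + eps,
     (1 - lam v) q.s - q.b = q.xi + r.b + v eps.b + (errors),
   where r_j = sum_i A_ij q_i (d_i - v) and the errors are quadratic in m or
   linear in s - b along eps and r; inverting I - D A, D = diag(d), turns the
   latter into linear statistics of xi.  The quadratic ones are controlled by
   |m|_4 <= (|A b|_4 + |A xi|_4) / (1 - rho), which is where the l4 operator
   norm enters.  Part (a) is the case s = u, in which xi = 0 by the fixed-point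
   equation of the optimizer.

   For part (b), resampling one coordinate from its conditional law is a
   reversible operation.  Reversibility gives the moment bounds
   E (a.xi)^4 <= C |a|^4 and the variance bounds of the quadratic statistics,
   and, applied to E [q.xi f(T)] for the solution f of Stein's equation with
   indicator right-hand side, the Kolmogorov bound.  The discontinuity of f' is
   handled as in Shao and Zhang: f' is the difference of two monotone functions
   of T, so the remainder is bounded by E |sum_i q_i |q_i| E[D_i |D_i| | s]|
   with D_i = s_i - s_i' antisymmetric under the exchange of s_i and its
   resampled value s_i'. *)

(** * Norms and the contraction property of the coupling matrix *)

(** The constants must be free of the dimension although the local field [mv A s] need not be small.
    Its part [A (g - b)] is dominated by the field itself, and only a strict contraction lets it be
    absorbed; for symmetric [A] the l4 bound also yields the l2 contraction, on which the linear
    statistics rely. The term sqrt(n) alpha is the price of the fluctuating part [A xi]: entry i is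
    the linear statistic with coefficient row [A i], so the fourth moments add up to at most a
    multiple of n alpha^2. The term |q|_inf comes from sums weighted by q_i^2, whose variance is of
    order |q|_inf^2 plus an interaction of order |q|_inf sqrt(alpha). The bound kappa enters because
    the Kolmogorov distance is estimated after multiplication by v. Base measures live on R but are
    carried by [-1, 1]. Replacing each coordinate by its truncation [clip] changes nothing almost
    everywhere and makes every observable bounded, so integrability reduces to closure properties.
    Conditional laws are exponential tilts of the base measures, hence psi', psi'' and the
    resampling kernel are all instances of [tilt]. *)

Section vectors.
Context {R : realType}.

Definition dotp {n} (x y : 'I_n -> R) : R := \sum_i x i * y i.
Definition sqs {n} (x : 'I_n -> R) : R := \sum_i x i ^+ 2.
Definition qds {n} (x : 'I_n -> R) : R := \sum_i x i ^+ 4.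
Definition mv {n} (A : 'M[R]_n) (x : 'I_n -> R) (i : 'I_n) : R :=
  \sum_j A i j * x j.

Lemma sqs_ge0 {n} (x : 'I_n -> R) : 0 <= sqs x.
Proof. by apply: sumr_ge0 => i _; rewrite sqr_ge0. Qed.

Lemma qds_ge0 {n} (x : 'I_n -> R) : 0 <= qds x.
Proof. by apply: sumr_ge0 => i _; rewrite exprn_even_ge0. Qed.

Lemma dotpC {n} (x y : 'I_n -> R) : dotp x y = dotp y x.
Proof. by apply: eq_bigr => i _; rewrite mulrC. Qed.

Lemma dotpDl {n} (x y z : 'I_n -> R) :
  dotp (fun i => x i + y i) z = dotp x z + dotp y z.
Proof. by rewrite -big_split/=; apply: eq_bigr => i _; rewrite mulrDl. Qed.

Lemma dotpDr {n} (x y z : 'I_n -> R) :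
  dotp z (fun i => x i + y i) = dotp z x + dotp z y.
Proof. by rewrite !(dotpC z) dotpDl. Qed.

Lemma dotpBr {n} (x y z : 'I_n -> R) :
  dotp z (fun i => x i - y i) = dotp z x - dotp z y.
Proof. by rewrite -sumrB/=; apply: eq_bigr => i _; rewrite mulrBr. Qed.

Lemma mvD {n} (A : 'M[R]_n) (x y : 'I_n -> R) i :
  mv A (fun i => x i + y i) i = mv A x i + mv A y i.
Proof. exact: dotpDr. Qed.

Lemma dotp_mv {n} (A : 'M[R]_n) (x y : 'I_n -> R) :
  (forall i j, A i j = A j i) -> dotp x (mv A y) = dotp (mv A x) y.
Proof.
move=> sA; rewrite /dotp /mv.
under eq_bigr do rewrite mulr_sumr.
rewrite exchange_big/=; apply: eq_bigr => j _.
rewrite mulr_suml; apply: eq_bigr => i _.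
by rewrite mulrA (mulrC (x i)) sA.
Qed.

(** Lagrange's identity: the two sides differ by half the sum of the squares of the minors x_i y_j -
    x_j y_i. *)
Lemma cauchy_schwarz {n} (x y : 'I_n -> R) : dotp x y ^+ 2 <= sqs x * sqs y.
Proof.
have -> : sqs x * sqs y = dotp x y ^+ 2 +
    2^-1 * \sum_i \sum_j (x i * y j - x j * y i) ^+ 2.
  rewrite /sqs /dotp.
  have -> : \sum_i \sum_j (x i * y j - x j * y i) ^+ 2 =
     2 * ((\sum_i x i ^+ 2) * (\sum_j y j ^+ 2)) - 2 * (\sum_i x i * y i) ^+ 2.
    transitivity (\sum_i (x i ^+ 2 * (\sum_j y j ^+ 2) +
        (\sum_j x j ^+ 2) * y i ^+ 2 - 2 * (x i * y i) * (\sum_j x j * y j))).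
      apply: eq_bigr => i _; rewrite mulr_sumr mulr_suml mulr_sumr -big_split/=.
      by rewrite -sumrB; apply: eq_bigr => j _; ring.
    rewrite sumrB big_split/= -mulr_suml -mulr_sumr -!mulr_suml -mulr_sumr.
    by ring.
  by field.
rewrite lerDl mulr_ge0// sumr_ge0// => i _; apply: sumr_ge0 => j _.
exact: sqr_ge0.
Qed.

Lemma abs_dotp_le {n} (x y : 'I_n -> R) :
  `|dotp x y| <= Num.sqrt (sqs x) * Num.sqrt (sqs y).
Proof.
rewrite -sqrtrM ?sqs_ge0// -sqrtr_sqr ler_wsqrtr//.
exact: cauchy_schwarz.
Qed.

(** Cauchy-Schwarz against the constant vector. The factor n does no harm where this is used, since
    it faces a geometric sequence. *)
Lemma sqs_le_qds {n} (x : 'I_n -> R) : sqs x ^+ 2 <= n%:R * qds x.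
Proof.
have := cauchy_schwarz (fun=> 1) (fun i => x i ^+ 2).
rewrite /dotp /sqs; under eq_bigr do rewrite mul1r.
under [X in X * _]eq_bigr do rewrite expr1n.
rewrite sumr_const card_ord.
by under [X in _ <= _ * X -> _]eq_bigr do rewrite -exprM.
Qed.

Lemma sqs_pow4 {n} (x : 'I_n -> R) : sqs (fun i => x i ^+ 2) = qds x.
Proof. by apply: eq_bigr => i _; rewrite -exprM. Qed.

(** Convexity of the square at s (x / s) + (1 - s) (y / (1 - s)). The weight is kept free: with 1 -
    s = rho, a y-term carrying rho^2 retains the factor rho < 1 and can be absorbed on the other
    side; for fourth powers rho^4 / rho^3 does the same. *)
Lemma sqr_conv_le (s x y : R) : 0 < s < 1 ->
  (x + y) ^+ 2 <= x ^+ 2 / s + y ^+ 2 / (1 - s).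
Proof.
move=> /andP[s0 s1]; have t0 : 0 < 1 - s by rewrite subr_gt0.
rewrite -subr_ge0.
have -> : x ^+ 2 / s + y ^+ 2 / (1 - s) - (x + y) ^+ 2 =
  ((1 - s) * x - s * y) ^+ 2 / (s * (1 - s)).
  by field; rewrite !gt_eqF.
by rewrite divr_ge0 ?sqr_ge0// mulr_ge0 ?ltW.
Qed.

Lemma pow4_conv_le (s x y : R) : 0 < s < 1 ->
  (x + y) ^+ 4 <= x ^+ 4 / s ^+ 3 + y ^+ 4 / (1 - s) ^+ 3.
Proof.
move=> s01; have /andP[s0 s1] := s01; have t0 : 0 < 1 - s by rewrite subr_gt0.
have E (z : R) : z ^+ 4 = (z ^+ 2) ^+ 2 by rewrite -exprM.
rewrite (E (x + y)); apply: le_trans (_ : (x ^+ 2 / s + y ^+ 2 / (1 - s)) ^+ 2 <= _).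
  rewrite lerXn2r// ?nnegrE ?sqr_ge0 ?sqr_conv_le//.
  by rewrite addr_ge0// divr_ge0 ?sqr_ge0// ltW.
apply: le_trans (sqr_conv_le _ _ _ s01) _.
by rewrite le_eqVlt; apply/orP; left; apply/eqP; field; rewrite !gt_eqF.
Qed.

Lemma ler_pow4_norm (x y : R) : `|x| <= `|y| -> x ^+ 4 <= y ^+ 4.
Proof.
have E (z : R) : z ^+ 4 = `|z| ^+ 4.
  by rewrite -normrX ger0_norm// exprn_even_ge0.
by move=> xy; rewrite (E x) (E y) lerXn2r ?nnegrE.
Qed.

Lemma sqs_add_le {n} (s : R) (x y : 'I_n -> R) : 0 < s < 1 ->
  sqs (fun i => x i + y i) <= sqs x / s + sqs y / (1 - s).
Proof.
move=> s01; rewrite /sqs !mulr_suml -big_split/= ler_sum// => i _.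
exact: sqr_conv_le.
Qed.

Lemma qds_add_le {n} (s : R) (x y : 'I_n -> R) : 0 < s < 1 ->
  qds (fun i => x i + y i) <= qds x / s ^+ 3 + qds y / (1 - s) ^+ 3.
Proof.
move=> s01; rewrite /qds !mulr_suml -big_split/= ler_sum// => i _.
exact: pow4_conv_le.
Qed.

Lemma lpnorm2E {n} (x : 'cV[R]_n) :
  lpnorm 2 x = Num.sqrt (sqs (fun i => x i 0)).
Proof.
rewrite /lpnorm -powR12_sqrt ?sqs_ge0//; congr (_ `^ _).
by apply: eq_bigr => i _; rewrite real_normK ?num_real.
Qed.

Lemma lpnorm4_qds {n} (x : 'cV[R]_n) :
  0 <= lpnorm 4 x /\ lpnorm 4 x ^+ 4 = qds (fun i => x i 0).
Proof.
rewrite /lpnorm; split; first exact: powR_ge0.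
have -> : \sum_(i < n) `|x i 0| ^+ 4 = qds (fun i => x i 0).
  apply: eq_bigr => i _.
  by rewrite (exprM _ 2 2) real_normK ?num_real// -exprM.
rewrite -powR_mulrn ?powR_ge0// -powRrM mulVf// powRr1//.
exact: qds_ge0.
Qed.

Lemma mvE {n} (A : 'M[R]_n) (x : 'cV[R]_n) i :
  (A *m x) i 0 = mv A (fun i => x i 0) i.
Proof. by rewrite mxE. Qed.

Lemma lpnorm4_le {n} (x y : 'cV[R]_n) : (lpnorm 4 x <= lpnorm 4 y) =
  (qds (fun i => x i 0) <= qds (fun i => y i 0)).
Proof.
have [x0 <-] := lpnorm4_qds x; have [y0 <-] := lpnorm4_qds y.
by rewrite ler_pXn2r.
Qed.

(** By homogeneity the bound on the unit ball extends to all vectors. The set under [sup] has to be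
    shown bounded first, since otherwise the real supremum is only a default value. *)
Lemma opnorm4_contract {n} (A : 'M[R]_n) (rho : R) : opnorm 4 A <= rho ->
  forall x, qds (mv A x) <= rho ^+ 4 * qds x.
Proof.
move=> hA x.
have ub (y : 'cV[R]_n) : lpnorm 4 y <= 1 -> lpnorm 4 (A *m y) <= opnorm 4 A.
  move=> y1; apply: ub_le_sup; last by exists y.
  (* On the l4 unit ball every |z_j| is at most 1, so the absolute row sums dominate [A z]
     coordinatewise. *)
  exists (lpnorm 4 (\col_i \sum_j `|A i j|)) => _ [z /= z1 <-].
  rewrite lpnorm4_le ler_sum// => i _; rewrite -[leLHS]ger0_norm ?exprn_even_ge0//.
  rewrite normrX lerXn2r ?nnegrE//.
    by rewrite mxE sumr_ge0.
  rewrite !mxE (le_trans (ler_norm_sum _ _ _))// ler_sum// => j _.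
  rewrite normrM ler_piMr//.
  have : qds (fun i => z i 0) <= 1.
    have [z0 <-] := lpnorm4_qds z.
    by rewrite exprn_ile1.
  rewrite /qds (bigD1 j)//= => h.
  have : z j 0 ^+ 4 <= 1.
    by apply: le_trans h; rewrite lerDl sumr_ge0// => k _; rewrite exprn_even_ge0.
  rewrite -[X in X <= _]ger0_norm ?exprn_even_ge0// normrX => h4.
  by rewrite -(@expr_le1 _ 4)//.
have op0 : 0 <= rho.
  apply: le_trans hA; apply: le_trans (ub 0 _); first by have [] := lpnorm4_qds (A *m 0).
  rewrite /lpnorm big1 ?powR0 ?ler01 ?invr_eq0 ?pnatr_eq0//.
  by move=> i _; rewrite mxE normr0 expr0n.
pose X : 'cV[R]_n := \col_i x i.
have XE : (fun i => X i 0) = x by apply/funext => i; rewrite mxE.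
have [s0 sE] := lpnorm4_qds X; rewrite XE in sE.
have [s00|sN0] := eqVneq (lpnorm 4 X) 0.
  have x0 i : x i = 0.
    have : qds x = 0 by rewrite -sE s00 expr0n.
    move/eqP; rewrite psumr_eq0; last by move=> *; rewrite exprn_even_ge0.
    by move=> /allP /(_ i (mem_index_enum _)); rewrite expf_eq0/= => /eqP.
  rewrite [leLHS]big1 ?mulr_ge0 ?exprn_ge0 ?qds_ge0//.
  by move=> i _; rewrite /mv big1 ?expr0n// => j _; rewrite x0 mulr0.
set s := lpnorm 4 X in s0 sE sN0.
have sp : 0 < s by rewrite lt_neqAle eq_sym sN0.
have qZ a (y : 'I_n -> R) : qds (fun i => a * y i) = a ^+ 4 * qds y.
  by rewrite /qds mulr_sumr; apply: eq_bigr => i _; rewrite exprMn.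
have /ub : lpnorm 4 (s^-1 *: X) <= 1.
  rewrite -(@expr_le1 _ 4)//; last by have [] := lpnorm4_qds (s^-1 *: X).
  have [_ ->] := lpnorm4_qds (s^-1 *: X).
  rewrite (_ : (fun i => _) = (fun i => s^-1 * x i)); last first.
    by apply/funext => i; rewrite !mxE.
  by rewrite qZ -sE -exprMn mulVf// expr1n.
move=> /le_trans/(_ hA); rewrite -(@ler_pXn2r _ 4) ?nnegrE//; last first.
  by have [] := lpnorm4_qds (A *m (s^-1 *: X)).
have [_ ->] := lpnorm4_qds (A *m (s^-1 *: X)).
rewrite (_ : (fun i => _) = (fun i => s^-1 * mv A x i)); last first.
  by apply/funext => i; rewrite -scalemxAr mxE mvE XE.
by rewrite qZ exprVn ler_pdivrMl ?exprn_gt0// sE mulrC.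
Qed.

Section contraction.
Variables (n : nat) (A : 'M[R]_n) (rho : R).
Hypothesis rho0 : 0 < rho.
Hypothesis symA : forall i j, A i j = A j i.
Hypothesis A4 : forall x, qds (mv A x) <= rho ^+ 4 * qds x.

(* The squared l2-norms N k of the iterates A^k x are log-convex in k because A
   is symmetric, so they grow at least like (N 1 / N 0)^k; comparing with the
   l4-norms forces N 1 / N 0 <= rho^2. *)
Lemma sym_contract2 x : sqs (mv A x) <= rho ^+ 2 * sqs x.
Proof.
pose N k := sqs (iter k (mv A) x).
have N_ge0 k : 0 <= N k by exact: sqs_ge0.
have Nconv k : N k.+1 ^+ 2 <= N k * N k.+2.
  have -> : N k.+1 = dotp (iter k (mv A) x) (iter k.+2 (mv A) x).
    rewrite [iter k.+2 _ _]iterS dotp_mv//; apply: eq_bigr => i _; rewrite expr2.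
  exact: cauchy_schwarz.
rewrite leNgt; apply/negP => lt.
have {}lt : rho ^+ 2 * N 0%N < N 1%N by [].
have N0 : 0 < N 0%N.
  rewrite lt_neqAle N_ge0 andbT; apply/eqP => N00.
  suff N10 : N 1%N = 0 by move: lt; rewrite N10 -N00 mulr0 ltxx.
  apply: big1 => i _; rewrite /= /mv big1 ?expr0n// => j _.
  suff -> : x j = 0 by rewrite mulr0.
  move/esym/eqP: N00; rewrite psumr_eq0; last by move=> *; rewrite sqr_ge0.
  by move=> /allP /(_ j (mem_index_enum _)); rewrite expf_eq0/= => /eqP.
pose r := N 1%N / N 0%N.
have rgt : rho ^+ 2 < r by rewrite ltr_pdivlMr.
have r0 : 0 < r by apply: lt_trans rgt; rewrite exprn_gt0.
have step k : 0 < N k /\ r * N k <= N k.+1.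
  elim: k => [|k [Nk IH]]; first by split => //; rewrite divfK ?gt_eqF.
  have NS : 0 < N k.+1 by apply: lt_le_trans IH; rewrite mulr_gt0.
  split=> //; rewrite -(ler_pM2l Nk); apply: le_trans (Nconv k).
  by rewrite mulrCA mulrA expr2 ler_pM2r.
have Nge k : r ^+ k * N 0%N <= N k.
  elim: k => [|k IH]; first by rewrite expr0 mul1r.
  apply: le_trans (step k).2.
  by rewrite exprS -mulrA ler_pM2l.
have q4 k : qds (iter k (mv A) x) <= rho ^+ (4 * k) * qds x.
  elim: k => [|k IH]; first by rewrite muln0 expr0 mul1r.
  apply: le_trans (A4 _) _; rewrite mulnS exprD -mulrA ler_pM2l//.
  exact: exprn_gt0.
(* The lower bound on [N k ^+ 2] grows like r^(2k), the upper bound through the l4 norm like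
   rho^(4k); [t] is the ratio of the two rates. Bernoulli's inequality then makes t^k exceed any
   bound. *)
pose t := r ^+ 2 / rho ^+ 4.
have t1 : 1 < t.
  rewrite ltr_pdivlMr ?exprn_gt0// mul1r (exprM rho 2 2).
  by rewrite ltrXn2r// ?nnegrE ?exprn_ge0// ltW.
have bnd k : t ^+ k * N 0%N ^+ 2 <= n%:R * qds x.
  have rk : 0 < rho ^+ (4 * k) by rewrite exprn_gt0.
  rewrite expr_div_n -!exprM mulrAC ler_pdivrMr//.
  rewrite [(2 * k)%N]mulnC exprM -exprMn.
  apply: le_trans (_ : N k ^+ 2 <= _).
    by rewrite lerXn2r ?nnegrE ?mulr_ge0 ?exprn_ge0 ?N_ge0// ?(ltW r0) ?Nge.
  apply: le_trans (sqs_le_qds _) _.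
  by rewrite -mulrA ler_wpM2l// mulrC.
have bern k : 1 + k%:R * (t - 1) <= t ^+ k.
  elim: k => [|k IH]; first by rewrite mul0r addr0 expr0.
  rewrite exprS; apply: le_trans (_ : t * (1 + k%:R * (t - 1)) <= _); last first.
    by rewrite ler_pM2l// (lt_trans _ t1).
  rewrite -natr1 -subr_ge0.
  have -> : t * (1 + k%:R * (t - 1)) - (1 + (k%:R + 1) * (t - 1)) =
     k%:R * (t - 1) ^+ 2 by ring.
  by rewrite mulr_ge0 ?sqr_ge0.
have tm : 0 < t - 1 by rewrite subr_gt0.
pose K := n%:R * qds x / N 0%N ^+ 2 / (t - 1).
have K0 : 0 <= K by rewrite !divr_ge0 ?mulr_ge0 ?qds_ge0 ?exprn_ge0// ltW.
have := archi_boundP K0; set k := Num.bound K.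
rewrite /K ltr_pdivrMr// ltr_pdivrMr ?exprn_gt0// ltNge => /negP; apply.
apply: le_trans (bnd k).
rewrite ler_pM2r ?exprn_gt0//; apply: le_trans (bern _).
by rewrite lerDr.
Qed.
End contraction.

End vectors.

(** * Resolvent of D A for a diagonal D with entries in [0, 1] *)

Section resolvent.
Context {R : realType}.
Variables (n : nat) (A : 'M[R]_n) (rho : R).
Hypothesis rho01 : 0 < rho < 1.
Hypothesis symA : forall i j, A i j = A j i.
Hypothesis A2 : forall x : 'I_n -> R, sqs (mv A x) <= rho ^+ 2 * sqs x.
Hypothesis A4 : forall x : 'I_n -> R, qds (mv A x) <= rho ^+ 4 * qds x.

(** The contraction applied to the i-th basis vector bounds column i, which is row i by symmetry. *)
Lemma row_sqs_le1 i : \sum_j A i j ^+ 2 <= 1.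
Proof.
have /andP[r0 r1] := rho01.
have := A2 (fun j => (j == i)%:R).
rewrite {2}/sqs (bigD1 i)//= eqxx expr1n big1 ?addr0 ?mulr1; last first.
  by move=> j /negbTE ->; rewrite expr0n.
move=> h; apply: (@le_trans _ _ (rho ^+ 2)); last by rewrite expr_le1 ?ltW.
apply: le_trans h; rewrite /sqs ler_sum// => j _.
rewrite /mv (bigD1 i)//= eqxx mulr1 big1 ?addr0 1?symA//.
by move=> k /negbTE ->; rewrite mulr0.
Qed.

(** A row vector killed by [M] satisfies v = D A v, hence |v|^2 <= rho^2 |v|^2 and v = 0, so [M] is
    invertible. *)
Lemma resolvent_exists (d e : 'I_n -> R) : (forall i, 0 <= d i <= 1) ->
  exists w, forall i, w i = d i * (e i + mv A w i).
Proof.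
move=> d01; have /andP[r0 r1] := rho01.
pose M : 'M[R]_n := 1%:M - A *m diag_mx (\row_i d i).
have ME (v : 'rV[R]_n) j : (v *m M) 0 j = v 0 j - d j * mv A (v 0) j.
  rewrite mulmxBr mulmx1 mulmxA mul_mx_diag !mxE mulrC; congr (_ - _ * _).
  by apply: eq_bigr => i _; rewrite mulrC symA.
have Mu : M \in unitmx.
  rewrite -row_free_unit; apply: inj_row_free => v vM.
  have vE j : v 0 j = d j * mv A (v 0) j.
    by apply/eqP; rewrite -subr_eq0 -ME vM mxE.
  have : sqs (v 0) <= rho ^+ 2 * sqs (v 0).
    apply: le_trans (A2 _); rewrite /sqs ler_sum// => j _.
    rewrite [in leLHS]vE exprMn ler_piMl ?sqr_ge0//.
    by have /andP[? ?] := d01 j; rewrite expr_le1.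
  rewrite -subr_ge0 -{2}[sqs _]mul1r -mulrBl => h.
  have s0 : sqs (v 0) = 0.
    apply/eqP; rewrite eq_le sqs_ge0 andbT -(@nmulr_rge0 _ (rho ^+ 2 - 1))//.
    by rewrite subr_lt0 expr_lt1// ltW.
  apply/rowP => j; rewrite mxE; move/eqP: s0.
  rewrite psumr_eq0; last by move=> *; rewrite sqr_ge0.
  by move=> /allP /(_ j (mem_index_enum _)); rewrite expf_eq0/= => /eqP.
pose w : 'rV[R]_n := (\row_j (d j * e j)) *m invmx M.
exists (w 0) => j.
have : (w *m M) 0 j = d j * e j by rewrite mulmxKV// mxE.
by rewrite ME mulrDr => /eqP; rewrite subr_eq => /eqP.
Qed.

(** Convexity with weight 1 - rho gives |e + A w|^2 <= |e|^2 / (1 - rho) + rho |w|^2, and |w| <= |e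
    + A w| lets the last term be absorbed. *)
Lemma resolvent_bounds (d e w : 'I_n -> R) : (forall i, 0 <= d i <= 1) ->
  (forall i, w i = d i * (e i + mv A w i)) ->
  Num.sqrt (sqs w) <= Num.sqrt (sqs e) / (1 - rho) /\
  Num.sqrt (sqs (fun i => e i + mv A w i)) <= Num.sqrt (sqs e) / (1 - rho).
Proof.
move=> d01 wE; have /andP[r0 r1] := rho01.
have r1' : 0 < 1 - rho by rewrite subr_gt0.
have ww : sqs w <= sqs (fun i => e i + mv A w i).
  rewrite /sqs ler_sum// => j _; rewrite [in leLHS]wE exprMn ler_piMl ?sqr_ge0//.
  by have /andP[? ?] := d01 j; rewrite expr_le1.
have ew : sqs (fun i => e i + mv A w i) <= sqs e / (1 - rho) + rho * sqs w.
  apply: le_trans (sqs_add_le (1 - rho) _ _ _) _.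
    by rewrite r1' gtrBl.
  rewrite (_ : 1 - (1 - rho) = rho); last by ring.
  rewrite lerD2l ler_pdivrMr// mulrAC -expr2.
  exact: A2.
have w1 : sqs w <= sqs e / (1 - rho) ^+ 2.
  have := le_trans ww ew.
  rewrite -lerBlDr -{1}[sqs w]mul1r -mulrBl => h.
  by rewrite expr2 invfM mulrA ler_pdivlMr// mulrC.
have ew1 : sqs (fun i => e i + mv A w i) <= sqs e / (1 - rho) ^+ 2.
  apply: le_trans ew _; apply: le_trans (_ : sqs e / (1 - rho) +
    rho * (sqs e / (1 - rho) ^+ 2) <= _); first by rewrite lerD2l ler_pM2l.
  rewrite le_eqVlt; apply/orP; left; apply/eqP; field.
  by rewrite gt_eqF.
have sq : Num.sqrt (sqs e) / (1 - rho) = Num.sqrt (sqs e / (1 - rho) ^+ 2).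
  rewrite sqrtrM ?sqs_ge0// sqrtrV ?exprn_ge0 ?sqrtr_sqr ?gtr0_norm//.
  exact: ltW.
by rewrite sq; split; exact: ler_wsqrtr.
Qed.

End resolvent.

(** * Linearization of the conditional means at the external field *)

Section linearization.
Context {R : realType}.
Variables (n : nat) (A : 'M[R]_n) (rho : R) (b d x g : 'I_n -> R).
Hypothesis rho01 : 0 < rho < 1.
Hypothesis symA : forall i j, A i j = A j i.
Hypothesis A4 : forall x : 'I_n -> R, qds (mv A x) <= rho ^+ 4 * qds x.
Hypothesis gb : forall i, `|g i - b i| <= `|mv A x i|.

(** [x] is a state, [g] its vector of conditional means, [b] and [d] the values of psi' and psi'' at
    the external field. Keeping them abstract lets the same identities serve the random state and
    the optimizer, for which [g] equals [x]. *)
Let xi i := x i - g i.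
Let rem i := g i - b i - d i * mv A x i.

Hypothesis rem_le : forall i, `|rem i| <= 4 * mv A x i ^+ 2.

Lemma local_fieldE i :
  mv A x i = mv A b i + mv A xi i + mv A (fun i => g i - b i) i.
Proof.
rewrite -!mvD; apply: eq_bigr => j _; congr (_ * _).
by rewrite /xi; ring.
Qed.

(** Of the three parts of the field, [A (g - b)] is bounded through [gb] and [A4] by rho^4 times the
    left side; the weight 1 - rho turns this into rho, and absorbing it costs the fourth factor 1 -
    rho of the denominator. *)
Lemma qds_local_field :
  qds (mv A x) <= qds (fun i => mv A b i + mv A xi i) / (1 - rho) ^+ 4.
Proof.
have /andP[r0 r1] := rho01.
have r1' : 0 < 1 - rho by rewrite subr_gt0.
have h : qds (mv A x) <=
    qds (fun i => mv A b i + mv A xi i) / (1 - rho) ^+ 3 + rho * qds (mv A x).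
  rewrite {1}(_ : mv A x = fun i => mv A b i + mv A xi i + mv A (fun i => g i - b i) i).
    apply: le_trans (qds_add_le (1 - rho) _ _ _) _; first by rewrite r1' gtrBl.
    rewrite (_ : 1 - (1 - rho) = rho); last by ring.
    rewrite lerD2l ler_pdivrMr ?exprn_gt0//.
    apply: le_trans (A4 _) _.
    rewrite (_ : _ * rho ^+ 3 = rho ^+ 4 * qds (mv A x)); last by ring.
    rewrite ler_pM2l ?exprn_gt0//.
    apply: ler_sum => i _.
    exact: ler_pow4_norm.
  by apply/funext => i; exact: local_fieldE.
move: h; rewrite -lerBlDr -{1}[qds (mv A x)]mul1r -mulrBl => h.
by rewrite exprSr invfM mulrA ler_pdivlMr// mulrC.
Qed.

(** Two evaluations of w . (A x) are compared, one from the equation for [w], one from the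
    decomposition of the local field. Their common part cancels, and the first-order term e . (d A
    x) is left expressed through [xi], [A b] and [rem]. *)
Lemma linear_stat_eq (e w : 'I_n -> R) :
  (forall i, w i = d i * (e i + mv A w i)) ->
  dotp e (fun i => x i - b i) = dotp (fun i => e i + mv A w i) xi +
    dotp w (mv A b) + dotp (fun i => e i + mv A w i) rem.
Proof.
move=> wE.
have E1 : dotp w (mv A x) = dotp e (fun i => d i * mv A x i) +
    dotp (mv A w) (fun i => d i * mv A x i).
  rewrite -dotpDl; apply: eq_bigr => i _.
  by rewrite [in LHS]wE; ring.
have E2 : dotp w (mv A x) = dotp w (mv A b) + dotp (mv A w) xi +
   (dotp (mv A w) (fun i => d i * mv A x i) + dotp (mv A w) rem).
  rewrite -dotpDr -!dotp_mv// -!dotpDr; apply: eq_bigr => i _.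
  congr (_ * _); rewrite local_fieldE; congr (_ + _); apply: eq_bigr => j _.
  by congr (_ * _); rewrite /rem; ring.
have E3 : dotp e (fun i => x i - b i) =
    dotp e xi + dotp e (fun i => d i * mv A x i) + dotp e rem.
  by rewrite -!dotpDr; apply: eq_bigr => i _; rewrite /xi /rem; ring.
rewrite E3 !dotpDl; move: E1; rewrite E2 => /eqP.
by lra.
Qed.

Lemma linear_stat_rem (a : 'I_n -> R) :
  `|dotp a rem| <= Num.sqrt (sqs a) * (4 * Num.sqrt (qds (mv A x))).
Proof.
apply: le_trans (abs_dotp_le _ _) _; rewrite ler_wpM2l ?sqrtr_ge0//.
have -> : 4 * Num.sqrt (qds (mv A x)) = Num.sqrt (16 * qds (mv A x)).
  rewrite sqrtrM// (_ : 16 = 4 ^+ 2); last by rewrite -natrX.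
  by rewrite sqrtr_sqr ger0_norm.
rewrite ler_wsqrtr// /sqs /qds mulr_sumr ler_sum// => i _.
rewrite -real_normK ?num_real//.
have -> : 16 * mv A x i ^+ 4 = (4 * mv A x i ^+ 2) ^+ 2 by ring.
by rewrite lerXn2r ?nnegrE// mulr_ge0 ?sqr_ge0.
Qed.

Lemma linear_stat_le (e w : 'I_n -> R) : (forall i, 0 <= d i <= 1) ->
  (forall x : 'I_n -> R, sqs (mv A x) <= rho ^+ 2 * sqs x) ->
  (forall i, w i = d i * (e i + mv A w i)) ->
  `|dotp e (fun i => x i - b i)| <= `|dotp (fun i => e i + mv A w i) xi| +
    Num.sqrt (sqs e) / (1 - rho) *
      (Num.sqrt (sqs (mv A b)) + 4 * Num.sqrt (qds (mv A x))).
Proof.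
move=> d01 A2 wE.
have [w1 w2] := resolvent_bounds n A rho rho01 A2 d e w d01 wE.
rewrite (linear_stat_eq e w)// (le_trans (ler_normD _ _))//.
rewrite mulrDr addrA lerD//.
  rewrite (le_trans (ler_normD _ _))// lerD2l.
  by apply: le_trans (abs_dotp_le _ _) _; rewrite ler_wpM2r ?sqrtr_ge0.
apply: le_trans (linear_stat_rem _) _.
by rewrite ler_wpM2r// mulr_ge0// sqrtr_ge0.
Qed.

(* With q an approximate eigenvector of A, linearizing g at the external field
   turns the statistic q.x into 1/(1 - lam * v) times its naive centering. *)
Lemma eigen_stat_eq (q eps r : 'I_n -> R) (lam v : R) :
  (forall i, eps i = mv A q i - lam * q i) ->
  (forall i, r i = \sum_j A i j * q j * (d j - v)) ->
  (1 - lam * v) * dotp q x - dotp q b = dotp q xi + dotp q rem +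
    (v * dotp eps b + dotp r b) +
    (v * dotp eps (fun i => x i - b i) + dotp r (fun i => x i - b i)).
Proof.
move=> epsE rE.
have Er y : dotp r y = dotp q (fun i => (d i - v) * mv A y i).
  transitivity (dotp (mv A (fun j => q j * (d j - v))) y).
    by apply: eq_bigr => i _; rewrite rE; congr (_ * _); apply: eq_bigr => j _; ring.
  by rewrite -dotp_mv//; apply: eq_bigr => i _; ring.
have Ee y : dotp eps y = dotp q (mv A y) - lam * dotp q y.
  rewrite dotp_mv// /dotp mulr_sumr -sumrB; apply: eq_bigr => i _.
  by rewrite epsE; ring.
have lin : dotp q (fun i => d i * mv A x i) =
    v * dotp q (mv A x) + dotp q (fun i => (d i - v) * mv A x i).
  by rewrite /dotp mulr_sumr -big_split; apply: eq_bigr => i _ /=; ring.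
have E1 : dotp q x - dotp q b =
    dotp q xi + dotp q rem + dotp q (fun i => d i * mv A x i).
  by rewrite -dotpBr -!dotpDr; apply: eq_bigr => i _; rewrite /xi /rem; ring.
have E2 y : v * dotp eps b + dotp r b +
    (v * dotp eps (fun i => y i - b i) + dotp r (fun i => y i - b i)) =
    v * dotp eps y + dotp r y by rewrite !dotpBr; ring.
rewrite -addrA (E2 x) Er Ee mulrBl mul1r; move: E1; rewrite lin => /eqP.
by lra.
Qed.

End linearization.

(** * Exponential tilting *)

Section bounded_measurable.
Context {R : realType} {d : measure_display} {T : measurableType d}.
Implicit Types F G : T -> R.

(** The class of integrands used throughout: integrable under every probability measure, and closed
    under sums, products and exponentials. *)
Definition bdm F : Prop :=
  measurable_fun [set: T] F /\ exists B : R, forall x, `|F x| <= B.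

Lemma bdm_cst (a : R) : bdm (fun=> a).
Proof. by split; [exact: measurable_cst|exists `|a|]. Qed.

Lemma bdmD F G : bdm F -> bdm G -> bdm (fun x => F x + G x).
Proof.
move=> [mF [B FB]] [mG [C GC]]; split; first exact: measurable_funD.
by exists (B + C) => x; rewrite (le_trans (ler_normD _ _))// lerD.
Qed.

Lemma bdmM F G : bdm F -> bdm G -> bdm (fun x => F x * G x).
Proof.
move=> [mF [B FB]] [mG [C GC]]; split; first exact: measurable_funM.
by exists (B * C) => x; rewrite normrM ler_pM.
Qed.

Lemma bdmN F : bdm F -> bdm (fun x => - F x).
Proof.
move=> [mF [B FB]]; split; first exact: measurableT_comp.
by exists B => x; rewrite normrN.
Qed.

Lemma bdmB F G : bdm F -> bdm G -> bdm (fun x => F x - G x).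
Proof. by move=> bF bG; apply: bdmD => //; exact: bdmN. Qed.

Lemma bdmX F k : bdm F -> bdm (fun x => F x ^+ k).
Proof.
move=> bF; elim: k => [|k IH].
  by under eq_fun do rewrite expr0; exact: bdm_cst.
by under eq_fun do rewrite exprS; exact: bdmM.
Qed.

Lemma bdm_sum I (s : seq I) (F : I -> T -> R) :
  (forall i, bdm (F i)) -> bdm (fun x => \sum_(i <- s) F i x).
Proof.
move=> bF; elim: s => [|i s IH].
  by under eq_fun do rewrite big_nil; exact: bdm_cst.
by under eq_fun do rewrite big_cons; exact: bdmD.
Qed.

Lemma bdm_norm F : bdm F -> bdm (fun x => `|F x|).
Proof.
move=> [mF [B FB]]; split; first exact: measurableT_comp.
by exists B => x; rewrite normr_id.
Qed.

Lemma bdm_expR F : bdm F -> bdm (fun x => expR (F x)).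
Proof.
move=> [mF [B FB]]; split; first exact: measurableT_comp.
exists (expR B) => x; rewrite ger0_norm ?expR_ge0// ler_expR.
exact: le_trans (ler_norm _) (FB x).
Qed.

Lemma bdm_bound F : bdm F -> exists2 B : R, 0 <= B & forall x, `|F x| <= B.
Proof.
move=> [_ [B FB]]; exists `|B| => // x; exact: le_trans (FB x) (ler_norm _).
Qed.

End bounded_measurable.

Lemma bdm_comp {R : realType} {d d' : measure_display} {T : measurableType d}
  {T' : measurableType d'}
  (F : T' -> R) (h : T -> T') :
  measurable_fun [set: T] h -> bdm F -> bdm (fun x => F (h x)).
Proof.
move=> mh [mF [B FB]]; split; first exact: measurableT_comp.
by exists B => x; exact: FB.
Qed.

Section integral_bounded.
Context {R : realType} {d : measure_display} {T : measurableType d}.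
Variable P : probability T R.
Implicit Types F G : T -> R.

Lemma bdm_integrable F : bdm F -> P.-integrable [set: T] (EFin \o F).
Proof.
move=> [mF [B FB]]; apply: measurable_bounded_integrable => //.
  by rewrite (le_lt_trans (probability_le1 P measurableT))// ltry.
exists `|B|; split; first exact: num_real.
by move=> M BM x _; apply: le_trans (ltW BM); apply: le_trans (ler_norm _).
Qed.

Lemma IbdmD F G : bdm F -> bdm G ->
  \int[P]_x (F x + G x) = \int[P]_x F x + \int[P]_x G x.
Proof. by move=> bF bG; rewrite RintegralD//; exact: bdm_integrable. Qed.

Lemma IbdmZl a F : bdm F -> \int[P]_x (a * F x) = a * \int[P]_x F x.
Proof. by move=> bF; rewrite RintegralZl//; exact: bdm_integrable. Qed.

Lemma Ibdm_cst a : \int[P]_x a = a.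
Proof. by rewrite Rintegral_cst//= probability_setT mulr1. Qed.

Lemma le_Ibdm F G : bdm F -> bdm G -> (forall x, F x <= G x) ->
  \int[P]_x F x <= \int[P]_x G x.
Proof.
by move=> bF bG FG; apply: le_Rintegral => //; exact: bdm_integrable.
Qed.

Lemma Ibdm_gt0 F e : bdm F -> 0 < e -> (forall x, e <= F x) ->
  0 < \int[P]_x F x.
Proof.
move=> bF e0 eF; apply: lt_le_trans e0 _.
by rewrite -[leLHS]Ibdm_cst; apply: le_Ibdm => //; exact: bdm_cst.
Qed.

Lemma Ibdm_expR_gt0 F : bdm F -> 0 < \int[P]_x expR (F x).
Proof.
move=> bF; have [B _ FB] := bdm_bound F bF.
apply: (@Ibdm_gt0 _ (expR (- B))); [exact: bdm_expR|exact: expR_gt0|].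
by move=> x; rewrite ler_expR; have := FB x; rewrite ler_norml => /andP[].
Qed.

Lemma abs_Ibdm_le F B : bdm F -> (forall x, `|F x| <= B) ->
  `|\int[P]_x F x| <= B.
Proof.
move=> bF FB; rewrite ler_norml; apply/andP; split.
  rewrite -[leLHS]Ibdm_cst; apply: le_Ibdm => //; first exact: bdm_cst.
  by move=> x; have := FB x; rewrite ler_norml => /andP[].
rewrite -[leRHS]Ibdm_cst; apply: le_Ibdm => //; first exact: bdm_cst.
by move=> x; have := FB x; rewrite ler_norml => /andP[].
Qed.

(** The weight [F] lets one statement serve the numerator and, with [F] = 1, the denominator of a
    tilted mean. *)
Lemma is_derive_mgf F X (a : R) : bdm F -> bdm X ->
  is_derive a 1 (fun t : R => \int[P]_x (F x * expR (t * X x)))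
    (\int[P]_x (F x * X x * expR (a * X x))).
Proof.
move=> bF bX; have [B B0 FB] := bdm_bound F bF; have [C C0 XC] := bdm_bound X bX.
pose f t x := F x * expR (t * X x).
have bf t : bdm (f t).
  by apply: bdmM => //; apply: bdm_expR; apply: bdmM => //; exact: bdm_cst.
have df (t : R) x : is_derive t (1 : R) (f ^~ x) (F x * X x * expR (t * X x)).
  rewrite /f.
  have e : is_derive t (1 : R) (fun t : R => t * X x) (X x).
    by apply: is_derive_eq; rewrite /GRing.scale/=; ring.
  apply: is_derive_eq; rewrite /GRing.scale/=. by ring.
have Ia : `]a - 1, a + 1[%classic a.
  by rewrite /= in_itv/= ltrBlDr ltrDl ltr01.
have intf t : `]a - 1, a + 1[%classic t -> P.-integrable setT (EFin \o f t).
  by move=> _; exact: bdm_integrable.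
have dfv t x : `]a - 1, a + 1[%classic t -> [set: T] x -> derivable (f ^~ x) t 1.
  by move=> _ _; have [] := df t x.
(* Constant dominating function on ]a - 1, a + 1[, where |t| < |a| + 1. *)
pose G (x : T) := B * C * expR ((`|a| + 1) * C).
have G0 x : 0 <= G x by rewrite !mulr_ge0// expR_ge0.
have intG : P.-integrable setT (EFin \o G) by apply: bdm_integrable; exact: bdm_cst.
have d1E t x : partial1of2 f t x = F x * X x * expR (t * X x).
  by rewrite partial1of2E; have [] := df t x.
have Gub t x : `]a - 1, a + 1[%classic t -> [set: T] x -> `|partial1of2 f t x| <= G x.
  rewrite /= in_itv/= => /andP[at1 at2] _.
  rewrite d1E /G 2!normrM !ler_pM// ger0_norm ?expR_ge0// ler_expR.
  apply: le_trans (ler_norm _) _; rewrite normrM ler_pM//.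
  rewrite -(subrK a t) addrC (le_trans (ler_normD _ _))// lerD2l.
  by rewrite ler_norml; apply/andP; split; lra.
apply: DeriveDef.
  exact: (derivable_under_integral _ Ia intf dfv G0 intG Gub).
rewrite -derive1E.
rewrite (differentiation_under_integral _ Ia intf dfv G0 intG Gub)//.
by apply: eq_Rintegral => x _; rewrite d1E.
Qed.

End integral_bounded.

Section tilt.
Context {R : realType} {d : measure_display} {T : measurableType d}.
Variables (P : probability T R) (X : T -> R).
Hypothesis mX : measurable_fun [set: T] X.
Hypothesis X1 : forall x, `|X x| <= 1.
Implicit Types F G : T -> R.

(** For a base measure and X = [clip] this is the conditional law of a coordinate whose total field
    is t; its mean is psi' t and its variance psi'' t. *)
Definition tilt (t : R) F : R :=
  \int[P]_x (F x * expR (t * X x)) / \int[P]_x expR (t * X x).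

Let bX : bdm X. Proof. by split => //; exists 1. Qed.

Let be t : bdm (fun x => expR (t * X x)).
Proof. by apply: bdm_expR; apply: bdmM => //; exact: bdm_cst. Qed.

Let M0 t : 0 < \int[P]_x expR (t * X x).
Proof. by apply: Ibdm_expR_gt0; apply: bdmM => //; exact: bdm_cst. Qed.

Lemma tiltD t F G : bdm F -> bdm G ->
  tilt t (fun x => F x + G x) = tilt t F + tilt t G.
Proof.
move=> bF bG; rewrite /tilt -mulrDl -IbdmD; [|exact: bdmM|exact: bdmM].
by congr (_ / _); apply: eq_Rintegral => x _; rewrite mulrDl.
Qed.

Lemma tiltZ t a F : bdm F -> tilt t (fun x => a * F x) = a * tilt t F.
Proof.
move=> bF; rewrite /tilt mulrA -IbdmZl; last exact: bdmM.
by congr (_ / _); apply: eq_Rintegral => x _; rewrite mulrA.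
Qed.

Lemma tilt_cst t a : tilt t (fun=> a) = a.
Proof. by rewrite /tilt IbdmZl// mulfK// gt_eqF. Qed.

Lemma tiltB t F G : bdm F -> bdm G ->
  tilt t (fun x => F x - G x) = tilt t F - tilt t G.
Proof.
move=> bF bG; rewrite -[- tilt t G]mulN1r -tiltZ// -tiltD//.
  by congr tilt; apply/funext => x; rewrite mulN1r.
by apply: bdmM => //; exact: bdm_cst.
Qed.

Lemma le_tilt t F G : bdm F -> bdm G -> (forall x, F x <= G x) ->
  tilt t F <= tilt t G.
Proof.
move=> bF bG FG; rewrite ler_pM2r ?invr_gt0//.
by apply: le_Ibdm => [||x]; [exact: bdmM|exact: bdmM|rewrite ler_pM2r ?expR_gt0].
Qed.

Lemma abs_tilt_le t F B : bdm F -> (forall x, `|F x| <= B) -> `|tilt t F| <= B.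
Proof.
move=> bF FB; rewrite ler_norml -[X in X <= _](tilt_cst t (- B)).
rewrite -[X in _ && (_ <= X)](tilt_cst t B).
by rewrite !le_tilt//; try exact: bdm_cst;
  move=> x; have := FB x; rewrite ler_norml => /andP[].
Qed.

Lemma is_derive_tilt (t : R) F : bdm F ->
  is_derive t (1 : R) (tilt^~ F) (tilt t (fun x => F x * X x) - tilt t F * tilt t X).
Proof.
move=> bF; rewrite /tilt.
have d1 := is_derive_mgf P F X t bF bX.
have d2 : is_derive t (1 : R) (fun t : R => \int[P]_x expR (t * X x))
    (\int[P]_x (X x * expR (t * X x))).
  have := is_derive_mgf P (fun=> 1) X t (bdm_cst 1) bX.
  by under eq_fun do under eq_Rintegral do rewrite mul1r;
    under eq_Rintegral do rewrite mul1r.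
have M0' : \int[P]_x expR (t * X x) != 0 by rewrite gt_eqF.
apply: is_derive_eq => /=.
rewrite /GRing.scale/=; field.
exact: M0'.
Qed.

Lemma tilt_mean_le1 t : `|tilt t X| <= 1.
Proof. exact: abs_tilt_le. Qed.

Lemma tilt_lip B F s t : bdm F -> (forall x, `|F x| <= B) ->
  `|tilt s F - tilt t F| <= 2 * B * `|s - t|.
Proof.
move=> bF FB.
have B0 : 0 <= B by exact: le_trans (FB point).
wlog st : s t / t <= s.
  by move=> h; have [/h//|/ltW/h] := leP t s; rewrite distrC (distrC t).
have [r _ ->] := @MVT_segment _ (tilt^~ F)
  (fun t => tilt t (fun x => F x * X x) - tilt t F * tilt t X) _ _ st
  (fun x _ => is_derive_tilt x F bF) (derivable_within_continuous
    (fun x _ => @ex_derive _ _ _ _ _ _ _ (is_derive_tilt x F bF))).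
rewrite normrM ler_wpM2r// (le_trans (ler_normB _ _))// (_ : 2 * B = B + B * 1); last by ring.
rewrite lerD//; last by rewrite normrM ler_pM// ?abs_tilt_le.
apply: abs_tilt_le; first exact: bdmM.
by move=> x; rewrite normrM -[B]mulr1 ler_pM.
Qed.

Definition tilt_var t : R := tilt t (fun x => X x ^+ 2) - tilt t X ^+ 2.

Lemma tilt_varE t : tilt_var t = tilt t (fun x => (X x - tilt t X) ^+ 2).
Proof.
set a := tilt t X.
rewrite [in RHS](_ : (fun x => _) =
  fun x => X x ^+ 2 - (2 * a) * X x + a ^+ 2); last by apply/funext => x; ring.
have b2 : bdm (fun x => 2 * a * X x) by apply: bdmM => //; exact: bdm_cst.
rewrite (tiltD t (fun x => X x ^+ 2 - 2 * a * X x)); first last.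
- exact: bdm_cst.
- by apply: bdmB => //; exact: bdmX.
rewrite (tiltB t (fun x => X x ^+ 2))//; last exact: bdmX.
rewrite (tilt_cst t (a ^+ 2)) (tiltZ t (2 * a))// /tilt_var -/a.
by ring.
Qed.

Lemma tilt_var_bounds t : 0 <= tilt_var t <= 1.
Proof.
rewrite {1}tilt_varE; apply/andP; split.
  rewrite -(tilt_cst t 0) le_tilt ?tilt_cst//.
  - exact: bdm_cst.
  - by apply: bdmX; apply: bdmB => //; exact: bdm_cst.
  - by move=> x; exact: sqr_ge0.
rewrite /tilt_var lerBlDr; apply: (@le_trans _ _ 1); last by rewrite lerDl sqr_ge0.
apply: le_trans (ler_norm _) _; apply: abs_tilt_le; first exact: bdmX.
by move=> x; rewrite normrX expr_le1.
Qed.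

(** Takes the place of a bound on psi'''. The constant is 2 + 2: the second moment is 2-Lipschitz by
    [tilt_lip], and the squared mean is 2-Lipschitz because the mean is 1-Lipschitz and bounded by
    1. *)
Lemma tilt_var_lip s t : `|tilt_var s - tilt_var t| <= 4 * `|s - t|.
Proof.
have h1 : `|tilt s (fun x => X x ^+ 2) - tilt t (fun x => X x ^+ 2)| <= 2 * `|s - t|.
  rewrite -[X in X * _](mulr1 2); apply: tilt_lip; first exact: bdmX.
  by move=> x; rewrite normrX expr_le1.
have h2 : `|tilt s X ^+ 2 - tilt t X ^+ 2| <= 2 * `|s - t|.
  rewrite subr_sqr normrM mulrC ler_pM//.
    by rewrite (le_trans (ler_normD _ _))// (_ : 2 = 1 + 1)// lerD// tilt_mean_le1.
  have meandx (r : R) : is_derive r (1 : R) (tilt^~ X) (tilt_var r).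
    have := is_derive_tilt r X bX; rewrite /tilt_var -expr2.
    by under [X in tilt r X]eq_fun do rewrite -expr2.
  wlog st : s t {h1} / t <= s.
    by move=> h; have [/h//|/ltW/h] := leP t s; rewrite distrC (distrC t).
  have [r _ ->] := @MVT_segment _ (tilt^~ X) tilt_var _ _ st
    (fun x _ => meandx x) (derivable_within_continuous
    (fun x _ => @ex_derive _ _ _ _ _ _ _ (meandx x))).
  have /andP[v0 v1] := tilt_var_bounds r.
  by rewrite normrM ler_piMl// ger0_norm.
rewrite /tilt_var (_ : _ - _ = (tilt s (fun x => X x ^+ 2) - tilt t (fun x => X x ^+ 2))
  - (tilt s X ^+ 2 - tilt t X ^+ 2)); last first.
  by rewrite !opprD !opprK addrACA.
apply: le_trans (ler_normB _ _) _; apply: le_trans (lerD h1 h2) _.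
by move: `|s - t| => x; lra.
Qed.

End tilt.

(** * Log-Laplace transform and rate function of a base measure *)

Section clip.
Context {R : realType}.

(** Truncation to [-1, 1]: the identity almost surely under a base measure, and bounded on all of
    R. *)
Definition clip (y : R) : R := Num.max (-1) (Num.min 1 y).

Lemma abs_clip_le y : `|clip y| <= 1.
Proof.
rewrite ler_norml /clip; apply/andP; split; first by rewrite le_max lexx.
by rewrite ge_max ge_min lexx /= -subr_ge0 opprK addr_ge0.
Qed.

Lemma clip_id y : -1 <= y <= 1 -> clip y = y.
Proof. by move=> /andP[y1 y2]; rewrite /clip (min_r y2) (max_r y1). Qed.

Lemma measurable_clip : measurable_fun [set: R] clip.
Proof.
apply: measurable_maxr; first exact: measurable_cst.
by apply: measurable_minr; [exact: measurable_cst|exact: measurable_id].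
Qed.

Lemma bdm_clip : bdm clip.
Proof. by split; [exact: measurable_clip|exists 1; exact: abs_clip_le]. Qed.

End clip.

Section base_measure_theory.
Context {R : realType}.
Variable mu : probability R R.
Hypothesis hmu : base_measure mu.

Let N : set R := ~` `[-1, 1]%classic.

Let mN : measurable N. Proof. exact: measurableC. Qed.

Let N0 : mu N = 0%E.
Proof.
by rewrite probability_setC// (base_supported hmu) subee.
Qed.

Let notN x : (~` N) x -> -1 <= x <= 1.
Proof. by rewrite /N setCK /= in_itv. Qed.

Notation tm t := (tilt mu clip t clip).
Notation tv t := (tilt_var mu clip t).

(** The untruncated integrand may be unbounded off the support; both integrands being nonnegative,
    equality almost everywhere suffices. *)
Lemma psiE t : psi mu t = ln (\int[mu]_z expR (t * clip z)).
Proof.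
rewrite /psi /Rintegral; congr (ln (fine _)).
apply: ge0_ae_eq_integral => //.
- apply/measurable_EFinP/measurableT_comp => //; exact: mulrl_measurable.
- apply/measurable_EFinP/measurableT_comp => //.
  by apply: measurable_funM; [exact: measurable_cst|exact: measurable_clip].
exists N; split => // x /= h Nx; apply: h => _.
by rewrite clip_id//; exact: notN.
Qed.

Let be t : bdm (fun x : R => expR (t * clip x)).
Proof. by apply: bdm_expR; apply: bdmM; [exact: bdm_cst|exact: bdm_clip]. Qed.

Let M0 t : 0 < \int[mu]_x expR (t * clip x).
Proof. by apply: Ibdm_expR_gt0; apply: bdmM; [exact: bdm_cst|exact: bdm_clip]. Qed.

Lemma is_derive_psi (t : R) : is_derive t (1 : R) (psi mu) (tm t).
Proof.
have d2 : is_derive t (1 : R) (fun t : R => \int[mu]_x expR (t * clip x))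
    (\int[mu]_x (clip x * expR (t * clip x))).
  have := is_derive_mgf mu (fun=> 1) clip t (bdm_cst 1) bdm_clip.
  by under eq_fun do under eq_Rintegral do rewrite mul1r;
    under eq_Rintegral do rewrite mul1r.
rewrite (_ : psi mu = @ln R \o (fun t : R => \int[mu]_x expR (t * clip x))); last first.
  by apply/funext => s; rewrite psiE.
have d1 := @is_derive1_ln R _ (M0 t).
apply: is_derive_eq.
by rewrite /tilt /GRing.scale/= mulrC.
Qed.

Lemma derive1_psi : (psi mu)^`()%classic = fun t => tm t.
Proof.
by apply/funext => t; rewrite derive1E; have [_ ->] := is_derive_psi t.
Qed.

Lemma is_derive_tm (t : R) : is_derive t (1 : R) (fun t => tm t) (tv t).
Proof.
have := is_derive_tilt mu clip measurable_clip abs_clip_le t clip bdm_clip.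
by rewrite /tilt_var -expr2.
Qed.

Lemma derive2_psi : (psi mu)^`(2)%classic = fun t => tv t.
Proof.
apply/funext => t; rewrite derive1nS/= derive1_psi derive1E.
by have [_ ->] := is_derive_tm t.
Qed.

(** A vanishing variance would make [clip] almost surely equal to its tilted mean [a], and [mu]
    would have an atom of mass 1 there, against nondegeneracy. *)
Lemma tilt_var_gt0 t : 0 < tv t.
Proof.
have /andP[v0 _] := tilt_var_bounds mu clip measurable_clip abs_clip_le t.
rewrite lt_neqAle v0 andbT eq_sym; apply/eqP.
rewrite (tilt_varE _ _ measurable_clip abs_clip_le).
move: (tm t) => a; rewrite /tilt.
move=> /eqP; rewrite mulf_eq0 invr_eq0 (gt_eqF (M0 t)) orbF.
have bF : bdm (fun x : R => (clip x - a) ^+ 2 * expR (t * clip x)).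
  apply: bdmM => //; apply: bdmX; apply: bdmB; [exact: bdm_clip|exact: bdm_cst].
have F0 x : 0 <= (clip x - a) ^+ 2 * expR (t * clip x).
  by rewrite mulr_ge0 ?sqr_ge0 ?expR_ge0.
move=> /eqP I0.
have : (\int[mu]_x `| ((clip x - a) ^+ 2 * expR (t * clip x))%:E | = 0)%E.
  have := bdm_integrable mu _ bF => /(integrable_fin_num) => /(_ measurableT) fin.
  under eq_integral do rewrite gee0_abs ?lee_fin//.
  by rewrite -(fineK fin); apply/eqP; rewrite eqe; apply/eqP; exact: I0.
move=> /(ae_eq_integral_abs mu measurableT) => /(_ _).
have [mF _] := bF.
move=> /(_ (iffRL (measurable_EFinP _ _) mF))[M [mM M0' subM]].
apply: (@base_nondegenerate _ _ hmu a).
apply/eqP; rewrite eq_le probability_le1//=.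
rewrite -(probability_setT mu).
have -> : [set: R] = [set a] `|` (M `|` N).
  apply/seteqP; split => // x _ /=.
  have [xM|nxM] := pselect (M x); first by right; left.
  have [xN|nxN] := pselect (N x); first by right; right.
  left; have : ~ ~ ([set: R] x -> ((clip x - a) ^+ 2 * expR (t * clip x))%:E = 0%:E).
    by move=> h; apply: nxM; apply: subM.
  move=> /contrapT/(_ I)[] /eqP; rewrite mulf_eq0 (gt_eqF (expR_gt0 _)) orbF.
  rewrite expf_eq0/= subr_eq0 => /eqP <-; rewrite clip_id//.
  exact: notN.
apply: le_trans (measureU2 _ _ _) _ => //; first exact: measurableU.
rewrite -[leRHS]adde0 leeD2l//.
apply: le_trans (measureU2 _ _ _) _ => //.
by rewrite [X in (X + _)%E]M0' [X in (_ + X)%E]N0 adde0.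
Qed.

Let ctm a b : {within `[a, b], continuous (fun t => tm t)}.
Proof.
apply: derivable_within_continuous => x _.
exact: @ex_derive _ _ _ _ _ _ _ (is_derive_tm x).
Qed.

Let cpsi a b : {within `[a, b], continuous (psi mu)}.
Proof.
apply: derivable_within_continuous => x _.
exact: @ex_derive _ _ _ _ _ _ _ (is_derive_psi x).
Qed.

Lemma tilt_mean_lt s t : s < t -> tm s < tm t.
Proof.
move=> st; rewrite -subr_gt0.
have [r _ ->] := @MVT _ (fun t => tm t) (fun t => tv t) _ _ st
  (fun x _ => is_derive_tm x) (ctm s t).
by rewrite mulr_gt0 ?tilt_var_gt0 ?subr_gt0.
Qed.

Lemma tilt_mean_inj s t : tm s = tm t -> s = t.
Proof.
move=> e; have [/tilt_mean_lt|/tilt_mean_lt|//] := ltgtP s t; by rewrite e ltxx.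
Qed.

(** Strictness comes from monotonicity: the means at t - 1 and t + 1 already lie in [-1, 1]. *)
Lemma tilt_mean_bounds t : -1 < tm t < 1.
Proof.
have b s := tilt_mean_le1 mu clip measurable_clip abs_clip_le s.
have /ler_normlP[h1 _] := b (t - 1); have /ler_normlP[_ h2] := b (t + 1).
have l1 : tm (t - 1) < tm t by apply: tilt_mean_lt; rewrite ltrBlDr ltrDl.
have l2 : tm t < tm (t + 1) by apply: tilt_mean_lt; rewrite ltrDl.
move: (tm t) (tm (t - 1)) (tm (t + 1)) h1 h2 l1 l2 => x x1 x2 h1 h2 l1 l2.
by apply/andP; split; lra.
Qed.

Lemma psi_tangent_lt s t : s != t -> psi mu t + tm t * (s - t) < psi mu s.
Proof.
move=> st; have [lt|lt|e] := ltgtP s t; last by rewrite e eqxx in st.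
  have [r /[!in_itv]/= /andP[r1 r2] E] := @MVT _ (psi mu) (fun t => tm t) _ _ lt
    (fun x _ => is_derive_psi x) (cpsi s t).
  have st0 : 0 < t - s by rewrite subr_gt0.
  have := tilt_mean_lt _ _ r2; move: E.
  move: (psi mu t) (psi mu s) (tm t) (tm r) => a b x y E xy.
  have := xy; rewrite -(ltr_pM2r st0); lra.
have [r /[!in_itv]/= /andP[r1 r2] E] := @MVT _ (psi mu) (fun t => tm t) _ _ lt
  (fun x _ => is_derive_psi x) (cpsi t s).
have ts0 : 0 < s - t by rewrite subr_gt0.
have := tilt_mean_lt _ _ r1; move: E.
move: (psi mu t) (psi mu s) (tm t) (tm r) => a b x y E xy.
have := xy; rewrite -(ltr_pM2r ts0); lra.
Qed.

Lemma psi0 : psi mu 0 = 0.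
Proof.
rewrite psiE; under eq_Rintegral do rewrite mul0r expR0.
by rewrite Ibdm_cst ln1.
Qed.

(** Every neighbourhood of an endpoint s has positive mass p, so the integral of exp (s t z) is at
    least p exp (t (1 - eta)), and K = |ln p| works. This is what drives psi' to both ends of ]-1,
    1[. *)
Let psi_lower (s : R) : s = 1 \/ s = -1 -> forall eta, 0 < eta ->
  exists2 K, 0 <= K & forall t, 0 <= t -> t * (1 - eta) - K <= psi mu (s * t).
Proof.
move=> s1 eta eta0.
pose U : set R := ball s eta.
have mU : measurable U by exact: measurable_ball.
have : (0 < mu U)%E.
  have : msupport mu s.
    by case: s1 => ->; [exact: base_support1|exact: base_supportN1].
  by apply; [exact: ball_open|exact: ballxx].
have finU : mu U \is a fin_num by exact: fin_num_measure.
rewrite -(fineK finU) lte_fin; set p := fine (mu U) => p0.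
have le t : 0 <= t -> p * expR (t * (1 - eta)) <= \int[mu]_x expR ((s * t) * clip x).
  move=> t0.
  have bU : bdm (\1_U : R -> R).
    split; first exact: measurable_indic.
    by exists 1 => x; rewrite indicE; case: (_ \in _); rewrite ?normr1 ?normr0.
  have -> : p * expR (t * (1 - eta)) = \int[mu]_x (expR (t * (1 - eta)) * \1_U x).
    rewrite IbdmZl// mulrC; congr (_ * _).
    by rewrite /Rintegral integral_indic// setIT.
  apply: le_Ibdm => //; first by apply: bdmM => //; exact: bdm_cst.
  move=> x; rewrite indicE; case: (boolP (x \in U)); last first.
    by rewrite mulr0 expR_ge0.
  rewrite mulr1 ler_expR => /set_mem; rewrite /U /ball/= => h.
  rewrite mulrAC mulrC ler_wpM2r//; case: s1 h => ->.
    rewrite ltr_distl => /andP[_ h]; rewrite mul1r /clip le_max le_min.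
    by apply/orP; right; apply/andP; split; lra.
  rewrite distrC ltr_distl => /andP[_ h]; rewrite mulN1r lerNr opprB /clip ge_max ge_min.
  by apply/andP; split; [|apply/orP; right]; lra.
exists `|ln p| => // t t0.
rewrite psiE; apply: (@le_trans _ _ (ln (p * expR (t * (1 - eta))))).
  rewrite lnM ?posrE ?expR_gt0// expRK.
  by have := ler_norm (- ln p); rewrite normrN; lra.
by rewrite ler_ln ?posrE ?mulr_gt0 ?expR_gt0 ?le.
Qed.

Lemma tilt_mean_surj z : -1 < z < 1 -> exists t, tm t = z.
Proof.
move=> /andP[z1 z2].
have [t2 h2] : exists t, z <= tm t.
  (* [eta] is half the gap between z and 1, and [th] is large enough for K <= eta th. The mean slope
     of psi on [0, th] is then at least 1 - 2 eta = z, and psi' attains it somewhere. *)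
  pose eta := (1 - z) / 2; have eta0 : 0 < eta by rewrite divr_gt0// subr_gt0.
  have [K K0 h] := psi_lower 1 (or_introl erefl) eta eta0.
  pose th := K / eta + 1.
  have th0 : 0 < th by rewrite ltr_wpDl// divr_ge0// ltW.
  have := h _ (ltW th0); rewrite mul1r.
  have [r _ E] := @MVT _ (psi mu) (fun t => tm t) _ _ th0
    (fun x _ => is_derive_psi x) (cpsi 0 th).
  move: E; rewrite psi0 !subr0 => -> le; exists r.
  rewrite -(ler_pM2r th0); apply: le_trans le.
  have -> : z = 1 - 2 * eta by rewrite /eta; field.
  suff : K <= eta * th by lra.
  by rewrite /th mulrDr mulrC divfK ?gt_eqF// mulr1 lerDl ltW.
have [t1 h1] : exists t, tm t <= z.
  pose eta := (1 + z) / 2; have eta0 : 0 < eta by rewrite divr_gt0//; lra.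
  have [K K0 h] := psi_lower (-1) (or_intror erefl) eta eta0.
  pose th := K / eta + 1.
  have th0 : 0 < th by rewrite ltr_wpDl// divr_ge0// ltW.
  have := h _ (ltW th0); rewrite mulN1r.
  have nth : - th < 0 by rewrite oppr_lt0.
  have [r _ E] := @MVT _ (psi mu) (fun t => tm t) _ _ nth
    (fun x _ => is_derive_psi x) (cpsi (- th) 0).
  move: E; rewrite psi0 !sub0r opprK => E le; exists r.
  rewrite -(ler_pM2r th0) -E.
  suff : K <= eta * th.
    have -> : z = 2 * eta - 1 by rewrite /eta; field.
    by lra.
  by rewrite /th mulrDr mulrC divfK ?gt_eqF// mulr1 lerDl ltW.
have [le|lt] := leP t1 t2; last first.
  have := tilt_mean_lt _ _ lt; have : tm t1 <= tm t2 by exact: le_trans h2.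
  by rewrite leNgt => /negP.
have [|t _ tE] := @IVT R (fun t => tm t) t1 t2 z le (ctm _ _); last by exists t.
rewrite ge_min h1 le_max h2 orbT; exact: isT.
Qed.

Lemma phiK z : -1 < z < 1 -> tm (phi mu z) = z.
Proof.
move=> /tilt_mean_surj[t tE]; have := @pinvK _ _ (fun=> 0) [set: R] (fun t => tm t) z.
rewrite /phi derive1_psi; apply; rewrite inE; exists t => //.
Qed.

Lemma phi_tilt_mean t : phi mu (tm t) = t.
Proof. by apply: tilt_mean_inj; rewrite phiK// tilt_mean_bounds. Qed.

Lemma rate_tilt_mean m : rate_int mu (tm m) = tm m * m - psi mu m.
Proof. by rewrite /rate_int phi_tilt_mean. Qed.

Lemma fenchel z m : -1 < z < 1 -> z * m - psi mu m <= rate_int mu z.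
Proof.
move=> z1; rewrite /rate_int; have [->|ne] := eqVneq m (phi mu z).
  exact: lexx.
have := psi_tangent_lt _ _ ne; rewrite (phiK _ z1).
by move: (psi mu m) (psi mu (phi mu z)) (phi mu z) => a b x; lra.
Qed.

Lemma fenchel_lt z m : -1 < z < 1 -> z != tm m ->
  z * m - psi mu m < rate_int mu z.
Proof.
move=> z1 ne; rewrite /rate_int.
have ne' : m != phi mu z by apply: contra_neq ne => ->; rewrite phiK.
have := psi_tangent_lt _ _ ne'; rewrite (phiK _ z1).
by move: (psi mu m) (psi mu (phi mu z)) (phi mu z) => a b x; lra.
Qed.

(** Monotonicity away from psi' 0, here and in [rate_int_nhomo], makes the one-sided limits in
    [rate] genuine limits. *)
Lemma rate_int_homo x y : tm 0 <= x -> x <= y -> y < 1 -> rate_int mu x <= rate_int mu y.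
Proof.
move=> x0 xy y1; have /andP[m1 _] := tilt_mean_bounds 0.
have x1 : -1 < x < 1 by apply/andP; split; lra.
have y1' : -1 < y < 1 by apply/andP; split; lra.
have p0 : 0 <= phi mu x.
  rewrite leNgt; apply/negP => /tilt_mean_lt; rewrite phiK//; lra.
apply: le_trans (fenchel y (phi mu x) y1').
by rewrite /rate_int lerD2r ler_wpM2r.
Qed.

Lemma rate_int_nhomo x y : -1 < x -> x <= y -> y <= tm 0 -> rate_int mu y <= rate_int mu x.
Proof.
move=> x0 xy y1; have /andP[_ m1] := tilt_mean_bounds 0.
have x1 : -1 < x < 1 by apply/andP; split; lra.
have y1' : -1 < y < 1 by apply/andP; split; lra.
have p0 : phi mu y <= 0.
  rewrite leNgt; apply/negP => /tilt_mean_lt; rewrite phiK//; lra.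
apply: le_trans (fenchel x (phi mu y) x1).
by rewrite /rate_int lerD2r ler_wnM2r.
Qed.

Lemma rate_intE z : -1 < z < 1 -> rate mu z = (rate_int mu z)%:E.
Proof.
move=> /andP[z1 z2]; rewrite /rate lt_eqF//.
by rewrite gt_eqF.
Qed.

(** Carries Fenchel's inequality to the endpoint s, for any upper bound [l] of the rate between psi'
    0 and s. *)
Let squeeze_end (s m : R) (l : \bar R) : (s = 1 \/ s = -1) ->
  (forall z, -1 < z < 1 -> 0 <= s * (z - tm 0) -> ((rate_int mu z)%:E <= l)%E) ->
  ((s * m - psi mu m)%:E <= l)%E.
Proof.
move=> s1 h; have /andP[m1 m2] := tilt_mean_bounds 0.
case: l h => [r||] h; last first.
- have : ((rate_int mu (tm 0%R))%:E <= -oo)%E by apply: h; rewrite ?subrr ?mulr0// tilt_mean_bounds.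
  by move: (rate_int mu _) => a; rewrite leeNy_eq.
- by rewrite leey.
rewrite lee_fin; apply/ler_addgt0Pr => e e0.
(* The first bound keeps s - s t between psi' 0 and s, the second makes the error s t m at most
   e. *)
pose t := Num.min (1 - s * tm 0) (e / (`|m| + 1)).
have m0 : 0 < `|m| + 1 by rewrite ltr_wpDl.
have t0 : 0 < t.
  by rewrite lt_min divr_gt0// andbT; case: s1 => ->; lra.
have t1 : t <= 1 - s * tm 0 by rewrite ge_min lexx.
have t2 : t * (`|m| + 1) <= e by rewrite -ler_pdivlMr// ge_min lexx orbT.
have z1 : -1 < s - s * t < 1 by apply/andP; case: s1 t1 => ->; split; lra.
have hr : rate_int mu (s - s * t) <= r.
  by rewrite -lee_fin; apply: h => //; case: s1 t1 => -> ?; lra.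
have := fenchel _ m z1.
have : s * t * m <= e.
  apply: le_trans t2; rewrite mulrAC mulrC ler_pM2l//.
  case: s1 => ->; have := ler_norm m; have := ler_norm (- m); rewrite normrN; lra.
by rewrite mulrBl; lra.
Qed.

Lemma rate1_ge m : ((m - psi mu m)%:E <= rate mu 1)%E.
Proof.
rewrite /rate eqxx.
have /andP[m1 m2] := tilt_mean_bounds 0.
have hcv : (rate_int mu x)%:E @[x --> (1 : R)^'-] -->
    ereal_sup ((fun x => (rate_int mu (- x))%:E) @` `]-1, (- tm 0)[%classic).
  (* Reflection turns the left limit at 1 into a right limit at -1, where monotone convergence
     applies. *)
  apply/cvg_at_leftNP; apply: (nonincreasing_at_right_cvge (BLeft (- tm 0))).
    by rewrite bnd_simp ltrN2.
  move=> x y; rewrite !in_itv/= => /andP[x1 x2] /andP[y1 y2] xy.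
  by rewrite lee_fin rate_int_homo//; lra.
rewrite (cvg_lim _ hcv)//.
rewrite -[m in (m - _)]mul1r; apply: squeeze_end; first by left.
move=> z /andP[z1 z2]; rewrite mul1r subr_ge0 => z3.
(* The midpoint lies strictly beyond psi' 0 even when z = psi' 0, as the open interval in the
   supremum requires. *)
pose z' := (z + 1) / 2.
apply: (@le_trans _ _ (rate_int mu z')%:E).
  by rewrite lee_fin rate_int_homo// /z'; lra.
apply: ereal_sup_ubound; exists (- z') => /=; last by rewrite opprK.
by rewrite in_itv/= /z'; apply/andP; split; lra.
Qed.

Lemma rateN1_ge m : ((- m - psi mu m)%:E <= rate mu (-1))%E.
Proof.
rewrite /rate [-1 == 1]lt_eqF ?eqxx; last by lra.
have /andP[m1 m2] := tilt_mean_bounds 0.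
have hcv : (rate_int mu x)%:E @[x --> (-1 : R)^'+] -->
    ereal_sup ((fun x => (rate_int mu x)%:E) @` `]-1, (tm 0)[%classic).
  apply: (nonincreasing_at_right_cvge (BLeft (tm 0))); first by rewrite bnd_simp.
  move=> x y; rewrite !in_itv/= => /andP[x1 x2] /andP[y1 y2] xy.
  by rewrite lee_fin rate_int_nhomo//; lra.
rewrite (cvg_lim _ hcv)//.
rewrite -[- m]mulN1r; apply: squeeze_end; first by right.
move=> z /andP[z1 z2]; rewrite mulN1r oppr_ge0 subr_le0 => z3.
pose z' := (z - 1) / 2.
apply: (@le_trans _ _ (rate_int mu z')%:E).
  by rewrite lee_fin rate_int_nhomo// /z'; lra.
apply: ereal_sup_ubound; exists z' => //=.
by rewrite in_itv/= /z'; apply/andP; split; lra.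
Qed.

Lemma rate_ge0 z : -1 <= z <= 1 -> (0 <= rate mu z)%E.
Proof.
move=> /andP[z1 z2]; have [->|n1] := eqVneq z 1.
  by apply: le_trans (rate1_ge 0); rewrite psi0 subrr.
have [->|n2] := eqVneq z (-1).
  by apply: le_trans (rateN1_ge 0); rewrite psi0 oppr0 addr0.
have z01 : -1 < z < 1 by rewrite !lt_neqAle z1 z2 n1 eq_sym n2.
by rewrite rate_intE// lee_fin; apply: le_trans (fenchel z 0 z01); rewrite psi0 mulr0 subrr.
Qed.

(** Equality case of Fenchel's inequality, endpoints excluded: z = 1 would give psi (m + 1) - psi m
    >= 1, and z = -1 would give psi m - psi (m - 1) <= -1, whereas psi' stays in ]-1, 1[. *)
Lemma rate_le_tangent z m : -1 <= z <= 1 ->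
  (rate mu z <= (z * m - psi mu m)%:E)%E -> z = tm m.
Proof.
move=> /andP[z1 z2]; have [->|n1] := eqVneq z 1.
  move=> /(le_trans (rate1_ge (m + 1))); rewrite lee_fin => h.
  have lt : m < m + 1 by rewrite ltrDl.
  have [r _ E] := @MVT _ (psi mu) (fun t => tm t) _ _ lt
    (fun x _ => is_derive_psi x) (cpsi m (m + 1)).
  have /andP[_ +] := tilt_mean_bounds r.
  by move: (tm r) (psi mu m) (psi mu (m + 1)) E h => x a b; lra.
have [->|n2] := eqVneq z (-1).
  move=> /(le_trans (rateN1_ge (m - 1))); rewrite lee_fin => h.
  have lt : m - 1 < m by rewrite ltrBlDr ltrDl.
  have [r _ E] := @MVT _ (psi mu) (fun t => tm t) _ _ lt
    (fun x _ => is_derive_psi x) (cpsi (m - 1) m).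
  have /andP[+ _] := tilt_mean_bounds r.
  by move: (tm r) (psi mu m) (psi mu (m - 1)) E h => x a b; lra.
have z01 : -1 < z < 1 by rewrite !lt_neqAle z1 z2 n1 eq_sym n2.
rewrite rate_intE// lee_fin leNgt => /negP h; apply/eqP/negPn/negP => ne.
by apply: h; exact: fenchel_lt.
Qed.

End base_measure_theory.

(** * One-coordinate changes of the Hamiltonian and the fixed-point equation of the optimizer *)

Section coordinate_update.
Context {R : realType} {n : nat}.
Implicit Types (A : 'M[R]_n) (z c : 'I_n -> R) (i : 'I_n) (y : R).

Definition upd z i y : 'I_n -> R := fun j => if j == i then y else z j.

Definition ham A c z : R := 2^-1 * dotp z (mv A z) + dotp c z.

Lemma upd_id z i y : upd z i y i = y.
Proof. by rewrite /upd eqxx. Qed.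

Lemma upd_neq z i y j : j != i -> upd z i y j = z j.
Proof. by rewrite /upd => /negbTE ->. Qed.

Lemma upd_upd z i y : upd (upd z i y) i (z i) = z.
Proof. by apply/funext => j; rewrite /upd; case: eqVneq => [->|]. Qed.

Lemma dotp_upd c z i y : dotp c (upd z i y) = dotp c z + c i * (y - z i).
Proof.
rewrite /dotp (bigD1 i)//= [in RHS](bigD1 i)//= upd_id mulrBr.
rewrite [X in _ + X = _](eq_bigr (fun j => c j * z j)); first by ring.
by move=> j ji; rewrite upd_neq.
Qed.

Lemma mv_upd A z i y k : mv A (upd z i y) k = mv A z k + A k i * (y - z i).
Proof. exact: dotp_upd. Qed.

(** The zero diagonal makes the Hamiltonian affine in each coordinate, with the local field as
    slope. The fixed-point equation and reversibility both rest on this. *)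
Lemma ham_upd A c z i y : (forall i j, A i j = A j i) -> A i i = 0 ->
  ham A c (upd z i y) = ham A c z + (y - z i) * (mv A z i + c i).
Proof.
move=> sA A0; rewrite /ham dotp_upd.
have -> : dotp (upd z i y) (mv A (upd z i y)) =
    dotp z (mv A z) + 2 * (y - z i) * mv A z i.
  rewrite dotpC dotp_upd mv_upd A0 mul0r addr0.
  by rewrite dotpC dotp_mv// dotp_upd (dotpC (mv A z)); ring.
by field.
Qed.

Lemma hamiltonianE A (c z : 'cV[R]_n) :
  hamiltonian A c z = ham A (fun i => c i 0) (fun i => z i 0).
Proof.
rewrite /hamiltonian /ham; congr (_ * _ + _).
  rewrite -mulmxA mxE; apply: eq_bigr => i _.
  by rewrite mxE mvE.
by rewrite mxE; apply: eq_bigr => i _; rewrite mxE.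
Qed.

End coordinate_update.

Section optimizer.
Context {R : realType} {n : nat}.
Variables (mu : 'I_n -> probability R R) (A : 'M[R]_n) (c u : 'cV[R]_n).
Hypothesis hmu : forall i, base_measure (mu i).
Hypothesis symA : forall i j, A i j = A j i.
Hypothesis A0 : forall i, A i i = 0.

(** Comparing [u] with the vector whose coordinate i is moved to psi' of its field shows that u_i
    attains equality in Fenchel's inequality. *)
Lemma mean_field_fixed_point : mean_field_optimizer mu A c u -> forall i,
  u i 0 = tilt (mu i) clip (mv A (fun j => u j 0) i + c i 0) clip.
Proof.
move=> [cubeu maxu] i.
set m := mv A _ i + _.
(* The rates at [u] are finite because the functional is finite at the point with coordinates psi'
   0; only then can the unchanged coordinates be cancelled. *)
have [r rE] : exists r : 'I_n -> R, forall j, rate (mu j) (u j 0) = (r j)%:E.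
  suff fin j : rate (mu j) (u j 0) \is a fin_num.
    by exists (fun j => fine (rate (mu j) (u j 0))) => j; rewrite fineK.
  have rge0 k : (0 <= rate (mu k) (u k 0%R))%E by apply: rate_ge0.
  have [z cubez zE] : exists2 z : 'cV[R]_n, in_cube z &
      forall k, rate (mu k) (z k 0) = (rate_int (mu k) (z k 0))%:E.
    exists (\col_k tilt (mu k) clip 0 clip) => k; rewrite mxE.
      by have /andP[? ?] := tilt_mean_bounds (mu k) (hmu k) 0; rewrite !ltW.
    by rewrite rate_intE// tilt_mean_bounds.
  have := maxu z cubez; rewrite /mean_field_functional.
  under [X in (_ - X <= _)%E]eq_bigr do rewrite zE.
  rewrite sumEFin -EFinB => h.
  have : (\sum_(k < n) rate (mu k) (u k 0%R) < +oo)%E.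
    rewrite ltey; apply/eqP => e; move: h; rewrite e /=.
    by rewrite addeNy leeNy_eq.
  rewrite ge0_fin_numE// (bigD1 j)//=; apply: le_lt_trans.
  by rewrite leeDl// sume_ge0.
pose tm := tilt (mu i) clip m clip.
have tmb : -1 < tm < 1 := tilt_mean_bounds (mu i) (hmu i) m.
have rtm : rate (mu i) tm = (tm * m - psi (mu i) m)%:E.
  by rewrite (rate_intE _ _ tmb) (rate_tilt_mean _ (hmu i)).
have [z zE] : exists z : 'cV[R]_n, (fun k => z k 0) = upd (fun j => u j 0) i tm.
  by exists (\col_k upd (fun j => u j 0) i tm k); apply/funext => k; rewrite mxE.
have zi : z i 0 = tm by have := congr1 (@^~ i) zE; rewrite /= upd_id.
have zj j : j != i -> z j 0 = u j 0.
  by move=> ji; have := congr1 (@^~ j) zE; rewrite /= upd_neq.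
move: tm rtm tmb zE zi => tm rtm tmb zE zi.
have cubez : in_cube z.
  move=> k; have [->|ki] := eqVneq k i; last by rewrite zj.
  by rewrite zi; have /andP[p1 p2] := tmb; rewrite !ltW.
have sumz : (\sum_(k < n) rate (mu k) (z k 0%R) =
    (tm * m - psi (mu i) m + \sum_(k < n | k != i) r k)%:E)%E.
  rewrite (bigD1 i isT) zi rtm [in RHS]EFinD -sumEFin; congr (_ + _)%E.
  by apply: eq_bigr => k ki; rewrite zj.
have sumu : (\sum_(k < n) rate (mu k) (u k 0%R) =
    (r i + \sum_(k < n | k != i) r k)%:E)%E.
  by rewrite -[in RHS](bigD1 i isT) -sumEFin; apply: eq_bigr.
have h : hamiltonian A c z - (tm * m - psi (mu i) m + \sum_(k < n | k != i) r k) <=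
    hamiltonian A c u - (r i + \sum_(k < n | k != i) r k).
  by rewrite -lee_fin !EFinB -sumz -sumu; exact: maxu.
rewrite !hamiltonianE zE (ham_upd _ _ _ _ _ symA (A0 i)) -/m in h.
apply: (rate_le_tangent (mu i) (hmu i) _ m (cubeu i)).
by rewrite rE lee_fin; lra.
Qed.

End optimizer.

(** * Reversible resampling of one coordinate *)

Section coordinate_swap.
Context {R : realType}.

Definition tupd {n} (x : n.-tuple R) (i : 'I_n) (y : R) : n.-tuple R :=
  [tuple if j == i then y else tnth x j | j < n].

Lemma tnth_tupd {n} (x : n.-tuple R) i y j :
  tnth (tupd x i y) j = if j == i then y else tnth x j.
Proof. by rewrite tnth_mktuple. Qed.

Lemma tupd_cons0 {n} (a : R) (x : n.-tuple R) y :
  tupd (tuple_cons (a, x)) ord0 y = tuple_cons (y, x).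
Proof.
apply: eq_from_tnth => j; rewrite tnth_tupd.
by case: (unliftP ord0 j) => [k|] ->; rewrite /tuple_cons ?tnthS ?tnth0.
Qed.

Lemma tupd_consS {n} (a : R) (x : n.-tuple R) i y :
  tupd (tuple_cons (a, x)) (lift ord0 i) y = tuple_cons (a, tupd x i y).
Proof.
apply: eq_from_tnth => j; rewrite tnth_tupd.
case: (unliftP ord0 j) => [k|] ->; rewrite /tuple_cons ?tnthS ?tnth0//.
by rewrite tnth_tupd (inj_eq lift_inj).
Qed.

Lemma measurable_tupd {n} (i : 'I_n) d (T : measurableType d)
    (f : T -> n.-tuple R) (g : T -> R) :
  measurable_fun [set: T] f -> measurable_fun [set: T] g ->
  measurable_fun [set: T] (fun p => tupd (f p) i (g p)).
Proof.
move=> mf mg; apply/measurable_fun_tnthP => j.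
rewrite (_ : _ \o _ = fun p => if j == i then g p else tnth (f p) j); last first.
  by apply/funext => p /=; rewrite tnth_tupd.
case: (j == i) => //.
exact: (measurableT_comp (measurable_tnth j)).
Qed.

Lemma measurable_tuple_cons2 {n} d (T : measurableType d)
    (f : T -> R) (g : T -> n.-tuple R) :
  measurable_fun [set: T] f -> measurable_fun [set: T] g ->
  measurable_fun [set: T] (fun p => tuple_cons (f p, g p)).
Proof. by move=> mf mg; exact: measurable_cons. Qed.

Local Open Scope ereal_scope.

Lemma integral_product_probS n (mu : 'I_n.+1 -> probability R R)
    (f : n.+1.-tuple R -> \bar R) :
  measurable_fun [set: n.+1.-tuple R] f -> (forall x, 0 <= f x) ->
  \int[product_prob mu]_x f x = \int[mu ord0]_a
    \int[product_prob (fun i => mu (lift ord0 i))]_x f (tuple_cons (a, x)).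
Proof.
move=> mf f0 /=.
rewrite (ge0_integral_distribution _ mf f0).
rewrite (fubini_tonelli1 (f \o @tuple_cons R n))//.
- by apply: measurableT_comp => //; exact: measurable_tuple_cons2.
- by move=> x; exact: f0.
Qed.

(** Coordinate i and the fresh variable are independent with the same law. Induction peels off the
    head: if i is the head, the exchange is Tonelli for two copies of [mu ord0]; otherwise the head
    is held fixed. *)
Lemma integral_swap_coordinate n (mu : 'I_n -> probability R R) (i : 'I_n)
    (f : n.-tuple R * R -> \bar R) :
  measurable_fun [set: n.-tuple R * R] f -> (forall p, 0 <= f p) ->
  \int[product_prob mu]_x \int[mu i]_y f (x, y) =
  \int[product_prob mu]_x \int[mu i]_y f (tupd x i y, tnth x i).
Proof.
elim: n mu i f => [? []//|n IH] mu i f mf f0.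
have mf' : measurable_fun [set: n.+1.-tuple R * R]
    (fun p => f (tupd p.1 i p.2, tnth p.1 i)).
  apply: measurableT_comp => //; apply: measurable_fun_pair.
    exact: measurable_tupd.
  exact: (measurableT_comp (measurable_tnth i)).
rewrite [LHS]integral_product_probS; first last.
- by move=> x; apply: integral_ge0.
- exact: (measurable_fun_fubini_tonelli_F f).
rewrite [RHS]integral_product_probS; first last.
- by move=> x; apply: integral_ge0.
- exact: (measurable_fun_fubini_tonelli_F (fun p => f (tupd p.1 i p.2, tnth p.1 i))).
case: (unliftP ord0 i) => [j|] ie; last first.
  rewrite ie; set P' := product_prob _.
  have mg : measurable_fun [set: (R * R) * n.-tuple R]
      (fun p => f (tuple_cons (p.1.1, p.2), p.1.2)).
    apply: measurableT_comp => //; apply: measurable_fun_pair => /=.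
      by apply: measurable_tuple_cons2 => //; exact: measurableT_comp.
    exact: measurableT_comp.
  pose h (p : R * R) := \int[P']_x f (tuple_cons (p.1, x), p.2).
  have mh : measurable_fun [set: R * R] h.
    exact: (measurable_fun_fubini_tonelli_F (fun p => f (tuple_cons (p.1.1, p.2), p.1.2))).
  have h0 p : 0 <= h p by exact: integral_ge0.
  transitivity (\int[mu ord0]_a \int[mu ord0]_y h (a, y)).
    apply: eq_integral => a _.
    rewrite (fubini_tonelli (fun p : n.-tuple R * R => f (tuple_cons (a, p.1), p.2)))//.
    apply: measurableT_comp => //; apply: measurable_fun_pair => //.
    exact: measurable_tuple_cons2.
  rewrite (fubini_tonelli h)//.
  apply: eq_integral => a _.
  rewrite -(fubini_tonelli (fun p : n.-tuple R * R => f (tuple_cons (p.2, p.1), a)))/=.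
  - apply: eq_integral => x _; apply: eq_integral => y _.
    by rewrite tupd_cons0 /tuple_cons tnth0.
  - apply: measurableT_comp => //; apply: measurable_fun_pair => //.
    exact: measurable_tuple_cons2.
  - by [].
apply: eq_integral => a _.
rewrite ie (IH (fun i => mu (lift ord0 i)) j (fun p => f (tuple_cons (a, p.1), p.2)));
  last by move=> p; exact: f0.
- apply: eq_integral => x _; apply: eq_integral => y _.
  by rewrite tupd_consS /tuple_cons tnthS.
- apply: measurableT_comp => //; apply: measurable_fun_pair => //.
  exact: measurable_tuple_cons2.
Qed.

End coordinate_swap.

Section iterated_integral.
Context {R : realType} {d1 d2 : measure_display}
  {T1 : measurableType d1} {T2 : measurableType d2}.
Variables (P1 : probability T1 R) (P2 : probability T2 R).

Lemma EFin_Ibdm d (T : measurableType d) (P : probability T R) (F : T -> R) :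
  bdm F -> (\int[P]_x (F x)%:E)%E = (\int[P]_x F x)%:E.
Proof.
move=> bF; rewrite /Rintegral fineK//.
by apply: (integrable_fin_num measurableT); exact: bdm_integrable.
Qed.

Lemma bdm_section1 (F : T1 * T2 -> R) x : bdm F -> bdm (fun y => F (x, y)).
Proof. by move=> bF; apply: (bdm_comp F) => //; exact: measurable_fun_pair. Qed.

Lemma bdm_partial_integral (F : T1 * T2 -> R) : bdm F ->
  bdm (fun x => \int[P2]_y F (x, y)).
Proof.
move=> bF; have [B B0 FB] := bdm_bound F bF; split; last first.
  exists B => x; apply: abs_Ibdm_le => //; exact: bdm_section1.
have := @measurable_fubini_F _ _ _ _ _ P1 P2 (EFin \o F) (bdm_integrable _ _ bF).
rewrite (_ : fubini_F _ _ = fun x => (\int[P2]_y F (x, y))%:E).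
  by move/measurable_EFinP.
apply/funext => x; rewrite /fubini_F -EFin_Ibdm//.
exact: bdm_section1.
Qed.

End iterated_integral.

(** Adding the bound B makes the integrand nonnegative, so that the Tonelli version applies; B
    cancels at the end. *)
Lemma Rintegral_swap_coordinate {R : realType} n (mu : 'I_n -> probability R R)
    (i : 'I_n) (F : n.-tuple R * R -> R) : bdm F ->
  \int[product_prob mu]_x \int[mu i]_y F (x, y) =
  \int[product_prob mu]_x \int[mu i]_y F (tupd x i y, tnth x i).
Proof.
move=> bF; have [B B0 FB] := bdm_bound F bF.
have bF' : bdm (fun p : n.-tuple R * R => F (tupd p.1 i p.2, tnth p.1 i)).
  apply: (bdm_comp F) => //; apply: measurable_fun_pair.
    exact: measurable_tupd.
  exact: (measurableT_comp (measurable_tnth i)).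
have E (G : n.-tuple R * R -> R) : bdm G ->
    (\int[product_prob mu]_x \int[mu i]_y (G (x, y) + B)%:E)%E =
    ((\int[product_prob mu]_x \int[mu i]_y G (x, y)) + B)%:E.
  move=> bG.
  have bGB : bdm (fun p => G p + B) by apply: bdmD => //; exact: bdm_cst.
  under eq_integral do rewrite (EFin_Ibdm _ _ _ _ (bdm_section1 _ _ bGB)).
  rewrite EFin_Ibdm; last exact: (bdm_partial_integral (product_prob mu) (mu i) _ bGB).
  congr (_%:E).
  rewrite -[in RHS](Ibdm_cst (product_prob mu) B) -IbdmD; last exact: bdm_cst.
    apply: eq_Rintegral => x _.
    rewrite IbdmD; [by rewrite Ibdm_cst|exact: bdm_section1|exact: bdm_cst].
  exact: (bdm_partial_integral (product_prob mu) (mu i) _ bG).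
have h := @integral_swap_coordinate R n mu i (fun p => (F p + B)%:E).
have {}h : ((\int[product_prob mu]_x \int[mu i]_y F (x, y)) + B)%:E =
    ((\int[product_prob mu]_x \int[mu i]_y F (tupd x i y, tnth x i)) + B)%:E.
  rewrite -(E _ bF) -(E _ bF'); apply: h.
  - apply/measurable_EFinP; apply: measurable_funD; [by have [] := bF|].
    exact: measurable_cst.
  - by move=> p; rewrite lee_fin -lerBlDr sub0r; have /ler_normlP[? _] := FB p; lra.
by case: h => /addIr.
Qed.

Lemma bdmV {R : realType} {d : measure_display} {T : measurableType d}
    (F : T -> R) (e : R) :
  bdm F -> 0 < e -> (forall x, e <= F x) -> bdm (fun x => (F x)^-1).
Proof.
move=> [mF _] e0 eF; have F0 x : 0 < F x by exact: lt_le_trans (eF x).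
split.
  (* Measurability of the inverse is read off from the composition exp (- ln). *)
  rewrite (_ : (fun x => _) = fun x => expR (- ln (F x))); last first.
    by apply/funext => x; rewrite expRN lnK// posrE.
  apply: measurableT_comp => //; apply: measurableT_comp => //.
  exact: (measurableT_comp (@measurable_ln R)).
by exists e^-1 => x; rewrite gtr0_norm ?invr_gt0// lef_pV2 ?posrE.
Qed.

(** * Expectations under the model and the single-site resampling kernel *)

Section gibbs.
Context {R : realType} {n : nat}.
Variables (mu : 'I_n -> probability R R) (A : 'M[R]_n) (c : 'I_n -> R).
Hypothesis symA : forall i j, A i j = A j i.
Hypothesis A0 : forall i, A i i = 0.
Implicit Types (F : ('I_n -> R) -> R) (G K : ('I_n -> R) -> R -> R)
  (z : 'I_n -> R) (i : 'I_n).

Notation P0 := (product_prob mu).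

Definition clip_state (x : n.-tuple R) : 'I_n -> R := fun i => clip (tnth x i).
Definition cube z : Prop := forall i, `|z i| <= 1.

Lemma cube_clip_state x : cube (clip_state x).
Proof. by move=> i; exact: abs_clip_le. Qed.

Lemma clip_state_surj z : cube z -> exists x, clip_state x = z.
Proof.
move=> cz; exists [tuple z j | j < n]; apply/funext => j.
by rewrite /clip_state tnth_mktuple clip_id// -ler_norml.
Qed.

Lemma clip_state_tupd x i y : clip_state (tupd x i y) = upd (clip_state x) i (clip y).
Proof. by apply/funext => j; rewrite /clip_state tnth_tupd /upd; case: eqP. Qed.

Lemma cube_upd z i y : cube z -> `|y| <= 1 -> cube (upd z i y).
Proof. by move=> cz y1 j; rewrite /upd; case: eqP. Qed.

(* The observables enter the expectations only through their values on the
   cube, where all of them are bounded. *)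
Definition bS F : Prop := bdm (fun x : n.-tuple R => F (clip_state x)).
Definition bS2 G : Prop :=
  bdm (fun p : n.-tuple R * R => G (clip_state p.1) (clip p.2)).

Lemma bS_cst (a : R) : bS (fun=> a).
Proof. exact: bdm_cst. Qed.

Lemma bS_coord i : bS (fun z => z i).
Proof.
by apply: (bdm_comp clip (fun x : n.-tuple R => tnth x i));
  [exact: measurable_tnth|exact: bdm_clip].
Qed.

Lemma bS_dotp (a : 'I_n -> R) : bS (dotp a).
Proof.
apply: bdm_sum => i; apply: bdmM; first exact: bdm_cst.
exact: bS_coord.
Qed.

Lemma bS_mv i : bS (fun z => mv A z i).
Proof. exact: bS_dotp. Qed.

Lemma bS_ham : bS (ham A c).
Proof.
apply: bdmD; last exact: bS_dotp.
apply: bdmM; first exact: bdm_cst.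
by apply: bdm_sum => i; apply: bdmM; [exact: bS_coord|exact: bS_mv].
Qed.

Lemma bS2_cst (a : R) : bS2 (fun _ _ => a).
Proof. exact: bdm_cst. Qed.

Lemma bS2M G K : bS2 G -> bS2 K -> bS2 (fun z y => G z y * K z y).
Proof. exact: bdmM. Qed.

Lemma bS2D G K : bS2 G -> bS2 K -> bS2 (fun z y => G z y + K z y).
Proof. exact: bdmD. Qed.

Lemma bS2B G K : bS2 G -> bS2 K -> bS2 (fun z y => G z y - K z y).
Proof. exact: bdmB. Qed.

Lemma bS2_1 F : bS F -> bS2 (fun z _ => F z).
Proof. by move=> bF; exact: (bdm_comp _ fst measurable_fst bF). Qed.

Lemma bS2_2 (f : R -> R) : bdm (f \o clip) -> bS2 (fun _ y => f y).
Proof. by move=> bf; exact: (bdm_comp _ snd measurable_snd bf). Qed.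

Lemma bS2_id : bS2 (fun _ y => y).
Proof. by apply: bS2_2; exact: bdm_clip. Qed.

Lemma bS2_swap i G : bS2 G -> bS2 (fun z y => G (upd z i y) (z i)).
Proof.
move=> bG; have := bdm_comp _ (fun p : n.-tuple R * R => (tupd p.1 i p.2, tnth p.1 i)) _ bG.
rewrite /bS2 => h; under eq_fun do rewrite -clip_state_tupd -/(clip_state _ i); apply: h.
apply: measurable_fun_pair; first exact: measurable_tupd.
exact: (measurableT_comp (measurable_tnth i)).
Qed.

Lemma bS2_upd i F : bS F -> bS2 (fun z y => F (upd z i y)).
Proof. by move=> /bS2_1/(bS2_swap i). Qed.

Lemma bS2_section G z : bS2 G -> cube z -> bdm (fun y => G z (clip y)).
Proof. by move=> bG /clip_state_surj[x <-]; exact: (bdm_section1 _ x bG). Qed.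

Definition site_field z i : R := mv A z i + c i.

Lemma site_field_upd z i y : site_field (upd z i y) i = site_field z i.
Proof. by rewrite /site_field mv_upd A0 mul0r addr0. Qed.

Lemma bS_site_field i : bS (fun z => site_field z i).
Proof. by apply: bdmD; [exact: bS_mv|exact: bdm_cst]. Qed.

Definition gibbs_weight z : R := expR (ham A c z).

Lemma bS_gibbs_weight : bS gibbs_weight.
Proof. by apply: bdm_expR; exact: bS_ham. Qed.

Definition gibbs_norm : R := \int[P0]_x gibbs_weight (clip_state x).

Lemma gibbs_norm_gt0 : 0 < gibbs_norm.
Proof. by apply: Ibdm_expR_gt0; exact: bS_ham. Qed.

Definition gibbs_mean F : R := (\int[P0]_x (F (clip_state x) * gibbs_weight (clip_state x))) / gibbs_norm.

Let bFw F : bS F -> bdm (fun x => F (clip_state x) * gibbs_weight (clip_state x)).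
Proof. by move=> bF; apply: bdmM => //; exact: bS_gibbs_weight. Qed.

Lemma eq_gibbs_mean F F' : (forall z, cube z -> F z = F' z) -> gibbs_mean F = gibbs_mean F'.
Proof.
move=> e; congr (_ / _); apply: eq_Rintegral => x _; rewrite e//.
exact: cube_clip_state.
Qed.

Lemma gibbs_meanD F F' : bS F -> bS F' -> gibbs_mean (fun z => F z + F' z) = gibbs_mean F + gibbs_mean F'.
Proof.
move=> bF bF'; rewrite /gibbs_mean -mulrDl -IbdmD; [|exact: bFw|exact: bFw].
by congr (_ / _); apply: eq_Rintegral => x _; rewrite mulrDl.
Qed.

Lemma gibbs_meanZ a F : bS F -> gibbs_mean (fun z => a * F z) = a * gibbs_mean F.
Proof.
move=> bF; rewrite /gibbs_mean mulrA -IbdmZl; last exact: bFw.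
by congr (_ / _); apply: eq_Rintegral => x _; rewrite mulrA.
Qed.

Lemma gibbs_meanB F F' : bS F -> bS F' -> gibbs_mean (fun z => F z - F' z) = gibbs_mean F - gibbs_mean F'.
Proof.
move=> bF bF'; rewrite -[- gibbs_mean F']mulN1r -gibbs_meanZ// -gibbs_meanD//.
  by apply: eq_gibbs_mean => z _; rewrite mulN1r.
by apply: bdmM => //; exact: bdm_cst.
Qed.

Lemma gibbs_mean_cst a : gibbs_mean (fun=> a) = a.
Proof. by rewrite /gibbs_mean IbdmZl ?mulfK ?gt_eqF ?gibbs_norm_gt0//; exact: bS_gibbs_weight. Qed.

Lemma bS_sum I (s : seq I) (F : I -> ('I_n -> R) -> R) :
  (forall k, bS (F k)) -> bS (fun z => \sum_(k <- s) F k z).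
Proof. by move=> bF; exact: bdm_sum. Qed.

Lemma gibbs_mean_sum I (s : seq I) (F : I -> ('I_n -> R) -> R) : (forall k, bS (F k)) ->
  gibbs_mean (fun z => \sum_(k <- s) F k z) = \sum_(k <- s) gibbs_mean (F k).
Proof.
move=> bF; elim: s => [|k s IH].
  by rewrite big_nil -[RHS](gibbs_mean_cst 0); apply: eq_gibbs_mean => z _; rewrite big_nil.
rewrite big_cons -IH -gibbs_meanD//; last exact: bS_sum.
by apply: eq_gibbs_mean => z _; rewrite big_cons.
Qed.

Lemma le_gibbs_mean F F' : bS F -> bS F' -> (forall z, cube z -> F z <= F' z) ->
  gibbs_mean F <= gibbs_mean F'.
Proof.
move=> bF bF' le; rewrite /gibbs_mean ler_pM2r ?invr_gt0 ?gibbs_norm_gt0//.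
apply: le_Ibdm => [||x]; [exact: bFw|exact: bFw|].
by rewrite ler_pM2r ?expR_gt0// le//; exact: cube_clip_state.
Qed.

Lemma gibbs_mean_ge0 F : bS F -> (forall z, cube z -> 0 <= F z) -> 0 <= gibbs_mean F.
Proof. by move=> bF F0; rewrite -(gibbs_mean_cst 0) le_gibbs_mean//; exact: bdm_cst. Qed.

Lemma abs_gibbs_mean_le F : bS F -> `|gibbs_mean F| <= gibbs_mean (fun z => `|F z|).
Proof.
move=> bF; have bN : bS (fun z => `|F z|) by exact: bdm_norm.
rewrite ler_norml; apply/andP; split; last by apply: le_gibbs_mean => // z _; exact: ler_norm.
rewrite -mulN1r -gibbs_meanZ//; apply: le_gibbs_mean => //.
  by apply: bdmM => //; exact: bdm_cst.
by move=> z _; rewrite mulN1r lerNl -normrN ler_norm.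
Qed.

Lemma gibbs_mean_sqr_le F : bS F -> gibbs_mean F ^+ 2 <= gibbs_mean (fun z => F z ^+ 2).
Proof.
move=> bF; have b2 : bS (fun z => F z ^+ 2) by exact: bdmX.
have b1 : bS (fun z => 2 * gibbs_mean F * F z) by apply: bdmM => //; exact: bdm_cst.
have : 0 <= gibbs_mean (fun z => F z ^+ 2 - 2 * gibbs_mean F * F z + gibbs_mean F ^+ 2).
  apply: gibbs_mean_ge0.
    by apply: bdmD; [exact: bdmB|exact: bdm_cst].
  by move=> z _; rewrite (_ : _ + _ = (F z - gibbs_mean F) ^+ 2) ?sqr_ge0//; ring.
have bd : bS (fun z => F z ^+ 2 - 2 * gibbs_mean F * F z) by exact: bdmB.
rewrite (gibbs_meanD _ _ bd (bS_cst _)) (gibbs_meanB _ _ b2 b1) (gibbs_meanZ _ _ bF) gibbs_mean_cst.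
by rewrite -mulrA -expr2; lra.
Qed.

Lemma gibbs_mean_abs_le_sqrt F : bS F -> gibbs_mean (fun z => `|F z|) <= Num.sqrt (gibbs_mean (fun z => F z ^+ 2)).
Proof.
move=> bF; have bN : bS (fun z => `|F z|) by exact: bdm_norm.
have e0 : 0 <= gibbs_mean (fun z => `|F z|) by apply: gibbs_mean_ge0.
rewrite -[leLHS]ger0_norm// -sqrtr_sqr ler_wsqrtr//.
apply: le_trans (gibbs_mean_sqr_le _ bN) _; rewrite le_eqVlt; apply/orP; left; apply/eqP.
by apply: eq_gibbs_mean => z _; rewrite real_normK ?num_real.
Qed.

(** Conditional expectation of G z y given z, for y a fresh draw of coordinate i from its
    conditional law, the tilt of [mu i] by the local field. [pair_mean] averages this over z. *)
Definition resample i G z : R := tilt (mu i) clip (site_field z i) (fun y => G z (clip y)).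

Lemma bS_resample i G : bS2 G -> bS (resample i G).
Proof.
move=> bG; have bf2 := bS2_1 _ (bS_site_field i).
have be : bS2 (fun z y => expR (site_field z i * y)).
  by apply: bdm_expR; apply: bdmM => //; exact: bS2_id.
apply: bdmM.
  exact: (bdm_partial_integral P0 (mu i) _ (bdmM _ _ bG be)).
have [B B0 FB] := bdm_bound _ (bS_site_field i).
apply: (bdmV _ (expR (- B))).
- exact: (bdm_partial_integral P0 (mu i) _ be).
- exact: expR_gt0.
move=> x; rewrite -[leLHS](Ibdm_cst (mu i)).
apply: le_Ibdm; [exact: bdm_cst|exact: (bdm_section1 _ x be)|].
move=> y; rewrite ler_expR lerNl; apply: le_trans (FB x).
rewrite -[leRHS]mulr1; apply: le_trans (_ : `|site_field (clip_state x) i * clip y| <= _).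
  by rewrite -normrN ler_norm.
by rewrite normrM ler_wpM2l// abs_clip_le.
Qed.

Lemma resampleD i G K z : bS2 G -> bS2 K -> cube z ->
  resample i (fun z y => G z y + K z y) z = resample i G z + resample i K z.
Proof.
move=> bG bK cz; rewrite /resample tiltD//; [exact: measurable_clip|exact: abs_clip_le|..];
  exact: bS2_section.
Qed.

Lemma resampleZ i (a : ('I_n -> R) -> R) G z : bS2 G -> cube z ->
  resample i (fun z y => a z * G z y) z = a z * resample i G z.
Proof.
move=> bG cz; rewrite /resample tiltZ//; [exact: measurable_clip|exact: abs_clip_le|..].
exact: bS2_section.
Qed.

Lemma resample_cst i F z : resample i (fun z _ => F z) z = F z.
Proof. by rewrite /resample tilt_cst//; [exact: measurable_clip|exact: abs_clip_le]. Qed.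

Lemma eq_resample i G K z : (forall y, `|y| <= 1 -> G z y = K z y) -> resample i G z = resample i K z.
Proof.
move=> e; rewrite /resample; congr tilt; apply/funext => y; rewrite e//.
exact: abs_clip_le.
Qed.

Lemma le_resample i G K z : bS2 G -> bS2 K -> cube z ->
  (forall y, `|y| <= 1 -> G z y <= K z y) -> resample i G z <= resample i K z.
Proof.
move=> bG bK cz le; apply: le_tilt; [exact: measurable_clip|exact: abs_clip_le|..].
- exact: bS2_section.
- exact: bS2_section.
by move=> y; apply: le; exact: abs_clip_le.
Qed.

Definition pair_mean i G : R := gibbs_mean (resample i G).

Lemma pair_meanD i G K : bS2 G -> bS2 K ->
  pair_mean i (fun z y => G z y + K z y) = pair_mean i G + pair_mean i K.
Proof.
move=> bG bK; rewrite /pair_mean -gibbs_meanD; [|exact: bS_resample|exact: bS_resample].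
by apply: eq_gibbs_mean => z cz; exact: resampleD.
Qed.

Lemma pair_mean_fst i F : pair_mean i (fun z _ => F z) = gibbs_mean F.
Proof. by apply: eq_gibbs_mean => z cz; exact: resample_cst. Qed.

Lemma pair_meanZ i a G : bS2 G -> pair_mean i (fun z y => a * G z y) = a * pair_mean i G.
Proof.
move=> bG; rewrite /pair_mean -gibbs_meanZ; last exact: bS_resample.
by apply: eq_gibbs_mean => z cz; exact: (resampleZ i (fun=> a)).
Qed.

Lemma pair_meanMl i F G : bS2 G -> pair_mean i (fun z y => F z * G z y) = gibbs_mean (fun z => F z * resample i G z).
Proof. by move=> bG; apply: eq_gibbs_mean => z cz; exact: resampleZ. Qed.

Lemma eq_pair_mean i G K : (forall z y, cube z -> `|y| <= 1 -> G z y = K z y) ->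
  pair_mean i G = pair_mean i K.
Proof. by move=> e; apply: eq_gibbs_mean => z cz; apply: eq_resample => y; exact: e. Qed.

Lemma pair_meanB i G K : bS2 G -> bS2 K ->
  pair_mean i (fun z y => G z y - K z y) = pair_mean i G - pair_mean i K.
Proof.
move=> bG bK; have bN : bS2 (fun z y => -1 * K z y).
  by apply: bdmM => //; exact: bdm_cst.
rewrite (_ : - pair_mean i K = pair_mean i (fun z y => -1 * K z y)); last by rewrite pair_meanZ ?mulN1r.
rewrite -(pair_meanD i _ _ bG bN).
by apply: eq_pair_mean => z y _ _; rewrite mulN1r.
Qed.

Lemma le_pair_mean i G K : bS2 G -> bS2 K ->
  (forall z y, cube z -> `|y| <= 1 -> G z y <= K z y) -> pair_mean i G <= pair_mean i K.
Proof.
move=> bG bK le; apply: le_gibbs_mean; [exact: bS_resample|exact: bS_resample|].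
by move=> z cz; apply: le_resample => // y; exact: le.
Qed.

(* Resampling coordinate i from its conditional law is reversible: the joint
   density of (z, y) is invariant under exchanging z i and y. *)
Lemma pair_mean_swap i G : bS2 G -> pair_mean i G = pair_mean i (fun z y => G (upd z i y) (z i)).
Proof.
move=> bG.
suff e : \int[P0]_x (resample i G (clip_state x) * gibbs_weight (clip_state x)) =
    \int[P0]_x (resample i (fun z y => G (upd z i y) (z i)) (clip_state x) * gibbs_weight (clip_state x)).
  by rewrite /pair_mean /gibbs_mean e.
pose M z := \int[mu i]_y expR (site_field z i * clip y).
pose D (z : 'I_n -> R) (y : R) := gibbs_weight z * expR (site_field z i * y) / M z.
have be : bS2 (fun z y => expR (site_field z i * y)).
  by apply: bdm_expR; apply: bdmM; [exact: (bS2_1 _ (bS_site_field i))|exact: bS2_id].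
have bMV : bS (fun z => (M z)^-1).
  have [B B0 FB] := bdm_bound _ (bS_site_field i).
  apply: (bdmV _ (expR (- B))).
  - exact: (bdm_partial_integral P0 (mu i) _ be).
  - exact: expR_gt0.
  move=> x; rewrite -[leLHS](Ibdm_cst (mu i)).
  apply: le_Ibdm; [exact: bdm_cst|exact: (bdm_section1 _ x be)|].
  move=> y; rewrite ler_expR lerNl; apply: le_trans (FB x).
  rewrite -[leRHS]mulr1; apply: le_trans (_ : `|site_field (clip_state x) i * clip y| <= _).
    by rewrite -normrN ler_norm.
  by rewrite normrM ler_wpM2l// abs_clip_le.
have bD : bS2 D.
  apply: bdmM; last exact: (bS2_1 _ bMV).
  by apply: bdmM => //; exact: (bS2_1 _ bS_gibbs_weight).
have Dsw z y : D (upd z i y) (z i) = D z y.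
  rewrite /D /M site_field_upd; congr (_ / _).
  rewrite /gibbs_weight -!expRD ham_upd//; congr expR.
  by rewrite -[mv A z i + c i]/(site_field z i); ring.
have EK H : bS2 H -> \int[P0]_x (resample i H (clip_state x) * gibbs_weight (clip_state x)) =
    \int[P0]_x \int[mu i]_y (H (clip_state x) (clip y) * D (clip_state x) (clip y)).
  move=> bH; apply: eq_Rintegral => x _.
  have -> : \int[mu i]_y (H (clip_state x) (clip y) * D (clip_state x) (clip y)) =
     \int[mu i]_y (gibbs_weight (clip_state x) / M (clip_state x) * (H (clip_state x) (clip y) * expR (site_field (clip_state x) i * clip y))).
    by apply: eq_Rintegral => y _; rewrite /D; ring.
  rewrite IbdmZl; last exact: (bdm_section1 _ x (bdmM _ _ bH be)).
  by rewrite /resample /tilt -/(M (clip_state x)); ring.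
rewrite EK// EK; last exact: bS2_swap.
rewrite (Rintegral_swap_coordinate n mu i
  (fun p => G (clip_state p.1) (clip p.2) * D (clip_state p.1) (clip p.2)))/=; last exact: bdmM.
apply: eq_Rintegral => x _; apply: eq_Rintegral => y _.
by rewrite clip_state_tupd -/(clip_state x i) Dsw.
Qed.

(** The exchange turns K into - K and F z into F (upd z i y); averaging the two expressions for the
    left side gives the right one. Correlations with an antisymmetric function thereby become
    increments of [F] under one resampling, small when the dependence is weak. *)
Lemma pair_mean_antisym i F K : bS F -> bS2 K ->
  (forall z y, cube z -> `|y| <= 1 -> K (upd z i y) (z i) = - K z y) ->
  gibbs_mean (fun z => F z * resample i K z) =
  2^-1 * pair_mean i (fun z y => K z y * (F z - F (upd z i y))).
Proof.
move=> bF bK aK; rewrite -pair_meanMl//.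
have bF1 : bS2 (fun z y => F z * K z y) by apply: bdmM => //; exact: bS2_1.
have bF2 : bS2 (fun z y => F (upd z i y) * K z y).
  by apply: bdmM => //; exact: bS2_upd.
have e1 : pair_mean i (fun z y => F (upd z i y) * K z y) = - pair_mean i (fun z y => F z * K z y).
  rewrite (pair_mean_swap i _ bF1) -mulN1r -pair_meanZ; last exact: (bS2_swap i _ bF1).
  by apply: eq_pair_mean => z y cz y1; rewrite aK//; ring.
have -> : pair_mean i (fun z y => K z y * (F z - F (upd z i y))) =
    pair_mean i (fun z y => F z * K z y) - pair_mean i (fun z y => F (upd z i y) * K z y).
  by rewrite -(pair_meanB i _ _ bF1 bF2); apply: eq_pair_mean => z y _ _; ring.
by rewrite e1; field.
Qed.

End gibbs.

(** * Moments of conditionally centered statistics *)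

Section tilt_mean.
Context {R : realType} {d : measure_display} {T : measurableType d}.
Variables (P : probability T R) (X : T -> R).
Hypothesis mX : measurable_fun [set: T] X.
Hypothesis X1 : forall x, `|X x| <= 1.

Let bX : bdm X. Proof. by split => //; exists 1. Qed.

Lemma is_derive_tilt_mean (t : R) :
  is_derive t (1 : R) (fun t => tilt P X t X) (tilt_var P X t).
Proof. by have := is_derive_tilt P X mX X1 t X bX; rewrite /tilt_var -expr2. Qed.

Lemma tilt_mean_taylor s t : exists2 r, `|r - t| <= `|s - t| &
  tilt P X s X - tilt P X t X = tilt_var P X r * (s - t).
Proof.
have dc x : derivable (fun t => tilt P X t X) x 1 := @ex_derive _ _ _ _ _ _ _
  (is_derive_tilt_mean x).
have [st|ts] := leP s t.
  have [r /[!in_itv]/= /andP[r1 r2] e] := @MVT_segment _ (fun t => tilt P X t X) (tilt_var P X) _ _ st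
    (fun x _ => is_derive_tilt_mean x) (derivable_within_continuous (fun x _ => dc x)).
  exists r; first by rewrite !ler0_norm ?subr_le0// lerN2 lerD2r.
  by rewrite -opprB e -mulrN opprB.
have [r /[!in_itv]/= /andP[r1 r2] e] := @MVT_segment _ (fun t => tilt P X t X) (tilt_var P X) _ _ (ltW ts)
    (fun x _ => is_derive_tilt_mean x) (derivable_within_continuous (fun x _ => dc x)).
by exists r => //; rewrite !ger0_norm ?subr_ge0 ?(ltW ts)// lerD2r.
Qed.

Lemma tilt_mean_lip s t : `|tilt P X s X - tilt P X t X| <= `|s - t|.
Proof.
have [r _ ->] := tilt_mean_taylor s t.
have /andP[v0 v1] := tilt_var_bounds P X mX X1 r.
by rewrite normrM ler_piMl// ger0_norm.
Qed.

Lemma tilt_mean_taylor2 s t :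
  `|tilt P X s X - tilt P X t X - tilt_var P X t * (s - t)| <= 4 * (s - t) ^+ 2.
Proof.
have [r rt ->] := tilt_mean_taylor s t.
rewrite -mulrBl normrM -[(s - t) ^+ 2]real_normK ?num_real// expr2 mulrA.
rewrite ler_wpM2r//; apply: le_trans (tilt_var_lip P X mX X1 r t) _.
by rewrite ler_wpM2l.
Qed.

End tilt_mean.

(** The 3 is |k| <= 2 times the 3/2 in s^2 + s s' + s'^2 <= (3/2) (s^2 + s'^2). The bounds o and o'
    are the oscillations seen from the two ends of the exchange, each paired with its own square. *)
Lemma cube_increment_le {R : realType} (a k s s' o o' : R) :
  `|k| <= 2 -> `|s - s'| <= o -> `|s - s'| <= o' ->
  a * (k * (s ^+ 3 - s' ^+ 3)) <= 3 * `|a| * (o * s ^+ 2 + o' * s' ^+ 2).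
Proof.
move=> k2 d1 d2; apply: le_trans (ler_norm _) _.
rewrite 2!normrM [leRHS](_ : _ = `|a| * (3 * (o * s ^+ 2 + o' * s' ^+ 2))); last by ring.
rewrite ler_wpM2l//.
rewrite (_ : s ^+ 3 - s' ^+ 3 = (s - s') * (s ^+ 2 + s * s' + s' ^+ 2)); last by ring.
rewrite normrM.
have q0 : `|s ^+ 2 + s * s' + s' ^+ 2| <= 3 / 2 * (s ^+ 2 + s' ^+ 2).
  have p1 := sqr_ge0 (s - s'); have p2 := sqr_ge0 (s + s').
  by rewrite ler_norml; apply/andP; split; nra.
apply: le_trans (_ : 2 * (`|s - s'| * (3 / 2 * (s ^+ 2 + s' ^+ 2))) <= _).
  by rewrite ler_pM ?mulr_ge0// ler_wpM2l.
have a1 : `|s - s'| * s ^+ 2 <= o * s ^+ 2 by rewrite ler_wpM2r ?sqr_ge0.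
have a2 : `|s - s'| * s' ^+ 2 <= o' * s' ^+ 2 by rewrite ler_wpM2r ?sqr_ge0.
by lra.
Qed.

Section moments.
Context {R : realType} {n : nat}.
Variables (mu : 'I_n -> probability R R) (A : 'M[R]_n) (c : 'I_n -> R) (rho : R).
Hypothesis rho01 : 0 < rho < 1.
Hypothesis symA : forall i j, A i j = A j i.
Hypothesis A0 : forall i, A i i = 0.
Hypothesis A2 : forall x : 'I_n -> R, sqs (mv A x) <= rho ^+ 2 * sqs x.
Implicit Types (i j k : 'I_n) (z a : 'I_n -> R) (y : R).

Notation E := (gibbs_mean mu A c).
Notation EE := (pair_mean mu A c).
Notation Tt := (resample mu A c).
Notation fld := (site_field A c).

Definition site_mean i z : R := tilt (mu i) clip (fld z i) clip.
Definition site_var i z : R := tilt_var (mu i) clip (fld z i).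
Definition site_resid z i : R := z i - site_mean i z.

Lemma bS_site_mean i : bS (site_mean i).
Proof. exact: (bS_resample mu A c i (fun _ y => y) bS2_id). Qed.

Lemma bS2_sqr : @bS2 R n (fun _ y => y ^+ 2).
Proof. by apply: bS2_2; apply: bdmX; exact: bdm_clip. Qed.

Lemma bS_site_var i : bS (site_var i).
Proof.
apply: bdmB; first exact: (bS_resample mu A c i (fun _ y => y ^+ 2) bS2_sqr).
by apply: bdmX; exact: bS_site_mean.
Qed.

Lemma bS_site_resid i : bS (fun z => site_resid z i).
Proof. by apply: bdmB; [exact: bS_coord|exact: bS_site_mean]. Qed.

Lemma abs_site_mean_le i z : `|site_mean i z| <= 1.
Proof. exact: (tilt_mean_le1 _ _ measurable_clip abs_clip_le). Qed.

Lemma site_var_bounds i z : 0 <= site_var i z <= 1.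
Proof. exact: (tilt_var_bounds _ _ measurable_clip abs_clip_le). Qed.

Lemma site_field_updE z j y k : fld (upd z j y) k - fld z k = A k j * (y - z j).
Proof. by rewrite /site_field mv_upd; ring. Qed.

Lemma cube_dist z j y : cube z -> `|y| <= 1 -> `|y - z j| <= 2.
Proof.
by move=> cz y1; rewrite (le_trans (ler_normB _ _))// (_ : 2 = 1 + 1)// lerD.
Qed.

(** The 16 is the remainder constant 4 of [tilt_mean_taylor2] times the square of |y - z_j| <= 2. *)
Lemma site_mean_upd_taylor z j y k : cube z -> `|y| <= 1 ->
  `|site_mean k (upd z j y) - site_mean k z - site_var k z * (A k j * (y - z j))| <= 16 * A k j ^+ 2.
Proof.
move=> cz y1; rewrite -site_field_updE.
apply: le_trans (tilt_mean_taylor2 _ _ measurable_clip abs_clip_le _ _) _.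
rewrite site_field_updE exprMn mulrCA mulrC ler_wpM2r ?sqr_ge0//.
have := cube_dist z j y cz y1 => h.
rewrite -[(y - z j) ^+ 2]real_normK ?num_real//.
have : `|y - z j| ^+ 2 <= 2 ^+ 2 by rewrite lerXn2r ?nnegrE.
by lra.
Qed.

Definition lstat a z : R := dotp a (site_resid z).

Lemma bS_lstat a : bS (lstat a).
Proof. by apply: bdm_sum => i; apply: bdmM; [exact: bdm_cst|exact: bS_site_resid]. Qed.

(** Bounds the change of [lstat a] when coordinate j is replaced: the direct term, the first-order
    effect on the conditional means, and the second-order effect. It does not involve the new value,
    so it is a function of the state alone. *)
Definition lstat_osc a j z : R := 2 * `|a j| +
  2 * `|mv A (fun k => a k * site_var k z) j| + 16 * \sum_k `|a k| * A j k ^+ 2.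

Lemma bS_lstat_osc a j : bS (lstat_osc a j).
Proof.
apply: bdmD; last exact: bdm_cst.
apply: bdmD; first exact: bdm_cst.
apply: bdmM; first exact: bdm_cst.
apply: bdm_norm; apply: bdm_sum => k; apply: bdmM; first exact: bdm_cst.
by apply: bdmM; [exact: bdm_cst|exact: bS_site_var].
Qed.

Lemma lstat_updE a j z y : lstat a (upd z j y) - lstat a z =
  a j * (y - z j) - \sum_k a k * (site_mean k (upd z j y) - site_mean k z).
Proof.
have -> : a j * (y - z j) = dotp a (upd z j y) - dotp a z.
  by rewrite dotp_upd; ring.
rewrite /lstat /dotp -!sumrB; apply: eq_bigr => k _; rewrite /site_resid.
by move: (site_mean k _) (site_mean k _) (upd _ _ _ _) => p q r; ring.
Qed.

Lemma lstat_osc_le a j z y : cube z -> `|y| <= 1 ->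
  `|lstat a (upd z j y) - lstat a z| <= lstat_osc a j z.
Proof.
move=> cz y1; have y2 := cube_dist z j y cz y1.
rewrite lstat_updE.
have -> : \sum_k a k * (site_mean k (upd z j y) - site_mean k z) =
   (y - z j) * mv A (fun k => a k * site_var k z) j +
   \sum_k a k * (site_mean k (upd z j y) - site_mean k z - site_var k z * (A k j * (y - z j))).
  rewrite /mv mulr_sumr -big_split/=; apply: eq_bigr => k _.
  rewrite symA; move: (site_mean k _) (site_mean k _) (site_var k _) => p q r.
  by ring.
rewrite opprD addrA (le_trans (ler_normB _ _))// lerD//.
  rewrite (le_trans (ler_normB _ _))// !normrM lerD//.
    by rewrite mulrC ler_wpM2r.
  by rewrite ler_wpM2r.
rewrite mulr_sumr (le_trans (ler_norm_sum _ _ _))// ler_sum// => k _.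
rewrite normrM [leRHS]mulrCA (symA j) ler_wpM2l//.
exact: site_mean_upd_taylor.
Qed.

(** 20 = 2 + 2 + 16, each of the three sums being at most [sqs a]: the second because [A] contracts
    in l2 and the variances are at most 1, the third because the rows of [A] have l2 norm at most
    1. *)
Lemma sum_lstat_osc a z : \sum_j `|a j| * lstat_osc a j z <= 20 * sqs a.
Proof.
have /andP[r0 r1] := rho01.
have -> : \sum_j `|a j| * lstat_osc a j z = 2 * \sum_j `|a j| * `|a j| +
    2 * \sum_j `|a j| * `|mv A (fun k => a k * site_var k z) j| +
    16 * \sum_j \sum_k `|a j| * `|a k| * A j k ^+ 2.
  rewrite !mulr_sumr -!big_split/=; apply: eq_bigr => j _.
  rewrite /lstat_osc !mulrDr mulr_sumr; congr (_ + _ + _); [by ring|by ring|].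
  by rewrite !mulr_sumr; apply: eq_bigr => k _; ring.
have h1 : \sum_j `|a j| * `|a j| = sqs a.
  by apply: eq_bigr => j _; rewrite -expr2 real_normK ?num_real.
have h2 : \sum_j `|a j| * `|mv A (fun k => a k * site_var k z) j| <= sqs a.
  have sn (x : 'I_n -> R) : sqs (fun i => `|x i|) = sqs x.
    by apply: eq_bigr => j _; rewrite real_normK ?num_real.
  have := abs_dotp_le (fun j => `|a j|) (fun j => `|mv A (fun k => a k * site_var k z) j|).
  rewrite (sn a) (sn (mv A _)) /dotp => /(le_trans (ler_norm _))/le_trans; apply.
  rewrite -[leRHS]sqr_sqrtr ?sqs_ge0// expr2 ler_wpM2l ?sqrtr_ge0// ler_wsqrtr//.
  apply: le_trans (A2 _) _; apply: le_trans (_ : sqs (fun k => a k * site_var k z) <= _).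
    by rewrite ler_piMl ?sqs_ge0// expr_le1// ltW.
  rewrite /sqs ler_sum// => k _; rewrite exprMn ler_piMr ?sqr_ge0//.
  by have /andP[? ?] := site_var_bounds k z; rewrite expr_le1.
have h3 : \sum_j \sum_k `|a j| * `|a k| * A j k ^+ 2 <= sqs a.
  apply: le_trans (_ : \sum_j \sum_k (a j ^+ 2 / 2 * A j k ^+ 2 + a k ^+ 2 / 2 * A j k ^+ 2) <= _).
    apply: ler_sum => j _; apply: ler_sum => k _.
    rewrite -mulrDl ler_wpM2r ?sqr_ge0//.
    have := sqr_ge0 (`|a j| - `|a k|).
    rewrite -[a j ^+ 2]real_normK ?num_real// -[a k ^+ 2]real_normK ?num_real//.
    by rewrite sqrrB; lra.
  under eq_bigr do rewrite big_split/=.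
  rewrite big_split/= [X in _ + X]exchange_big/=.
  have hh : \sum_i \sum_j a i ^+ 2 / 2 * A i j ^+ 2 <= sqs a / 2.
    rewrite /sqs mulr_suml ler_sum// => j _; rewrite -mulr_sumr ler_piMr//.
      by rewrite divr_ge0 ?sqr_ge0.
    exact: (row_sqs_le1 n A rho rho01 symA A2).
  have hh' : \sum_j \sum_i a j ^+ 2 / 2 * A i j ^+ 2 <= sqs a / 2.
    by under eq_bigr do under eq_bigr do rewrite symA.
  by move: hh hh'; lra.
by rewrite h1; lra.
Qed.

(* Reversibility turns S^4 = S * S^3 into a sum of increments of S^3 under
   single-site resampling, which gives E S^4 <= C |a|^2 E S^2. *)
Lemma lstat_moment4_step a :
  E (fun z => lstat a z ^+ 4) <= 60 * sqs a * E (fun z => lstat a z ^+ 2).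
Proof.
have bS3 : bS (fun z => lstat a z ^+ 3) by apply: bdmX; exact: bS_lstat.
have bq : bS (fun z => lstat a z ^+ 2) by apply: bdmX; exact: bS_lstat.
pose K j z y : R := z j - y.
have bK j : bS2 (K j).
  by apply: bdmB; [exact: (bS2_1 _ (bS_coord j))|exact: bS2_id].
have TK j z : cube z -> Tt j (K j) z = site_resid z j.
  move=> cz; rewrite /site_resid -(resample_cst mu A c j (fun z => z j) z).
  rewrite /resample /K tiltB//; [exact: measurable_clip|exact: abs_clip_le|exact: bdm_cst|exact: bdm_clip].
have e1 : E (fun z => lstat a z ^+ 4) =
    \sum_j a j * (2^-1 * EE j (fun z y => K j z y *
      (lstat a z ^+ 3 - lstat a (upd z j y) ^+ 3))).
  transitivity (\sum_j a j * E (fun z => lstat a z ^+ 3 * Tt j (K j) z)).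
    have bj j : bS (fun z => lstat a z ^+ 3 * Tt j (K j) z).
      by apply: bdmM => //; exact: bS_resample.
    under eq_bigr do rewrite -gibbs_meanZ//.
    rewrite -gibbs_mean_sum; last by move=> j; apply: bdmM; [exact: bdm_cst|exact: bj].
    apply: eq_gibbs_mean => z cz; rewrite exprS {1}/lstat /dotp mulr_suml.
    by apply: eq_bigr => j _; rewrite TK//; ring.
  apply: eq_bigr => j _; congr (_ * _).
  rewrite (pair_mean_antisym mu A c symA A0 j (fun z => lstat a z ^+ 3) (K j))//.
  by move=> z y _ _; rewrite /K upd_id; ring.
pose H j z (_ : R) := lstat_osc a j z * lstat a z ^+ 2.
have bH j : bS2 (H j).
  by apply: (bS2_1 (fun z => lstat_osc a j z * lstat a z ^+ 2)); apply: bdmM => //; exact: bS_lstat_osc.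
have e2 j : a j * (2^-1 * EE j (fun z y => K j z y *
      (lstat a z ^+ 3 - lstat a (upd z j y) ^+ 3))) <=
      3 * (`|a j| * E (fun z => lstat_osc a j z * lstat a z ^+ 2)).
  have bL : bS2 (fun z y => K j z y * (lstat a z ^+ 3 - lstat a (upd z j y) ^+ 3)).
    exact: (bS2M _ _ (bK j) (bS2B _ _ (bS2_1 _ bS3) (bS2_upd j _ bS3))).
  have bL2 : bS2 (fun z y => H j z y + H j (upd z j y) (z j)).
    exact: (bS2D _ _ (bH j) (bS2_swap j _ (bH j))).
  (* By reversibility both summands on the right have the mean on the left. *)
  have -> : E (fun z => lstat_osc a j z * lstat a z ^+ 2) =
      2^-1 * EE j (fun z y => H j z y + H j (upd z j y) (z j)).
    rewrite (pair_meanD mu A c j _ _ (bH j) (bS2_swap j _ (bH j))).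
    have half (x y w : R) : y = x -> w = x -> x = 2^-1 * (y + w).
      by move=> -> ->; field.
    have EEH : EE j (H j) = E (fun z => lstat_osc a j z * lstat a z ^+ 2).
      exact: pair_mean_fst.
    exact: (half _ _ _ EEH (etrans (esym (pair_mean_swap mu A c symA A0 j _ (bH j))) EEH)).
  have -> : 3 * (`|a j| * (2^-1 * EE j (fun z y => H j z y + H j (upd z j y) (z j)))) =
    2^-1 * EE j (fun z y => 3 * `|a j| * (H j z y + H j (upd z j y) (z j))).
    by rewrite (pair_meanZ mu A c j (3 * `|a j|) _ bL2); ring.
  rewrite mulrCA ler_wpM2l ?invr_ge0//.
  rewrite -(pair_meanZ mu A c j (a j) _ bL); apply: le_pair_mean.
  - exact: (bS2M _ _ (bS2_cst _) bL).
  - exact: (bS2M _ _ (bS2_cst _) bL2).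
  move=> z y cz y1; apply: cube_increment_le.
  - by rewrite /K distrC; exact: cube_dist.
  - by rewrite distrC; exact: lstat_osc_le.
  - have := lstat_osc_le a j (upd z j y) (z j) (cube_upd _ _ _ cz y1) (cz j).
    by rewrite upd_upd.
rewrite e1; apply: le_trans (ler_sum _ (fun j _ => e2 j)) _.
rewrite -mulr_sumr.
have bj j : bS (fun z => lstat_osc a j z * lstat a z ^+ 2).
  by apply: bdmM => //; exact: bS_lstat_osc.
under eq_bigr do rewrite -gibbs_meanZ//.
rewrite -gibbs_mean_sum; last by move=> j; apply: bdmM; [exact: bdm_cst|exact: bj].
have -> : 60 * sqs a * E (fun z => lstat a z ^+ 2) =
   3 * E (fun z => (20 * sqs a) * lstat a z ^+ 2) by rewrite gibbs_meanZ//; ring.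
rewrite ler_wpM2l//; apply: le_gibbs_mean.
- by apply: bdm_sum => j; apply: bdmM; [exact: bdm_cst|exact: bj].
- by apply: bdmM => //; exact: bdm_cst.
move=> z _; under eq_bigr do rewrite mulrA.
by rewrite -mulr_suml ler_wpM2r ?sqr_ge0// sum_lstat_osc.
Qed.

(** With M = E S^2, Jensen gives M^2 <= E S^4 <= 60 |a|^2 M, and a factor M cancels. *)
Lemma lstat_moment2 a : E (fun z => lstat a z ^+ 2) <= 60 * sqs a.
Proof.
have bq : bS (fun z => lstat a z ^+ 2) by apply: bdmX; exact: bS_lstat.
have e0 : 0 <= E (fun z => lstat a z ^+ 2) by apply: gibbs_mean_ge0 => // z _; exact: sqr_ge0.
have h := lstat_moment4_step a.
have := gibbs_mean_sqr_le mu A c _ bq.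
rewrite (eq_gibbs_mean mu A c (fun z => (lstat a z ^+ 2) ^+ 2) (fun z => lstat a z ^+ 4)); last by move=> z _; rewrite -exprM.
move=> /le_trans/(_ h); rewrite expr2.
have [->|eN0] := eqVneq (E (fun z => lstat a z ^+ 2)) 0.
  by rewrite mulr_ge0 ?sqs_ge0.
by rewrite ler_pM2r// lt_neqAle eq_sym eN0.
Qed.

Lemma lstat_moment4 a : E (fun z => lstat a z ^+ 4) <= 3600 * sqs a ^+ 2.
Proof.
apply: le_trans (lstat_moment4_step a) _.
have -> : 3600 * sqs a ^+ 2 = 60 * sqs a * (60 * sqs a) by ring.
by rewrite ler_wpM2l ?lstat_moment2// mulr_ge0 ?sqs_ge0.
Qed.

Lemma abs_lstat_le a : E (fun z => `|lstat a z|) <= 8 * Num.sqrt (sqs a).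
Proof.
apply: le_trans (gibbs_mean_abs_le_sqrt _ _ _ _ (bS_lstat a)) _.
(* 60 is rounded up to the perfect square 64. *)
have -> : 8 * Num.sqrt (sqs a) = Num.sqrt (64 * sqs a).
  rewrite sqrtrM// (_ : 64 = 8 ^+ 2); last by rewrite -natrX.
  by rewrite sqrtr_sqr ger0_norm.
rewrite ler_wsqrtr//; apply: le_trans (lstat_moment2 a) _.
by rewrite ler_wpM2r ?sqs_ge0// ler_nat.
Qed.

(** The square is expanded and every covariance rewritten by [pair_mean_antisym]. On the diagonal
    the crude bounds B and 2 B, halved, give B^2; off the diagonal the j-th term changes by at most
    L |A_ij| when coordinate i is resampled. *)
Lemma antisym_variance (w : 'I_n -> R) (K : 'I_n -> ('I_n -> R) -> R -> R) (B L : R) :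
  0 <= B ->
  (forall i, bS2 (K i)) ->
  (forall i z y, cube z -> `|y| <= 1 -> `|K i z y| <= B) ->
  (forall i z y, cube z -> `|y| <= 1 -> K i (upd z i y) (z i) = - K i z y) ->
  (forall i j z y, i != j -> cube z -> `|y| <= 1 ->
     `|Tt j (K j) z - Tt j (K j) (upd z i y)| <= L * `|A i j|) ->
  E (fun z => (\sum_i w i * Tt i (K i) z) ^+ 2) <=
    B ^+ 2 * (\sum_i w i ^+ 2) + 2^-1 * B * L * \sum_i \sum_j `|w i| * `|w j| * `|A i j|.
Proof.
move=> B0 bK KB aK lipK.
have bX i : bS (Tt i (K i)) by exact: bS_resample.
have XB i z : cube z -> `|Tt i (K i) z| <= B.
  move=> cz; apply: abs_tilt_le; [exact: measurable_clip|exact: abs_clip_le|..].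
    exact: bS2_section.
  by move=> y; apply: KB => //; exact: abs_clip_le.
have bXX i j : bS (fun z => Tt j (K j) z * Tt i (K i) z) by exact: (bdmM _ _ (bX j) (bX i)).
have -> : E (fun z => (\sum_i w i * Tt i (K i) z) ^+ 2) =
   \sum_i \sum_j w i * w j * E (fun z => Tt j (K j) z * Tt i (K i) z).
  under eq_bigr do under eq_bigr do rewrite -gibbs_meanZ//.
  have bz i j : bS (fun z => w i * w j * (Tt j (K j) z * Tt i (K i) z)).
    by apply: bdmM; [exact: bdm_cst|exact: bXX].
  under eq_bigr do rewrite -gibbs_mean_sum//.
  rewrite -gibbs_mean_sum; last by move=> i; exact: (bS_sum _ _ _ (bz i)).
  apply: eq_gibbs_mean => z _; rewrite expr2 mulr_suml; apply: eq_bigr => i _.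
  by rewrite mulr_sumr; apply: eq_bigr => j _; ring.
have cov i j : E (fun z => Tt j (K j) z * Tt i (K i) z) =
    2^-1 * EE i (fun z y => K i z y * (Tt j (K j) z - Tt j (K j) (upd z i y))).
  by apply: pair_mean_antisym => //; exact: aK.
have bC i j : bS2 (fun z y => K i z y * (Tt j (K j) z - Tt j (K j) (upd z i y))).
  exact: (bS2M _ _ (bK i) (bS2B _ _ (bS2_1 _ (bX j)) (bS2_upd i _ (bX j)))).
have absEE i G M : bS2 G -> (forall z y, cube z -> `|y| <= 1 -> `|G z y| <= M) ->
    `|EE i G| <= M.
  move=> bG GM; rewrite ler_norml; apply/andP; split.
    have -> : - M = EE i (fun _ _ => - M) by rewrite pair_mean_fst gibbs_mean_cst.
    apply: le_pair_mean => //; first exact: bdm_cst.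
    by move=> z y cz y1; have := GM z y cz y1; rewrite ler_norml => /andP[].
  have -> : M = EE i (fun _ _ => M) by rewrite pair_mean_fst gibbs_mean_cst.
  apply: le_pair_mean => //; first exact: bdm_cst.
  by move=> z y cz y1; have := GM z y cz y1; rewrite ler_norml => /andP[].
have covii i : `|E (fun z => Tt i (K i) z * Tt i (K i) z)| <= B ^+ 2.
  rewrite cov normrM ger0_norm ?invr_ge0// mulrC ler_pdivrMr//.
  apply: absEE => // z y cz y1; rewrite normrM.
  rewrite (_ : B ^+ 2 * 2 = B * (B + B)); last by ring.
  rewrite ler_pM// ?KB//.
  by rewrite (le_trans (ler_normB _ _))// lerD// XB//; exact: cube_upd.
have covij i j : i != j -> `|E (fun z => Tt j (K j) z * Tt i (K i) z)| <=
    2^-1 * B * L * `|A i j|.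
  move=> ij; rewrite cov normrM ger0_norm ?invr_ge0// -!mulrA ler_wpM2l ?invr_ge0//.
  apply: absEE => // z y cz y1; rewrite normrM.
  by rewrite ler_pM// ?KB// lipK.
rewrite [X in B ^+ 2 * X]big_mkcond/= !mulr_sumr -big_split/= ler_sum// => i _.
rewrite (bigD1 i)//= lerD//.
  apply: le_trans (ler_norm _) _; rewrite normrM mulrC -expr2.
  by rewrite normrX real_normK ?num_real// ler_wpM2r ?sqr_ge0// covii.
rewrite mulr_sumr [leRHS](bigD1 i)//= A0 normr0 !mulr0 add0r ler_sum// => j ji.
apply: le_trans (ler_norm _) _; rewrite 2!normrM.
rewrite [leRHS](_ : _ = `|w i| * `|w j| * (2^-1 * B * L * `|A i j|)); last by ring.
by rewrite ler_wpM2l ?mulr_ge0// covij// eq_sym.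
Qed.

End moments.

(** * Fluctuations of statistics weighted by the squares of q *)

Section quadratic_fluctuations.
Context {R : realType} {n : nat}.
Variables (mu : 'I_n -> probability R R) (A : 'M[R]_n) (c q : 'I_n -> R) (Q al : R).
Hypothesis symA : forall i j, A i j = A j i.
Hypothesis A0 : forall i, A i i = 0.
Hypothesis q1 : sqs q = 1.
Hypothesis qQ : forall i, `|q i| <= Q.
Hypothesis al0 : 0 <= al.
Hypothesis rowA : forall i, \sum_j A i j ^+ 2 <= al.
Implicit Types (i j k : 'I_n) (z a : 'I_n -> R) (y : R).

Notation E := (gibbs_mean mu A c).
Notation EE := (pair_mean mu A c).
Notation Tt := (resample mu A c).
Notation fld := (site_field A c).
Notation cmean := (site_mean mu A c).
Notation cvar := (site_var mu A c).
Notation resid := (site_resid mu A c).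

Let Q0 : 0 <= Q.
Proof.
case: (pickP [pred i : 'I_n | true]) => [i _|none].
  exact: le_trans (qQ i).
have := q1; rewrite /sqs big_pred0 => [/eqP|i]; first by rewrite eq_sym oner_eq0.
by have := none i.
Qed.

Lemma sum_pow4_le : \sum_i q i ^+ 4 <= Q ^+ 2.
Proof.
rewrite -[leRHS]mulr1 -q1 /sqs mulr_sumr ler_sum// => i _.
rewrite (exprD (q i) 2 2) ler_wpM2r ?sqr_ge0//.
by rewrite -real_normK ?num_real// lerXn2r ?nnegrE.
Qed.

(** Cauchy-Schwarz in j for fixed i, with sum q_j^4 <= Q^2 and the row bound, then summation against
    q_i^2. *)
Lemma sum_sqr_interaction_le :
  \sum_i \sum_j q i ^+ 2 * q j ^+ 2 * `|A i j| <= Q * Num.sqrt al.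
Proof.
rewrite -[leRHS]mul1r -q1 /sqs mulr_suml ler_sum// => i _.
under eq_bigr do rewrite -mulrA; rewrite -mulr_sumr ler_wpM2l ?sqr_ge0//.
have := abs_dotp_le (fun j => q j ^+ 2) (fun j => `|A i j|).
move=> /(le_trans (ler_norm _))/le_trans; apply.
rewrite sqs_pow4; apply: ler_pM; rewrite ?sqrtr_ge0//.
  by rewrite -[leRHS]ger0_norm// -sqrtr_sqr ler_wsqrtr//; exact: sum_pow4_le.
rewrite ler_wsqrtr// /sqs.
by under eq_bigr do rewrite real_normK ?num_real//; exact: rowA.
Qed.

(** With B = 6 and L = 16 the variance is at most 36 Q^2 + 48 Q sqrt(al), which is part of the
    expanded square of 6 Q + 4 sqrt(al). *)
Lemma antisym_stat_le (w : 'I_n -> R) (K : 'I_n -> ('I_n -> R) -> R -> R) :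
  (forall i, `|w i| = q i ^+ 2) ->
  (forall i, bS2 (K i)) ->
  (forall i z y, cube z -> `|y| <= 1 -> `|K i z y| <= 6) ->
  (forall i z y, cube z -> `|y| <= 1 -> K i (upd z i y) (z i) = - K i z y) ->
  (forall i j z y, i != j -> cube z -> `|y| <= 1 ->
     `|Tt j (K j) z - Tt j (K j) (upd z i y)| <= 16 * `|A i j|) ->
  E (fun z => `|\sum_i w i * Tt i (K i) z|) <= 6 * Q + 4 * Num.sqrt al.
Proof.
move=> wq bK KB aK lipK.
have bX i : bS (fun z => w i * Tt i (K i) z).
  by apply: bdmM; [exact: bdm_cst|exact: bS_resample].
apply: le_trans (gibbs_mean_abs_le_sqrt mu A c _ (bS_sum _ _ _ bX)) _.
have s0 := sqrtr_ge0 al.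
have p0 : 0 <= 6 * Q + 4 * Num.sqrt al by rewrite addr_ge0// mulr_ge0.
rewrite -[leRHS]ger0_norm// -sqrtr_sqr ler_wsqrtr//.
apply: le_trans (antisym_variance mu A c symA A0 w K 6 16 _ bK KB aK lipK) _ => //.
have h1 : \sum_i w i ^+ 2 <= Q ^+ 2.
  apply: le_trans sum_pow4_le; rewrite ler_sum// => i _.
  by rewrite -[w i ^+ 2]real_normK ?num_real// wq -exprM.
have h2 : \sum_i \sum_j `|w i| * `|w j| * `|A i j| <= Q * Num.sqrt al.
  by under eq_bigr do under eq_bigr do rewrite !wq; exact: sum_sqr_interaction_le.
have := sqr_ge0 (Num.sqrt al).
have -> : (6 * Q + 4 * Num.sqrt al) ^+ 2 =
  36 * Q ^+ 2 + 48 * (Q * Num.sqrt al) + 16 * Num.sqrt al ^+ 2 by ring.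
have -> : (6 : R) ^+ 2 = 36 by rewrite -natrX.
by move: h1 h2; lra.
Qed.

Definition signed_sq i z y : R := (z i - y) * `|z i - y|.
(** Chosen to be antisymmetric under the exchange of z_i and y, which leaves [cmean i] fixed, while
    its resampled mean is the squared residual minus the conditional variance. *)
Definition centered_sq i z y : R :=
  (z i ^+ 2 - y ^+ 2) - 2 * cmean i z * (z i - y).

Let bz i : @bS2 R n (fun z _ => z i).
Proof. exact: (bS2_1 _ (bS_coord i)). Qed.

Let bdel i : bS2 (fun z y => z i - y).
Proof. exact: (bS2B _ _ (bz i) bS2_id). Qed.

Lemma bS2_signed_sq i : bS2 (signed_sq i).
Proof. by apply: bdmM; [exact: bdel|apply: bdm_norm; exact: bdel]. Qed.

Lemma bS2_centered_sq i : bS2 (centered_sq i).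
Proof.
apply: bdmB; last apply: bdmM; last exact: bdel.
  by apply: bdmB; apply: bdmX; [exact: bz|exact: bS2_id].
apply: bdmM; first exact: bdm_cst.
exact: (bS2_1 _ (bS_site_mean mu A c i)).
Qed.

Lemma resample_sqr_diff i z : cube z ->
  Tt i (fun z y => (z i - y) ^+ 2) z = resid z i ^+ 2 + cvar i z.
Proof.
move=> cz; rewrite /resample /site_resid /site_var /tilt_var -/(cmean i z).
set t := fld z i; set g := cmean i z; set x := z i.
have b1 : bdm (fun y : R => 2 * x * clip y).
  by apply: bdmM; [exact: bdm_cst|exact: bdm_clip].
have b2 : bdm (fun y : R => clip y ^+ 2) by apply: bdmX; exact: bdm_clip.
rewrite (_ : (fun y => _) = fun y => x ^+ 2 - 2 * x * clip y + clip y ^+ 2); last first.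
  by apply/funext => y; ring.
rewrite tiltD//; [|exact: measurable_clip|exact: abs_clip_le|].
- rewrite tiltB//; [|exact: measurable_clip|exact: abs_clip_le|exact: bdm_cst].
  rewrite tilt_cst//; [|exact: measurable_clip|exact: abs_clip_le].
  rewrite tiltZ//; [|exact: measurable_clip|exact: abs_clip_le|exact: bdm_clip].
  rewrite -[tilt (mu i) clip t clip]/g.
  by move: (tilt _ _ _ _) => m2; ring.
- by apply: bdmB => //; exact: bdm_cst.
Qed.

Lemma resample_centered_sq i z : cube z ->
  Tt i (centered_sq i) z = resid z i ^+ 2 - cvar i z.
Proof.
move=> cz; rewrite /resample /centered_sq /site_resid /site_var /tilt_var -/(cmean i z).
set t := fld z i; set g := cmean i z; set x := z i.
have b1 : bdm (fun y : R => 2 * g * clip y).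
  by apply: bdmM; [exact: bdm_cst|exact: bdm_clip].
have b2 : bdm (fun y : R => clip y ^+ 2) by apply: bdmX; exact: bdm_clip.
rewrite (_ : (fun y => _) = fun y => (x ^+ 2 - 2 * g * x) + 2 * g * clip y - clip y ^+ 2); last first.
  by apply/funext => y; ring.
rewrite tiltB//; [|exact: measurable_clip|exact: abs_clip_le|].
- rewrite tiltD//; [|exact: measurable_clip|exact: abs_clip_le|exact: bdm_cst].
  rewrite tilt_cst//; [|exact: measurable_clip|exact: abs_clip_le].
  rewrite tiltZ//; [|exact: measurable_clip|exact: abs_clip_le|exact: bdm_clip].
  rewrite -[tilt (mu i) clip t clip]/g.
  by move: (tilt _ _ _ _) => m2; ring.
- by apply: bdmD => //; exact: bdm_cst.
Qed.

Let fld_dist z i j y : cube z -> `|y| <= 1 ->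
  `|fld z j - fld (upd z i y) j| <= 2 * `|A i j|.
Proof.
move=> cz y1; rewrite distrC site_field_updE normrM mulrC symA ler_wpM2r//.
exact: cube_dist.
Qed.

(** Controls the antisymmetric remainder of the Stein bound. The functions are bounded by 4, and
    [tilt_lip] over a field change of at most 2 |A_ij| gives the Lipschitz constant 2 x 4 x 2 =
    16. *)
Lemma signed_sq_fluctuation :
  E (fun z => `|\sum_i q i * `|q i| * Tt i (signed_sq i) z|) <=
  6 * Q + 4 * Num.sqrt al.
Proof.
apply: antisym_stat_le.
- by move=> i; rewrite normrM normr_id -expr2 real_normK ?num_real.
- exact: bS2_signed_sq.
- move=> i z y cz y1; have h := cube_dist z i y cz y1.
  rewrite /signed_sq normrM normr_id distrC.
  apply: le_trans (_ : 2 * 2 <= _); first by rewrite ler_pM.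
  by rewrite -natrM ler_nat.
- by move=> i z y cz y1; rewrite /signed_sq upd_id -opprB normrN mulNr.
move=> i j z y ij cz y1; rewrite /resample /signed_sq upd_neq; last by rewrite eq_sym.
have cl4 (y' : R) : `|(z j - clip y') * `|z j - clip y'| | <= 4.
  have h := cube_dist z j (clip y') cz (abs_clip_le _).
  rewrite normrM normr_id distrC.
  apply: le_trans (_ : 2 * 2 <= _); first by rewrite ler_pM.
  by rewrite -natrM ler_nat.
have bb : bdm (fun y' : R => (z j - clip y') * `|z j - clip y'|).
  exact: (bS2_section _ _ (bS2_signed_sq j) cz).
apply: le_trans (tilt_lip (mu j) clip measurable_clip abs_clip_le 4 _ _ _ bb cl4) _.
have := fld_dist z i j y cz y1; lra.
Qed.

(** The bound 6 is 2 + 4 from the two parts of [centered_sq]; the Lipschitz constant 16 is 8 from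
    the squared residual, through the conditional mean, plus 8 from the conditional variance. *)
Lemma centered_sq_fluctuation :
  E (fun z => `|\sum_i q i ^+ 2 * (resid z i ^+ 2 - cvar i z)|) <=
  6 * Q + 4 * Num.sqrt al.
Proof.
rewrite (eq_gibbs_mean mu A c _ (fun z => `|\sum_i q i ^+ 2 * Tt i (centered_sq i) z|)); last first.
  by move=> z cz; congr (`| _ |); apply: eq_bigr => i _; rewrite resample_centered_sq.
apply: antisym_stat_le.
- by move=> i; rewrite ger0_norm ?sqr_ge0.
- exact: bS2_centered_sq.
- move=> i z y cz y1; have h := cube_dist z i y cz y1.
  rewrite /centered_sq; apply: le_trans (ler_normB _ _) _.
  have h1 : `|z i ^+ 2 - y ^+ 2| <= 2.
    rewrite (le_trans (ler_normB _ _))// (_ : 2 = 1 + 1)// !normrX lerD// expr_le1//.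
  have h2 : `|2 * cmean i z * (z i - y)| <= 4.
    rewrite normrM; apply: le_trans (_ : 2 * 2 <= _); last by rewrite -natrM ler_nat.
    rewrite ler_pM//; last by rewrite distrC.
    by rewrite normrM ger0_norm// ler_piMr// abs_site_mean_le.
  by lra.
- move=> i z y cz y1; rewrite /centered_sq upd_id.
  by rewrite /site_mean site_field_upd//; move: (tilt _ _ _ _) => g; ring.
move=> i j z y ij cz y1; rewrite !resample_centered_sq//; last exact: cube_upd.
rewrite /site_resid upd_neq; last by rewrite eq_sym.
have m1 := abs_site_mean_le mu A c j z; have m2 := abs_site_mean_le mu A c j (upd z i y).
have hd := fld_dist z i j y cz y1.
have d1 := le_trans (tilt_mean_lip (mu j) clip measurable_clip abs_clip_le (fld z j) (fld (upd z i y) j)) hd.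
have d2 := tilt_var_lip (mu j) clip measurable_clip abs_clip_le (fld z j) (fld (upd z i y) j).
move: d1 d2; rewrite -/(cmean j z) -/(cmean j (upd z i y)) -/(cvar j z) -/(cvar j (upd z i y)).
move: m1 m2 (cz j) hd.
move: (cmean j z) (cmean j (upd z i y)) (cvar j z) (cvar j (upd z i y)) (z j) => g g' v v' x.
move: `|fld z j - _| => f m1 m2 x1 hd d1 d2.
rewrite (_ : _ - _ = (g' - g) * ((x - g) + (x - g')) - (v - v')); last by ring.
apply: le_trans (ler_normB _ _) _; rewrite normrM.
have h4 : `|x - g + (x - g')| <= 4.
  apply: le_trans (ler_normD _ _) _.
  by have := ler_normB x g; have := ler_normB x g'; lra.
have : `|g' - g| * `|x - g + (x - g')| <= 2 * `|A i j| * 4.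
  by rewrite ler_pM// distrC.
by lra.
Qed.

End quadratic_fluctuations.

(** * Stein's equation for the normal law *)

Section mean_value.
Context {R : realType}.

Lemma is_derive_mvt (F dF : R -> R) (a b : R) : a <= b ->
  (forall x, is_derive x (1 : R) F (dF x)) ->
  exists2 x, a <= x <= b & F b - F a = dF x * (b - a).
Proof.
move=> ab dFE.
have [x /[!in_itv]/= xab e] := @MVT_segment _ F dF _ _ ab (fun x _ => dFE x)
  (derivable_within_continuous (fun x _ => @ex_derive _ _ _ _ _ _ _ (dFE x))).
by exists x.
Qed.

Lemma is_derive_ge0_le (F dF : R -> R) (a b : R) : a <= b ->
  (forall x, is_derive x (1 : R) F (dF x)) ->
  (forall x, a <= x <= b -> 0 <= dF x) -> F a <= F b.
Proof.
move=> ab dFE dF0; have [x xab e] := is_derive_mvt F dF a b ab dFE.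
by rewrite -subr_ge0 e mulr_ge0 ?dF0// subr_ge0.
Qed.

Lemma is_derive_measurable (F dF : R -> R) :
  (forall x, is_derive x (1 : R) F (dF x)) -> measurable_fun [set: R] F.
Proof.
move=> dFE; apply: continuous_measurable_fun => x.
apply/differentiable_continuous/derivable1_diffP.
exact: (@ex_derive _ _ _ _ _ _ _ (dFE x)).
Qed.

End mean_value.

Section stein_normal.
Context {R : realType}.
Variable v : R.
Hypothesis v0 : 0 < v.

Let s : R := Num.sqrt v.
Let s0 : s != 0. Proof. by rewrite gt_eqF// sqrtr_gt0. Qed.
Let ss : s ^+ 2 = v. Proof. by rewrite sqr_sqrtr// ltW. Qed.
Let K := normal_peak s.
Let K0 : 0 < K. Proof. exact: normal_peak_gt0. Qed.

Let p (x : R) : R := K * expR (- (x ^+ 2 / (2 * v))).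
(** Integrating factor of Stein's equation: [e] is the inverse of v p, so [a] below is Phi / (v
    p). *)
Let e (x : R) : R := (v * K)^-1 * expR (x ^+ 2 / (2 * v)).

Let pE : normal_pdf 0 s = p.
Proof.
apply/funext => x; rewrite normal_pdfE// /p /normal_fun subr0 ss mulNr.
by rewrite -[v *+ 2]mulr_natl.
Qed.

Let p_gt0 x : 0 < p x. Proof. by rewrite mulr_gt0// expR_gt0. Qed.
Let e_gt0 x : 0 < e x. Proof. by rewrite mulr_gt0 ?expR_gt0// invr_gt0 mulr_gt0. Qed.

Let pe x : p x * e x = v^-1.
Proof.
rewrite /p /e mulrACA -expRD addNr expR0 mulr1.
by field; rewrite !gt_eqF.
Qed.

Let pN x : p (- x) = p x. Proof. by rewrite /p sqrrN. Qed.
Let eN x : e (- x) = e x. Proof. by rewrite /e sqrrN. Qed.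

Let is_derive_sq (x : R) : is_derive x (1 : R) (fun x : R => x ^+ 2 / (2 * v)) (x / v).
Proof.
apply: is_derive_eq; rewrite /GRing.scale/=; field.
by rewrite gt_eqF.
Qed.

Let is_derive_p (x : R) : is_derive x (1 : R) p (- (x / v) * p x).
Proof.
rewrite /p; have d := is_derive_sq x.
by apply: is_derive_eq; rewrite /GRing.scale/=; ring.
Qed.

Let is_derive_e (x : R) : is_derive x (1 : R) e (x / v * e x).
Proof.
rewrite /e; have d := is_derive_sq x.
by apply: is_derive_eq; rewrite /GRing.scale/=; ring.
Qed.

Let Phi (x : R) : R := fine (normal_prob 0 s `]-oo, x]%classic).

Let PhiE x : Phi x = \int[lebesgue_measure]_(y in `]-oo, x]) p y.
Proof. by rewrite /Phi /normal_prob pE. Qed.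

(** The identity as a random variable under the normal law, so that the limits of distribution
    functions apply to [Phi]. *)
Let idTR : measurableTypeR R -> R := idfun.

#[local] HB.instance Definition _ :=
  @isMeasurableFun.Build _ _ _ _ idTR (@measurable_id _ _ setT).

Let cdfE : Phi = fine \o cdf (idTR : {RV (normal_prob 0 s) >-> R}).
Proof. by apply/funext => x. Qed.

Let Phi01 x : 0 <= Phi x <= 1.
Proof.
apply/andP; split; first by rewrite fine_ge0.
by rewrite -lee_fin /Phi fineK ?fin_num_measure// probability_le1.
Qed.

Let is_derive_Phi (x : R) : is_derive x (1 : R) Phi (p x).
Proof.
have cp : continuous p by rewrite -pE; exact: continuous_normal_pdf.
have xu : x < x + 1 by rewrite ltrDl.
have [||d1 d2] := @continuous_FTC1 R p (BInfty _ true) x (x + 1) xu _ _ (cp x).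
- apply: (@integrableS _ _ _ _ setT) => //.
  by have := @integrable_normal_pdf R 0 s; rewrite -pE.
- by rewrite ltNyr.
rewrite (_ : Phi = fun y => \int[lebesgue_measure]_(t in [set` Interval -oo%O (BRight y)]) p t); last first.
  by apply/funext => y; exact: PhiE.
by apply: DeriveDef; [exact: d1|rewrite -derive1E; exact: d2].
Qed.

Let Phi_small eps x : 0 < eps -> exists2 M, M <= x & Phi M < eps.
Proof.
move=> e0.
have := cvg_cdfNy0 (idTR : {RV (normal_prob 0 s) >-> R}).
move=> /fine_cvgP[_]; rewrite -[fine \o _]cdfE => /cvgrPdist_lt/(_ _ e0)[M [_ hM]].
exists (Num.min x (M - 1)); first by rewrite ge_min lexx.
have := hM (Num.min x (M - 1)); rewrite sub0r normrN ger0_norm; last first.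
  by have /andP[] := Phi01 (Num.min x (M - 1)).
by apply; rewrite gt_min ltrBlDr ltrDl ltr01 orbT.
Qed.

Let Phi_large eps x : 0 < eps -> exists2 M, x <= M & 1 - eps < Phi M.
Proof.
move=> e0.
have := cvg_cdfy1 (idTR : {RV (normal_prob 0 s) >-> R}).
move=> /fine_cvgP[_]; rewrite -[fine \o _]cdfE => /cvgrPdist_lt/(_ _ e0)[M [_ hM]].
exists (Num.max x (M + 1)); first by rewrite le_max lexx.
have := hM (Num.max x (M + 1)).
rewrite ltr_norml => h; suff : - eps < 1 - Phi (Num.max x (M + 1)) < eps by move/andP => [_]; lra.
by apply: h; rewrite lt_max ltrDl ltr01 orbT.
Qed.

(** Phi y + Phi (- y) has derivative zero because the density is even, and the tails of [Phi]
    identify the constant. *)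
Let PhiN x : Phi (- x) = 1 - Phi x.
Proof.
have dD (y : R) : is_derive y (1 : R) (fun y => Phi y + Phi (- y)) 0.
  have d1 := is_derive_Phi y; have d2 := is_derive_Phi (- y).
  have d3 : is_derive y (1 : R) (fun y => Phi (- y)) (- p (- y)).
    have dN : is_derive y (1 : R) (fun y : R => - y) (-1) by apply: is_derive_eq.
    have := @is_derive1_comp R Phi (fun y : R => - y) y _ _ d2 dN.
    by rewrite mulrN1.
  by apply: is_derive_eq; rewrite pN subrr.
have c1 y z : y <= z -> Phi y + Phi (- y) = Phi z + Phi (- z).
  move=> yz; have [w _] := is_derive_mvt _ (fun=> 0) y z yz dD.
  by rewrite mul0r => /eqP; rewrite subr_eq0 => /eqP.
suff h : Phi x + Phi (- x) = 1 by rewrite -h; ring.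
apply/eqP; rewrite eq_le; apply/andP; split; apply/ler_addgt0Pr => eps e0.
  have [M1 M1x h1] := Phi_small eps (- x) e0.
  rewrite (c1 x (- M1)); last by lra.
  by rewrite opprK; have /andP[_ ?] := Phi01 (- M1); lra.
have [M xM h2] := Phi_large eps x e0.
rewrite (c1 x M xM).
by have /andP[? _] := Phi01 (- M); lra.
Qed.

(* Mills' upper bound; for y <= x < 0 the map y |-> v p(y) + x Phi(y) is
   nondecreasing and tends to 0 at -oo. *)
Let mills_upper x : 0 <= v * p x + x * Phi x.
Proof.
have [x0|x0] := leP 0 x.
  by have /andP[? _] := Phi01 x; rewrite addr_ge0 ?mulr_ge0// ltW// p_gt0.
have dG (y : R) : is_derive y (1 : R) (fun y => v * p y + x * Phi y) ((x - y) * p y).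
  have d1 := is_derive_p y; have d2 := is_derive_Phi y.
  apply: is_derive_eq; rewrite /GRing.scale/=; field.
  by rewrite gt_eqF.
rewrite -oppr_le0; apply/ler_addgt0Pr => eps e0; rewrite add0r.
have ex0 : 0 < eps / (- x) by rewrite divr_gt0// oppr_gt0.
have [M Mx hM] := Phi_small _ x ex0.
have := is_derive_ge0_le _ _ M x Mx dG.
move: hM; rewrite ltr_pdivlMr ?oppr_gt0// => hM h.
have : v * p M + x * Phi M <= v * p x + x * Phi x.
  by apply: h => y /andP[_ yx]; rewrite mulr_ge0 ?subr_ge0// ltW// p_gt0.
have : 0 <= v * p M by rewrite mulr_ge0// ltW// p_gt0.
by lra.
Qed.

(** The expression has derivative 2 (v p + y Phi), nonnegative by [mills_upper], and far to the left
    its value is at least - eps. *)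
Let mills_lower x : 0 <= (v + x ^+ 2) * Phi x + x * v * p x.
Proof.
have dL (y : R) : is_derive y (1 : R) (fun y => (v + y ^+ 2) * Phi y + y * v * p y)
    (2 * (v * p y + y * Phi y)).
  have d1 := is_derive_p y; have d2 := is_derive_Phi y.
  apply: is_derive_eq; rewrite /GRing.scale/=; field.
  by rewrite gt_eqF.
rewrite -oppr_le0; apply/ler_addgt0Pr => eps e0; rewrite add0r.
(* From exp w >= 1 + w the density satisfies M^2 p(M) <= 2 v K, so - M v p(M) <= 2 v^2 K / (- M), at
   most eps once - M >= N. *)
pose N := 2 * v ^+ 2 * K / eps + 1.
have N0 : 0 < N.
  rewrite /N ltr_wpDl// divr_ge0// ?ltW//.
  by rewrite !mulr_gt0// exprn_gt0.
pose M := Num.min x (- N).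
have Mx : M <= x by rewrite ge_min lexx.
have MN : M <= - N by rewrite ge_min lexx orbT.
have := is_derive_ge0_le _ _ M x Mx dL.
have M0 : M < 0 by lra.
have h1 : 0 <= (v + M ^+ 2) * Phi M.
  by have /andP[? _] := Phi01 M; rewrite mulr_ge0// addr_ge0 ?sqr_ge0// ltW.
have h2 : - M * v * p M <= eps.
  have pM : p M * (M ^+ 2 / (2 * v)) <= K.
    rewrite /p expRN mulrAC ler_pdivrMr ?expR_gt0// ler_pM2l//.
    by apply: le_trans (expR_ge1Dx _); rewrite lerDr.
  have pM2 : - M * v * p M * (- M) <= 2 * v ^+ 2 * K.
    have -> : - M * v * p M * (- M) = 2 * v ^+ 2 * (p M * (M ^+ 2 / (2 * v))).
      by field; rewrite gt_eqF.
    by rewrite ler_wpM2l// mulr_ge0 ?sqr_ge0.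
  have h3 : 2 * v ^+ 2 * K <= eps * N.
    by rewrite /N mulrDr mulr1 [eps * (_ / _)]mulrC divfK ?gt_eqF// lerDl ltW.
  have nM0 : 0 < - M by rewrite oppr_gt0.
  rewrite -(ler_pM2r nM0); apply: le_trans pM2 (le_trans h3 _).
  by rewrite ler_pM2l//; lra.
move=> h; have := h (fun y _ => mulr_ge0 (ler0n R 2) (mills_upper y)).
by lra.
Qed.

Let a x : R := Phi x * e x.

Let a_ge0 x : 0 <= a x.
Proof. by have /andP[? _] := Phi01 x; rewrite mulr_ge0// ltW. Qed.

Let is_derive_a (x : R) : is_derive x (1 : R) a ((1 + x * a x) / v).
Proof.
rewrite /a; have d1 := is_derive_e x; have d2 := is_derive_Phi x.
apply: is_derive_eq; rewrite /GRing.scale/=.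
by rewrite [e x * p x]mulrC pe; field; rewrite gt_eqF.
Qed.

Let xa_geN1 x : -1 <= x * a x.
Proof.
have := mulr_ge0 (mills_upper x) (ltW (e_gt0 x)).
by rewrite mulrDl -mulrA pe divff ?gt_eqF// /a mulrA; lra.
Qed.

Let is_derive_xa (x : R) : is_derive x (1 : R) (fun x => x * a x)
  (((v + x ^+ 2) * a x + x) / v).
Proof.
have d := is_derive_a x; apply: is_derive_eq; rewrite /GRing.scale/=; field.
by rewrite gt_eqF.
Qed.

(** The derivative is the quantity of [mills_lower] times the positive factor e / v. *)
Let xa_nd x y : x <= y -> x * a x <= y * a y.
Proof.
move=> xy; apply: (is_derive_ge0_le _ _ x y xy is_derive_xa) => z _.
apply: divr_ge0; last exact: ltW.
have := mulr_ge0 (mills_lower z) (ltW (e_gt0 z)).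
have -> : ((v + z ^+ 2) * Phi z + z * v * p z) * e z =
   (v + z ^+ 2) * (Phi z * e z) + z * v * (p z * e z) by ring.
by rewrite pe mulfK ?gt_eqF.
Qed.

Let a_nd x y : x <= y -> a x <= a y.
Proof.
move=> xy; apply: (is_derive_ge0_le _ _ x y xy is_derive_a) => z _.
by apply: divr_ge0; [have := xa_geN1 z; lra|exact: ltW].
Qed.

(** The exact value is sqrt(pi / (2 v)), and pi / 2 < 2. *)
Let a0_le : a 0 <= Num.sqrt (2 / v).
Proof.
have Phi0 : Phi 0 = 1 / 2 by have := PhiN 0; rewrite oppr0; lra.
rewrite /a Phi0 /e expr0n/= mul0r expR0 mulr1 /K /normal_peak ss.
have -> : 1 / 2 * (v * (Num.sqrt (v * pi *+ 2))^-1)^-1 = Num.sqrt (v * pi *+ 2) / (2 * v).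
  by field; rewrite !gt_eqF// sqrtr_gt0 mulrn_wgt0// mulr_gt0// pi_gt0.
have -> : Num.sqrt (v * pi *+ 2) / (2 * v) = Num.sqrt (v * pi *+ 2 / (2 * v) ^+ 2).
  rewrite sqrtrM; last by rewrite mulrn_wge0// mulr_ge0// ?pi_ge0// ltW.
  by rewrite sqrtrV ?sqr_ge0// sqrtr_sqr gtr0_norm// mulr_gt0.
rewrite ler_wsqrtr//.
have -> : v * pi *+ 2 / (2 * v) ^+ 2 = pi / 2 / v.
  by rewrite -mulr_natl; field; rewrite gt_eqF.
by rewrite ler_pM2r ?invr_gt0// ltW// pihalf_lt2.
Qed.

Variable t : R.

(** The bounded solution of Stein's equation for the indicator of ]-oo, t]. To the right of t the
    usual factor (1 - Phi x) / (v p x) is written a (- x) by symmetry. *)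
Let f x : R := if x <= t then (1 - Phi t) * a x else Phi t * a (- x).

Let ftE : (1 - Phi t) * a t = Phi t * a (- t).
Proof. by rewrite /a eN PhiN; ring. Qed.

Let fl x : x <= t -> f x = (1 - Phi t) * a x.
Proof. by rewrite /f => ->. Qed.

Let fr x : t <= x -> f x = Phi t * a (- x).
Proof.
rewrite le_eqVlt => /predU1P[<-|tx]; first by rewrite /f lexx ftE.
by rewrite /f leNgt tx.
Qed.

Let Pt01 := Phi01 t.

Let measurable_stein : measurable_fun [set: R] f.
Proof.
have ma := is_derive_measurable _ _ is_derive_a.
apply: measurable_fun_ifT.
- by apply: measurable_fun_ler; [exact: measurable_id|exact: measurable_cst].
- by apply: measurable_funM => //; exact: measurable_cst.
- apply: measurable_funM; first exact: measurable_cst.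
  exact: measurableT_comp.
Qed.

(** [f] rises up to t and falls afterwards; at t the sign of t decides which of the two expressions
    is compared with a 0. *)
Let f_bound x : `|f x| <= Num.sqrt (2 / v).
Proof.
have /andP[P0 P1] := Pt01.
have q0 := sqrtr_ge0 (2 / v).
have fge0 : 0 <= f x.
  by rewrite /f; case: ifP => _; rewrite mulr_ge0// subr_ge0.
rewrite ger0_norm//.
have ft : f t <= Num.sqrt (2 / v).
  have [t0|t0] := leP t 0.
    rewrite fl//; apply: le_trans (le_trans (a_nd _ _ t0) a0_le).
    by rewrite ler_piMl ?a_ge0//; lra.
  rewrite fr//; apply: le_trans (_ : a 0 <= _) => //.
  apply: le_trans (_ : a (- t) <= _); last by apply: a_nd; lra.
  by rewrite ler_piMl ?a_ge0.
apply: le_trans ft; have [xt|tx] := leP x t.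
  by rewrite !fl// ler_wpM2l ?subr_ge0// a_nd.
rewrite !fr ?(ltW tx)// ler_wpM2l// a_nd//; lra.
Qed.

Let kl x : x <= t -> x * f x = (1 - Phi t) * (x * a x).
Proof. by move=> xt; rewrite fl// mulrCA. Qed.

Let kr x : t <= x -> x * f x = - (Phi t * ((- x) * a (- x))).
Proof. by move=> xt; rewrite fr//; ring. Qed.

Let k_nd x y : x <= y -> x * f x <= y * f y.
Proof.
have /andP[P0 P1] := Pt01.
have L x' y' : x' <= y' -> y' <= t -> x' * f x' <= y' * f y'.
  move=> xy yt; rewrite !kl//; last exact: le_trans yt.
  by rewrite ler_wpM2l ?subr_ge0// xa_nd.
have U x' y' : x' <= y' -> t <= x' -> x' * f x' <= y' * f y'.
  move=> xy tx; rewrite !kr//; last exact: le_trans xy.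
  by rewrite lerN2 ler_wpM2l// xa_nd// lerN2.
move=> xy; have [yt|ty] := leP y t; first exact: L.
have [tx|xt] := leP t x; first exact: U.
apply: le_trans (L x t (ltW xt) (lexx _)) _.
exact: (U t y (ltW ty)).
Qed.

Let k_bound x : `|x * f x| <= 1.
Proof.
have /andP[P0 P1] := Pt01.
have lowN y : y <= 0 -> -1 <= y * a y <= 0.
  by move=> y0; rewrite xa_geN1/= mulr_le0_ge0.
have kt : -1 <= t * f t <= 1.
  have [t0|t0] := leP t 0.
    rewrite kl//; have /andP[? ?] := lowN t t0; apply/andP; split; nra.
  rewrite kr//; have /andP[? ?] := lowN (- t) (ltac:(lra)); apply/andP; split; nra.
have /andP[kt1 kt2] := kt.
rewrite ler_norml; have [xt|tx] := leP x t.
  apply/andP; split; last exact: le_trans (k_nd _ _ xt) kt2.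
  by rewrite kl//; have := xa_geN1 x; nra.
apply/andP; split; first exact: le_trans kt1 (k_nd _ _ (ltW tx)).
rewrite kr ?(ltW tx)//; have := xa_geN1 (- x); nra.
Qed.

Let h (x : R) : R := (x <= t)%R%:R.

Let pieceL x y : x <= y -> y <= t ->
  (y - x) * (x * f x + 1 - Phi t) <= v * (f y - f x) <= (y - x) * (y * f y + 1 - Phi t).
Proof.
move=> xy yt.
have d (z : R) : is_derive z (1 : R) (fun z => (1 - Phi t) * a z)
    ((1 - Phi t) * ((1 + z * a z) / v)).
  by have da := is_derive_a z; apply: is_derive_eq; rewrite /GRing.scale/=; ring.
have [z /andP[xz zy] E] := is_derive_mvt _ _ x y xy d.
have zt := le_trans zy yt.
rewrite (fl y)// (fl x) ?(le_trans xy)// E.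
rewrite -(fl x) ?(le_trans xy)// -(fl y)//.
have -> : v * ((1 - Phi t) * ((1 + z * a z) / v) * (y - x)) =
    (y - x) * (z * f z + 1 - Phi t).
  by rewrite kl//; field; rewrite gt_eqF.
by rewrite !ler_wpM2l ?subr_ge0//= ?lerD2r ?k_nd.
Qed.

Let pieceR x y : x <= y -> t <= x ->
  (y - x) * (x * f x - Phi t) <= v * (f y - f x) <= (y - x) * (y * f y - Phi t).
Proof.
move=> xy tx.
have d (z : R) : is_derive z (1 : R) (fun z => Phi t * a (- z))
    (- (Phi t * ((1 + (- z) * a (- z)) / v))).
  have dN : is_derive z (1 : R) (fun y : R => - y) (-1) by apply: is_derive_eq.
  have da := @is_derive1_comp R a (fun y : R => - y) z _ _ (is_derive_a (- z)) dN.
  by apply: is_derive_eq; rewrite /GRing.scale/=; ring.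
have [z /andP[xz zy] E] := is_derive_mvt _ _ x y xy d.
have tz := le_trans tx xz.
have ty := le_trans tx xy.
rewrite (fr y)// (fr x)// E -(fr x)// -(fr y)//.
have -> : v * (- (Phi t * ((1 + (- z) * a (- z)) / v)) * (y - x)) =
    (y - x) * (z * f z - Phi t).
  by rewrite kr//; field; rewrite gt_eqF.
by rewrite !ler_wpM2l ?subr_ge0//= ?lerD2r ?k_nd.
Qed.

(* The derivative of f solves Stein's equation v f' = x f + h - Phi(t), h being
   the indicator of ]-oo, t]; the two-sided bound on increments holds because
   x f is nondecreasing and h nonincreasing. *)
Let increment x y : x < y ->
  (y - x) * (x * f x + h y - Phi t) <= v * (f y - f x) <= (y - x) * (y * f y + h x - Phi t).
Proof.
move=> xy; rewrite /h; have [yt|ty] := leP y t.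
  by rewrite (le_trans (ltW xy) yt); exact: pieceL (ltW xy) yt.
have yx : 0 <= y - x by rewrite subr_ge0 ltW.
have [tx|xt] := ltP t x.
  by rewrite !addr0; exact: pieceR (ltW xy) (ltW tx).
have /andP[L1 L2] := pieceL x t xt (lexx _).
have /andP[U1 U2] := pieceR t y (ltW ty) (lexx _).
have kxt := k_nd _ _ xt; have kty := k_nd _ _ (ltW ty).
have tx0 : 0 <= t - x by rewrite subr_ge0.
have yt0 : 0 <= y - t by rewrite subr_ge0 ltW.
have -> : v * (f y - f x) = v * (f t - f x) + v * (f y - f t) by ring.
have m1 := ler_wpM2l yt0 kxt; have m2 := ler_wpM2l tx0 kty.
rewrite /= ?mulr1n ?mulr0n; apply/andP; split; lra.
Qed.

(** The equation is recorded through increments rather than a derivative: [f] has a kink at t, and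
    the exchange argument only compares values at two points. *)
Lemma stein_solution : exists f : R -> R,
  [/\ measurable_fun [set: R] f, forall x, `|f x| <= Num.sqrt (2 / v),
     forall x, `|x * f x| <= 1 &
     forall x y, x < y ->
       (y - x) * (x * f x + (y <= t)%R%:R -
         fine (normal_prob 0 (Num.sqrt v) `]-oo, t]%classic)) <= v * (f y - f x)
       <= (y - x) * (y * f y + (x <= t)%R%:R -
         fine (normal_prob 0 (Num.sqrt v) `]-oo, t]%classic))].
Proof. by exists f; split. Qed.

End stein_normal.

(** * Normal approximation *)

Section centering_error.
Context {R : realType} {n : nat}.
Variables (A : 'M[R]_n) (rho : R) (b d q eps r : 'I_n -> R) (lam v : R).
Hypothesis rho01 : 0 < rho < 1.
Hypothesis symA : forall i j, A i j = A j i.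
Hypothesis A2 : forall x : 'I_n -> R, sqs (mv A x) <= rho ^+ 2 * sqs x.
Hypothesis A4 : forall x : 'I_n -> R, qds (mv A x) <= rho ^+ 4 * qds x.
Hypothesis d01 : forall i, 0 <= d i <= 1.
Hypothesis v01 : 0 <= v <= 1.
Hypothesis lam_le : `|lam| <= rho.
Hypothesis q1 : sqs q = 1.
Hypothesis epsE : forall i, eps i = mv A q i - lam * q i.
Hypothesis rE : forall i, r i = \sum_j A i j * q j * (d j - v).

Lemma sqrt_sqs_eps_le : Num.sqrt (sqs eps) <= 2.
Proof.
have /andP[r0 r1] := rho01.
rewrite -[leRHS](@ger0_norm _ 2)// -sqrtr_sqr ler_wsqrtr//.
rewrite (_ : eps = fun i => mv A q i + (- lam * q i)); last first.
  by apply/funext => i; rewrite epsE mulNr.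
apply: le_trans (sqs_add_le (1 / 2) _ _ _) _; first by apply/andP; split; lra.
have h1 : sqs (mv A q) <= 1.
  by apply: le_trans (A2 q) _; rewrite q1 mulr1 expr_le1// ltW.
have h2 : sqs (fun i => - lam * q i) <= 1.
  rewrite (_ : sqs _ = lam ^+ 2); last first.
    rewrite -[RHS]mulr1 -q1 /sqs mulr_sumr; apply: eq_bigr => i _.
    by rewrite exprMn sqrrN.
  by rewrite -real_normK ?num_real// expr_le1//; exact: le_trans lam_le (ltW r1).
have half (a1 a2 : R) : a1 / (1 / 2) + a2 / (1 - 1 / 2) = 2 * a1 + 2 * a2 by field.
by rewrite half (_ : 2 ^+ 2 = 4); [lra|rewrite -natrX].
Qed.

Lemma sqrt_sqs_r_le : Num.sqrt (sqs r) <= 1.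
Proof.
have /andP[r0 r1] := rho01; have /andP[v0 v1] := v01.
rewrite -[leRHS](@ger0_norm _ 1)// -sqrtr_sqr ler_wsqrtr//.
rewrite (_ : r = mv A (fun j => q j * (d j - v))); last first.
  by apply/funext => i; rewrite rE; apply: eq_bigr => j _; ring.
apply: le_trans (A2 _) _; rewrite expr1n -[leRHS]mulr1.
apply: ler_pM; rewrite ?sqr_ge0 ?sqs_ge0//; first by rewrite expr_le1// ltW.
rewrite -q1 /sqs ler_sum// => i _; rewrite exprMn ler_piMr ?sqr_ge0//.
have /andP[d0 d1] := d01 i.
by rewrite -real_normK ?num_real// expr_le1// ler_norml; apply/andP; split; lra.
Qed.

(** The 16 collects three quadratic remainders: 4 along [q] of norm 1, 4 x 2 along [eps] of norm at
    most 2, and 4 along [r] of norm at most 1; the last two carry the resolvent factor 1 / (1 -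
    rho). *)
Lemma centering_error_le (w1 w2 x g : 'I_n -> R) :
  (forall i, w1 i = d i * (eps i + mv A w1 i)) ->
  (forall i, w2 i = d i * (r i + mv A w2 i)) ->
  (forall i, `|g i - b i - d i * mv A x i| <= 4 * mv A x i ^+ 2) ->
  `|(1 - lam * v) * dotp q x - dotp q b - dotp q (fun i => x i - g i)| <=
  16 / (1 - rho) * Num.sqrt (qds (mv A x)) +
  (`|dotp eps b| + `|dotp r b| +
   (Num.sqrt (sqs eps) + Num.sqrt (sqs r)) * Num.sqrt (sqs (mv A b)) / (1 - rho)) +
  (`|dotp (fun i => eps i + mv A w1 i) (fun i => x i - g i)| +
   `|dotp (fun i => r i + mv A w2 i) (fun i => x i - g i)|).
Proof.
move=> w1E w2E rem_le; have /andP[r0 r1] := rho01; have /andP[v0 v1] := v01.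
have dl : 0 < 1 - rho by rewrite subr_gt0.
have h0 := linear_stat_rem n A b d x g rem_le q.
have h1 := linear_stat_le n A rho b d x g rho01 symA rem_le eps w1 d01 A2 w1E.
have h2 := linear_stat_le n A rho b d x g rho01 symA rem_le r w2 d01 A2 w2E.
rewrite (eigen_stat_eq n A b d x g symA q eps r lam v epsE rE).
move: h0 h1 h2; rewrite q1 sqrtr1 mul1r.
move: (dotp q (fun i => x i - g i)) (dotp q (fun i => g i - _ - _)) => a0 a1.
move: (dotp eps (fun i => x i - b i)) (dotp r (fun i => x i - b i)) => a2 a3.
move: (dotp eps b) (dotp r b) `|dotp _ _| `|dotp _ _| => a4 a5 L1 L2.
have e2 := sqrt_sqs_eps_le; have rr := sqrt_sqs_r_le.
have e0 := sqrtr_ge0 (sqs eps); have r0' := sqrtr_ge0 (sqs r).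
have M0 := sqrtr_ge0 (qds (mv A x)); have N0 := sqrtr_ge0 (sqs (mv A b)).
move: (Num.sqrt (sqs eps)) (Num.sqrt (sqs r)) e2 rr e0 r0' => e rr' e2 rr e0 r0'.
move: (Num.sqrt (qds (mv A x))) (Num.sqrt (sqs (mv A b))) M0 N0 => M N M0 N0.
have i1 : 1 <= (1 - rho)^-1 by rewrite invf_ge1//; lra.
move: (1 - rho)^-1 i1 => i i1 h0 h1 h2.
have h3 : `|v * a4| <= `|a4| by rewrite normrM (ger0_norm v0) ler_piMl.
have h4 : `|v * a2| <= `|a2| by rewrite normrM (ger0_norm v0) ler_piMl.
have t1 : `|a0 + a1 + (v * a4 + a5) + (v * a2 + a3) - a0| <=
    `|a1| + (`|v * a4| + `|a5|) + (`|v * a2| + `|a3|).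
  rewrite (_ : _ - a0 = a1 + (v * a4 + a5) + (v * a2 + a3)); last by ring.
  by rewrite (le_trans (ler_normD _ _))// lerD ?(le_trans (ler_normD _ _))// ?lerD// ?ler_normD.
apply: le_trans t1 _.
have m1 : M <= i * M by rewrite ler_peMl.
have m2 : e * (i * M) <= 2 * (i * M) by rewrite ler_wpM2r// mulr_ge0//; lra.
have m3 : rr' * (i * M) <= 1 * (i * M) by rewrite ler_wpM2r// mulr_ge0//; lra.
by lra.
Qed.

End centering_error.

(* Both bounds on D (f x - f x') refine to a symmetric and an antisymmetric part
   in D; only the antisymmetric part D |D| survives reversibility. *)
Lemma stein_increment_le {R : realType} (v : R) (f h : R -> R) (P : R) :
  (forall x y, x < y ->
     (y - x) * (x * f x + h y - P) <= v * (f y - f x) <= (y - x) * (y * f y + h x - P)) ->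
  forall x x', let D := x - x' in
  v * (D * (f x - f x')) <= D ^+ 2 * (x * f x + h x - P) +
    2^-1 * (D ^+ 2 * ((h x' + x' * f x') - (h x + x * f x))) +
    2^-1 * (D * `|D| * ((h x' - x' * f x') - (h x - x * f x))) /\
  D ^+ 2 * (x * f x + h x - P) +
    2^-1 * (D ^+ 2 * ((h x' + x' * f x') - (h x + x * f x))) -
    2^-1 * (D * `|D| * ((h x' - x' * f x') - (h x - x * f x))) <= v * (D * (f x - f x')).
Proof.
move=> H x x' D; have [lt|gt|e] := ltgtP x x'.
- have D0 : D < 0 by rewrite subr_lt0.
  have /andP[h1 h2] := H x x' lt; rewrite (ltr0_norm D0).
  have N0 : 0 <= - D by lra.
  have m1 := ler_wpM2l N0 h1; have m2 := ler_wpM2l N0 h2.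
  have gibbs_meanD : x' - x = - D by rewrite /D; ring.
  rewrite gibbs_meanD in m1 m2; split; lra.
- have D0 : 0 < D by rewrite subr_gt0.
  have /andP[h1 h2] := H x' x gt; rewrite (gtr0_norm D0).
  have m1 := ler_wpM2l (ltW D0) h1; have m2 := ler_wpM2l (ltW D0) h2.
  by split; rewrite -/D in m1 m2; lra.
- by rewrite /D e subrr; split; lra.
Qed.

Section normal_approximation.
Context {R : realType} {n : nat}.
Variables (mu : 'I_n -> probability R R) (A : 'M[R]_n) (c q : 'I_n -> R).
Variables (rho lam Q al : R).
Hypothesis rho01 : 0 < rho < 1.
Hypothesis symA : forall i j, A i j = A j i.
Hypothesis A0 : forall i, A i i = 0.
Hypothesis A2 : forall x : 'I_n -> R, sqs (mv A x) <= rho ^+ 2 * sqs x.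
Hypothesis A4 : forall x : 'I_n -> R, qds (mv A x) <= rho ^+ 4 * qds x.
Hypothesis q1 : sqs q = 1.
Hypothesis qQ : forall i, `|q i| <= Q.
Hypothesis al0 : 0 <= al.
Hypothesis rowA : forall i, \sum_j A i j ^+ 2 <= al.
Hypothesis lam_le : `|lam| <= rho.

Notation E := (gibbs_mean mu A c).
Notation EE := (pair_mean mu A c).
Notation Tt := (resample mu A c).
Notation fld := (site_field A c).
Notation cmean := (site_mean mu A c).
Notation cvar := (site_var mu A c).
Notation resid := (site_resid mu A c).
Notation lstat := (lstat mu A c).

(** [free] refers to the product measure tilted by the external field alone: the values psi'(c_i),
    psi''(c_i) and upsilon. [eigen_defect] is the vector epsilon, and [var_defect] the vector whose
    squared norm is R1. *)
Definition free_mean (i : 'I_n) : R := tilt (mu i) clip (c i) clip.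
Definition free_var (i : 'I_n) : R := tilt_var (mu i) clip (c i).
Definition free_upsilon : R := \sum_i q i ^+ 2 * free_var i.
Definition eigen_defect (i : 'I_n) : R := mv A q i - lam * q i.
Definition var_defect (i : 'I_n) : R := \sum_j A i j * q j * (free_var j - free_upsilon).
Definition Tstat (z : 'I_n -> R) : R := dotp q z - dotp q free_mean / (1 - lam * free_upsilon).

Let del := 1 - rho.
Let del_gt0 : 0 < del. Proof. by rewrite subr_gt0; have /andP[] := rho01. Qed.

Let d01 i : 0 <= free_var i <= 1.
Proof. exact: (tilt_var_bounds _ _ measurable_clip abs_clip_le). Qed.

Lemma v01 : 0 <= free_upsilon <= 1.
Proof.
apply/andP; split.
  by apply: sumr_ge0 => i _; have /andP[? _] := d01 i; rewrite mulr_ge0 ?sqr_ge0.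
rewrite -q1 /sqs ler_sum// => i _; have /andP[_ ?] := d01 i.
by rewrite ler_piMr ?sqr_ge0.
Qed.

Lemma one_minus_lamv : del <= 1 - lam * free_upsilon.
Proof.
have /andP[v1 v2] := v01; have /andP[r1 r2] := rho01.
rewrite /del lerD2l lerN2; apply: le_trans (ler_norm _) _.
by rewrite normrM (ger0_norm v1) -[leRHS]mulr1 ler_pM.
Qed.

(** Mean of the squared l4 norm of the local field, the common size of the quadratic errors. *)
Let S4 : R := E (fun z => Num.sqrt (qds (mv A z))).

Let b_qds : bS (fun z => qds (mv A z)).
Proof. by apply: bdm_sum => i; apply: bdmX; exact: bS_mv. Qed.

Let b_sqrt : bS (fun z => Num.sqrt (qds (mv A z))).
Proof.
have [mF [B FB]] := b_qds; split.
  rewrite (_ : (fun x => _) = fun x : n.-tuple R => qds (mv A (clip_state x)) `^ 2^-1).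
    by apply: (measurableT_comp (@measurable_powR R 2^-1)).
  by apply/funext => x; rewrite powR12_sqrt ?qds_ge0.
exists (Num.sqrt B) => x; rewrite ger0_norm ?sqrtr_ge0// ler_wsqrtr//.
exact: le_trans (ler_norm _) (FB x).
Qed.

Let gb z i : `|cmean i z - free_mean i| <= `|mv A z i|.
Proof.
apply: le_trans (tilt_mean_lip _ _ measurable_clip abs_clip_le _ _) _.
by rewrite /site_field addrK.
Qed.

Let rem_le z i : `|cmean i z - free_mean i - free_var i * mv A z i| <= 4 * mv A z i ^+ 2.
Proof.
have := tilt_mean_taylor2 (mu i) _ measurable_clip abs_clip_le (fld z i) (c i).
by rewrite /site_field addrK.
Qed.

Lemma field_norm_ge0 : 0 <= S4.
Proof. by apply: gibbs_mean_ge0 => // z _; exact: sqrtr_ge0. Qed.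

(** Entry i of [A xi] is the linear statistic with coefficients [A i], whose fourth moment is at
    most 3600 al^2. Splitting with weight 1/2 costs 8, and 8 x^2 + 28800 y^2 <= (3 x + 170 y)^2 for
    x, y >= 0. *)
Lemma field_norm_le : S4 <= (3 * Num.sqrt (qds (mv A free_mean)) + 170 * (Num.sqrt n%:R * al)) / del ^+ 2.
Proof.
have S0 := field_norm_ge0.
set X := 3 * _ + _.
have X0 : 0 <= X by rewrite addr_ge0 ?mulr_ge0 ?sqrtr_ge0.
have D0 : 0 < del ^+ 2 by rewrite exprn_gt0.
rewrite -(@ler_pXn2r _ 2) ?nnegrE//; last exact: divr_ge0 X0 (ltW D0).
apply: le_trans (gibbs_mean_sqr_le _ _ _ _ b_sqrt) _.
rewrite (eq_gibbs_mean mu A c _ (fun z => qds (mv A z))); last first.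
  by move=> z _; rewrite sqr_sqrtr ?qds_ge0.
have bl i : bS (fun z => lstat (A i) z ^+ 4) by apply: bdmX; exact: bS_lstat.
have bs : bS (fun z => \sum_i lstat (A i) z ^+ 4) := bS_sum _ _ _ bl.
pose k := 8 / del ^+ 4.
have bk : bS (fun z => k * (qds (mv A free_mean) + \sum_i lstat (A i) z ^+ 4)).
  apply: bdmM; first exact: bdm_cst.
  by apply: bdmD => //; exact: bdm_cst.
have le1 : E (fun z => qds (mv A z)) <=
    E (fun z => k * (qds (mv A free_mean) + \sum_i lstat (A i) z ^+ 4)).
  apply: le_gibbs_mean => // z cz.
  apply: le_trans (qds_local_field n A rho free_mean z (fun i => cmean i z) rho01 A4 (gb z)) _.
  rewrite /k mulrAC ler_wpM2r ?invr_ge0 ?exprn_ge0// ?(ltW del_gt0)//.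
  have half : 0 < (1 / 2 : R) < 1 by apply/andP; split; lra.
  apply: le_trans (qds_add_le _ _ _ half) _.
  have -> : (fun i => z i - cmean i z) = resid z by [].
  rewrite -[\sum_i lstat (A i) z ^+ 4]/(qds (mv A (resid z))).
  have hf (x y : R) : x / (1 / 2) ^+ 3 + y / (1 - 1 / 2) ^+ 3 = 8 * (x + y) by field.
  by rewrite hf.
apply: le_trans le1 _.
rewrite gibbs_meanZ; last by apply: bdmD => //; exact: bdm_cst.
rewrite (gibbs_meanD mu A c (fun=> qds (mv A free_mean)))//; last exact: bdm_cst.
rewrite gibbs_mean_cst gibbs_mean_sum//.
have sl : \sum_i E (fun z => lstat (A i) z ^+ 4) <= 3600 * (n%:R * al ^+ 2).
  apply: le_trans (_ : \sum_(i < n) 3600 * al ^+ 2 <= _).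
    apply: ler_sum => i _.
    apply: le_trans (lstat_moment4 mu A c rho rho01 symA A0 A2 (A i)) _.
    have ha : sqs (A i) <= al := rowA i.
    have := sqs_ge0 (A i); move: (sqs (A i)) ha => a ha a0.
    have : a ^+ 2 <= al ^+ 2 by rewrite lerXn2r.
    by lra.
  rewrite sumr_const card_ord -mulr_natl; lra.
rewrite expr_div_n -exprM /k mulrAC ler_pM2r ?invr_gt0 ?exprn_gt0//.
apply: le_trans (_ : 8 * (qds (mv A free_mean) + 3600 * (n%:R * al ^+ 2)) <= _).
  by rewrite ler_wpM2l// lerD2l.
have e1 : qds (mv A free_mean) = Num.sqrt (qds (mv A free_mean)) ^+ 2 by rewrite sqr_sqrtr ?qds_ge0.
have e2 : n%:R * al ^+ 2 = (Num.sqrt n%:R * al) ^+ 2 by rewrite exprMn sqr_sqrtr.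
rewrite e1 e2 /X.
have : 0 <= Num.sqrt n%:R * al by rewrite mulr_ge0 ?sqrtr_ge0.
have := sqrtr_ge0 (qds (mv A free_mean)).
move: (Num.sqrt (qds _)) (Num.sqrt n%:R * al) => x y x0 y0.
rewrite -subr_ge0.
rewrite (_ : _ - _ = x ^+ 2 + 100 * y ^+ 2 + 1020 * (x * y)); last by ring.
by have := mulr_ge0 x0 y0; have := sqr_ge0 x; have := sqr_ge0 y; lra.
Qed.

Let eps_norm := Num.sqrt (sqs eigen_defect).
Let r_norm := Num.sqrt (sqs var_defect).
Let nu_norm := Num.sqrt (sqs (mv A free_mean)).

Definition stat_err (z : 'I_n -> R) : R := (1 - lam * free_upsilon) * Tstat z - dotp q (resid z).

Lemma bS_stat_err : bS stat_err.
Proof.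
apply: bdmB; last exact: (bS_lstat mu A c q).
apply: bdmM; first exact: bdm_cst.
by apply: bdmB; [exact: bS_dotp|exact: bdm_cst].
Qed.

Lemma stat_errE z : stat_err z =
  (1 - lam * free_upsilon) * dotp q z - dotp q free_mean - dotp q (fun i => z i - cmean i z).
Proof.
have D : 1 - lam * free_upsilon != 0 by rewrite gt_eqF// (lt_le_trans del_gt0)// one_minus_lamv.
rewrite /stat_err /Tstat -[dotp q (resid z)]/(dotp q (fun i => z i - cmean i z)).
by move: (dotp q (fun i => _)) => x; field.
Qed.

(** The pathwise estimate [centering_error_le] is averaged. The coefficients of its two linear
    statistics are controlled by the resolvent bound, and first moments are at most 8 times their
    norms. *)
Lemma stat_err_le : E (fun z => `|stat_err z|) <=
  16 / del * S4 + (`|dotp eigen_defect free_mean| + `|dotp var_defect free_mean| +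
   (eps_norm + r_norm) * nu_norm / del) + 8 * (eps_norm + r_norm) / del.
Proof.
have [w1 w1E] := resolvent_exists n A rho rho01 symA A2 free_var eigen_defect d01.
have [w2 w2E] := resolvent_exists n A rho rho01 symA A2 free_var var_defect d01.
have [_ n1] := resolvent_bounds n A rho rho01 A2 free_var eigen_defect w1 d01 w1E.
have [_ n2] := resolvent_bounds n A rho rho01 A2 free_var var_defect w2 d01 w2E.
pose a1 i := eigen_defect i + mv A w1 i; pose a2 i := var_defect i + mv A w2 i.
have l1 := abs_lstat_le mu A c rho rho01 symA A0 A2 a1.
have l2 := abs_lstat_le mu A c rho rho01 symA A0 A2 a2.
pose k := `|dotp eigen_defect free_mean| + `|dotp var_defect free_mean| + (eps_norm + r_norm) * nu_norm / del.
have bl a : bS (fun z => `|lstat a z|) by apply: bdm_norm; exact: bS_lstat.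
have bM : bS (fun z => 16 / del * Num.sqrt (qds (mv A z))).
  by apply: bdmM => //; exact: bdm_cst.
have bMk : bS (fun z => 16 / del * Num.sqrt (qds (mv A z)) + k).
  by apply: bdmD => //; exact: bdm_cst.
have bL : bS (fun z => `|lstat a1 z| + `|lstat a2 z|) by apply: bdmD; exact: bl.
have le1 : E (fun z => `|stat_err z|) <= E (fun z =>
    (16 / del * Num.sqrt (qds (mv A z)) + k) + (`|lstat a1 z| + `|lstat a2 z|)).
  apply: le_gibbs_mean.
  - by apply: bdm_norm; exact: bS_stat_err.
  - exact: bdmD.
  move=> z cz; rewrite stat_errE.
  exact: (centering_error_le A rho free_mean free_var q eigen_defect var_defect lam free_upsilon rho01 symA A2 d01 v01
    lam_le q1 (fun=> erefl) (fun=> erefl) w1 w2 z _ w1E w2E (rem_le z)).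
apply: le_trans le1 _.
rewrite (gibbs_meanD mu A c _ _ bMk bL) (gibbs_meanD mu A c _ _ bM (bS_cst _)) gibbs_mean_cst.
rewrite (gibbs_meanD mu A c _ _ (bl a1) (bl a2)) (gibbs_meanZ mu A c _ _ b_sqrt).
rewrite lerD2l mulrDr mulrDl lerD//.
  by apply: le_trans l1 _; rewrite -mulrA ler_wpM2l.
by apply: le_trans l2 _; rewrite -mulrA ler_wpM2l.
Qed.

(** The sum is the conditional mean, given the state, of the sum of the squares of q_i (s_i - s_i');
    Stein's method asks that half of it be close to upsilon. *)
Definition var_err (z : 'I_n -> R) : R :=
  free_upsilon - 2^-1 * \sum_i q i ^+ 2 * (resid z i ^+ 2 + cvar i z).

Let Q0 : 0 <= Q.
Proof.
case: (pickP [pred i : 'I_n | true]) => [i _|none].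
  exact: le_trans (qQ i).
have := q1; rewrite /sqs big_pred0 => [/eqP|i]; first by rewrite eq_sym oner_eq0.
by have := none i.
Qed.

Let b_quad : bS (fun z => \sum_i q i ^+ 2 * (resid z i ^+ 2 + cvar i z)).
Proof.
apply: bdm_sum => i; apply: bdmM; first exact: bdm_cst.
by apply: bdmD; [apply: bdmX; exact: bS_site_resid|exact: bS_site_var].
Qed.

Let b_quad2 : bS (fun z => `|\sum_i q i ^+ 2 * (resid z i ^+ 2 - cvar i z)|).
Proof.
apply: bdm_norm; apply: bdm_sum => i; apply: bdmM; first exact: bdm_cst.
by apply: bdmB; [apply: bdmX; exact: bS_site_resid|exact: bS_site_var].
Qed.

Lemma bS_var_err : bS var_err.
Proof.
apply: bdmB; first exact: bdm_cst.
by apply: bdmM => //; exact: bdm_cst.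
Qed.

(** Passing from psi'' at the full field to psi'' at c costs 4 |m_i|, and 4 sqrt(Q M) <= 2 (Q + M)
    for M the squared l4 norm of the field; what is left is half of [centered_sq_fluctuation]. *)
Lemma var_err_le : E (fun z => `|var_err z|) <=
  2 * (Q + S4) + 2^-1 * (6 * Q + 4 * Num.sqrt al).
Proof.
have b1 : bS (fun z => 2 * Num.sqrt (qds (mv A z))).
  by apply: bdmM => //; exact: bdm_cst.
have b2 : bS (fun z => 2 * Q + 2 * Num.sqrt (qds (mv A z))).
  by apply: bdmD => //; exact: bdm_cst.
have b3 : bS (fun z => 2^-1 * `|\sum_i q i ^+ 2 * (resid z i ^+ 2 - cvar i z)|).
  by apply: bdmM => //; exact: bdm_cst.
have le1 : E (fun z => `|var_err z|) <= E (fun z => (2 * Q + 2 * Num.sqrt (qds (mv A z))) +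
    2^-1 * `|\sum_i q i ^+ 2 * (resid z i ^+ 2 - cvar i z)|).
  apply: le_gibbs_mean.
  - by apply: bdm_norm; exact: bS_var_err.
  - exact: bdmD.
  move=> z cz.
  have -> : var_err z = \sum_i q i ^+ 2 * (free_var i - cvar i z) -
      2^-1 * \sum_i q i ^+ 2 * (resid z i ^+ 2 - cvar i z).
    rewrite /var_err /free_upsilon !mulr_sumr -!sumrB; apply: eq_bigr => i _.
    by move: (resid z i) (cvar i z) => x y; field.
  rewrite (le_trans (ler_normB _ _))// lerD//; last first.
    by rewrite normrM ger0_norm// invr_ge0.
  apply: le_trans (ler_norm_sum _ _ _) _.
  have s1 : \sum_i `|q i ^+ 2 * (free_var i - cvar i z)| <= 4 * \sum_i `|q i| * (`|q i| * `|mv A z i|).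
    rewrite mulr_sumr ler_sum// => i _; rewrite normrM normrX distrC.
    have := tilt_var_lip (mu i) clip measurable_clip abs_clip_le (fld z i) (c i).
    rewrite {2}/site_field addrK -/(cvar i z) -/(free_var i) => h.
    rewrite [leRHS](_ : _ = `|q i| ^+ 2 * (4 * `|mv A z i|)); last by ring.
    by rewrite ler_wpM2l ?sqr_ge0.
  apply: le_trans s1 _.
  have s2 := abs_dotp_le (fun i => `|q i|) (fun i => `|q i| * `|mv A z i|).
  have := le_trans (ler_norm _) s2; rewrite {1}/dotp => {}s2.
  rewrite (_ : sqs (fun i => `|q i|) = 1) ?sqrtr1 ?mul1r in s2; last first.
    by rewrite -q1; apply: eq_bigr => i _; rewrite real_normK ?num_real.
  have s3 : sqs (fun i => `|q i| * `|mv A z i|) <= Q * Num.sqrt (qds (mv A z)).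
    have := abs_dotp_le (fun i => q i ^+ 2) (fun i => mv A z i ^+ 2).
    rewrite !sqs_pow4 => /(le_trans (ler_norm _)) h.
    rewrite (_ : sqs _ = dotp (fun i => q i ^+ 2) (fun i => mv A z i ^+ 2)); last first.
      by apply: eq_bigr => i _; rewrite exprMn !real_normK ?num_real.
    apply: le_trans h _; rewrite ler_wpM2r ?sqrtr_ge0//.
    rewrite -[leRHS]ger0_norm// -sqrtr_sqr ler_wsqrtr//.
    exact: (sum_pow4_le q Q q1 qQ).
  have M0 := sqrtr_ge0 (qds (mv A z)).
  move: (Num.sqrt (qds (mv A z))) s3 M0 => M s3 M0.
  have s4 : Num.sqrt (sqs (fun i => `|q i| * `|mv A z i|)) <= (Q + M) / 2.
    rewrite -[leRHS]ger0_norm; last by rewrite divr_ge0// addr_ge0.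
    rewrite -sqrtr_sqr ler_wsqrtr//; apply: le_trans s3 _.
    by have := sqr_ge0 (Q - M); rewrite expr_div_n (_ : 2 ^+ 2 = 4); [lra|rewrite -natrX].
  by have := le_trans s2 s4; lra.
apply: le_trans le1 _.
rewrite (gibbs_meanD mu A c _ _ b2 b3) (gibbs_meanD mu A c _ _ (bS_cst _) b1) gibbs_mean_cst.
rewrite (gibbs_meanZ mu A c _ _ b_sqrt) (gibbs_meanZ mu A c _ _ b_quad2) -mulrDr lerD2l.
rewrite ler_wpM2l ?invr_ge0//.
exact: (centered_sq_fluctuation mu A c q Q al symA A0 q1 qQ rowA).
Qed.

Lemma Tstat_upd z i y : Tstat z - Tstat (upd z i y) = q i * (z i - y).
Proof. by rewrite /Tstat dotp_upd; ring. Qed.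

Let b_T : bS Tstat.
Proof. by apply: bdmB; [exact: bS_dotp|exact: bdm_cst]. Qed.

Let b_comp (f : R -> R) B : measurable_fun [set: R] f -> (forall x, `|f x| <= B) ->
  bS (fun z => f (Tstat z)).
Proof.
move=> mf fB; have [mT _] := b_T; split; last by exists B => x; exact: fB.
exact: measurableT_comp.
Qed.

Let EE_antisym0 i K : bS2 K ->
  (forall z y, cube z -> `|y| <= 1 -> K (upd z i y) (z i) = - K z y) -> EE i K = 0.
Proof.
move=> bK aK; have := pair_mean_swap mu A c symA A0 i K bK.
rewrite (eq_pair_mean mu A c i (fun z y => K (upd z i y) (z i)) (fun z y => -1 * K z y)); last first.
  by move=> z y cz y1; rewrite aK// mulN1r.
by rewrite (pair_meanZ mu A c i _ _ bK); move: (EE i K) => x; lra.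
Qed.

(** The increment q_i (z_i - y) of [Tstat] times its absolute value. *)
Let wsq i (z : 'I_n -> R) (y : R) : R := q i * `|q i| * signed_sq i z y.

Let b_wsq i : bS2 (wsq i).
Proof. exact: (bS2M _ _ (bS2_cst _) (bS2_signed_sq i)). Qed.

Let wsq_antisym i z y : wsq i (upd z i y) (z i) = - wsq i z y.
Proof. by rewrite /wsq /signed_sq upd_id -opprB normrN; ring. Qed.

Let Zs z : R := \sum_i Tt i (wsq i) z.

Let b_Zs : bS Zs.
Proof. by apply: bdm_sum => i; exact: (bS_resample mu A c i _ (b_wsq i)). Qed.

Let E_Zs_le : E (fun z => `|Zs z|) <= 6 * Q + 4 * Num.sqrt al.
Proof.
have := signed_sq_fluctuation mu A c q Q al symA A0 q1 qQ rowA.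
congr (_ <= _); apply: eq_gibbs_mean => z cz; congr (`| _ |); apply: eq_bigr => i _.
by rewrite /wsq (resampleZ mu A c i (fun=> q i * `|q i|))//; exact: bS2_signed_sq.
Qed.

Let b_diff i : bS2 (fun (z : 'I_n -> R) (y : R) => z i - y).
Proof. exact: (bS2B _ _ (bS2_1 _ (bS_coord i)) bS2_id). Qed.

(** The resampled mean of z_i - y is the residual, and z_i - y is antisymmetric, so
    [pair_mean_antisym] applies in each coordinate. *)
Let E_linear_part (f : R -> R) B : measurable_fun [set: R] f -> (forall x, `|f x| <= B) ->
  E (fun z => f (Tstat z) * dotp q (resid z)) = 2^-1 * \sum_i
    EE i (fun (z : 'I_n -> R) (y : R) => q i * (z i - y) * (f (Tstat z) - f (Tstat (upd z i y)))).
Proof.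
move=> mf fB; have bf := b_comp f B mf fB.
have bres i : bS (fun z => f (Tstat z) * Tt i (fun (z : 'I_n -> R) (y : R) => z i - y) z).
  by apply: bdmM => //; exact: bS_resample.
transitivity (\sum_i q i * E (fun z => f (Tstat z) * Tt i (fun (z : 'I_n -> R) (y : R) => z i - y) z)).
  transitivity (\sum_i E (fun z => q i * (f (Tstat z) * Tt i (fun (z : 'I_n -> R) (y : R) => z i - y) z))).
    rewrite -gibbs_mean_sum; last by move=> i; apply: bdmM; [exact: bdm_cst|exact: bres].
    apply: eq_gibbs_mean => z cz; rewrite /dotp mulr_sumr; apply: eq_bigr => i _.
    have -> : Tt i (fun (z : 'I_n -> R) (y : R) => z i - y) z = resid z i.
      rewrite /resample tiltB//; [|exact: measurable_clip|exact: abs_clip_le|exact: bdm_cst|exact: bdm_clip].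
      by rewrite tilt_cst//; [exact: measurable_clip|exact: abs_clip_le].
    by move: (f _) (resid z i) => x y; ring.
  by apply: eq_bigr => i _; rewrite gibbs_meanZ.
rewrite mulr_sumr; apply: eq_bigr => i _.
rewrite (pair_mean_antisym mu A c symA A0 i (fun z => f (Tstat z)) (fun (z : 'I_n -> R) (y : R) => z i - y) bf (b_diff i)); last first.
  by move=> z y _ _; rewrite upd_id; ring.
rewrite mulrCA; congr (_ * _).
have bb : bS2 (fun (z : 'I_n -> R) (y : R) => (z i - y) * (f (Tstat z) - f (Tstat (upd z i y)))).
  exact: (bS2M _ _ (b_diff i) (bS2B _ _ (bS2_1 _ bf) (bS2_upd i _ bf))).
by rewrite -(pair_meanZ mu A c i _ _ bb); apply: eq_pair_mean => z y _ _; rewrite mulrA.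
Qed.

(* The exchangeable-pair expansion of E[q.xi f(T)], with the remainder
   controlled through the monotonicity of the two parts of f'. *)
Let stein_pair_bound (vv P B : R) (f h : R -> R) :
  measurable_fun [set: R] f -> measurable_fun [set: R] h ->
  (forall x, `|f x| <= B) -> (forall x, `|x * f x| <= 1) -> (forall x, `|h x| <= 1) ->
  (forall x y, x < y -> (y - x) * (x * f x + h y - P) <= vv * (f y - f x) <=
     (y - x) * (y * f y + h x - P)) ->
  `|2 * (vv * E (fun z => f (Tstat z) * dotp q (resid z))) -
    E (fun z => (Tstat z * f (Tstat z) + h (Tstat z) - P) *
        \sum_i q i ^+ 2 * (resid z i ^+ 2 + cvar i z))| <=
  2 * (6 * Q + 4 * Num.sqrt al).
Proof.
move=> mf mh fB kB hB inc.
pose k x := x * f x.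
have mk : measurable_fun [set: R] k by apply: measurable_funM => //; exact: measurable_id.
have bf := b_comp f B mf fB; have bk := b_comp k 1 mk kB; have bh := b_comp h 1 mh hB.
pose F z := k (Tstat z) + h (Tstat z) - P.
pose G z := h (Tstat z) - k (Tstat z).
pose H z := h (Tstat z) + k (Tstat z).
have bF : bS F by apply: bdmB; [exact: (bdmD _ _ bk bh)|exact: bdm_cst].
have bG : bS G := bdmB _ _ bh bk.
have bH : bS H := bdmD _ _ bh bk.
pose dq i (z : 'I_n -> R) (y : R) := q i * (z i - y).
have bdq i : bS2 (dq i) by exact: (bS2M _ _ (bS2_cst _) (b_diff i)).
have bdq2 i : bS2 (fun z y => dq i z y ^+ 2) := bdmX _ _ (bdq i).
have bsq2 i : bS2 (fun (z : 'I_n -> R) (y : R) => (z i - y) ^+ 2) by apply: bdmX; exact: b_diff.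
pose L i z y := dq i z y * (f (Tstat z) - f (Tstat (upd z i y))).
have bL i : bS2 (L i) := bS2M _ _ (bdq i) (bS2B _ _ (bS2_1 _ bf) (bS2_upd i _ bf)).
pose M i z y := dq i z y ^+ 2 * F z.
have bM i : bS2 (M i) := bS2M _ _ (bdq2 i) (bS2_1 _ bF).
pose S i z y := dq i z y ^+ 2 * (H (upd z i y) - H z).
have bS' i : bS2 (S i) := bS2M _ _ (bdq2 i) (bS2B _ _ (bS2_upd i _ bH) (bS2_1 _ bH)).
pose N i z y := wsq i z y * (G z - G (upd z i y)).
have bN i : bS2 (N i) := bS2M _ _ (b_wsq i) (bS2B _ _ (bS2_1 _ bG) (bS2_upd i _ bG)).
have pt i z y : vv * L i z y <= M i z y + 2^-1 * S i z y - 2^-1 * N i z y /\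
    M i z y + 2^-1 * S i z y + 2^-1 * N i z y <= vv * L i z y.
  have := stein_increment_le vv f h P inc (Tstat z) (Tstat (upd z i y)).
  rewrite Tstat_upd /L /M /S /N /F /G /H /k /wsq /signed_sq /dq.
  have -> : q i * `|q i| * ((z i - y) * `|z i - y|) = q i * (z i - y) * `|q i * (z i - y)|.
    by rewrite normrM; ring.
  move: (Tstat z) (Tstat (upd z i y)) (q i * (z i - y)) => x1 x2 D.
  move: (f x1) (f x2) (h x1) (h x2) => f1 f2 h1 h2.
  by move=> /= [u1 u2]; split; [move: u1|move: u2]; congr (_ <= _); ring.
have bMS i : bS2 (fun z y => M i z y + 2^-1 * S i z y).
  exact: (bS2D _ _ (bM i) (bS2M _ _ (bS2_cst _) (bS' i))).
have bN2 i : bS2 (fun z y => 2^-1 * N i z y) := bS2M _ _ (bS2_cst _) (bN i).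
have bvL i : bS2 (fun z y => vv * L i z y) := bS2M _ _ (bS2_cst _) (bL i).
(* A square, invariant under the exchange, times a difference that changes sign. *)
have EES i : EE i (S i) = 0.
  apply: EE_antisym0 => // z y _ _; rewrite /S /dq upd_id upd_upd.
  by move: (H z) (H _) => a b; ring.
have EEM i : EE i (M i) = E (fun z => F z * (q i ^+ 2 * (resid z i ^+ 2 + cvar i z))).
  transitivity (EE i (fun z y => (F z * q i ^+ 2) * (z i - y) ^+ 2)).
    by apply: eq_pair_mean => z y _ _; rewrite /M /dq; move: (F z) => x; ring.
  rewrite (pair_meanMl mu A c i (fun z => F z * q i ^+ 2) _ (bsq2 i)).
  by apply: eq_gibbs_mean => z cz; rewrite resample_sqr_diff// -mulrA.
have EEN i : EE i (N i) = 2 * E (fun z => G z * Tt i (wsq i) z).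
  rewrite (pair_mean_antisym mu A c symA A0 i G (wsq i) bG (b_wsq i)).
    by rewrite mulrA divff ?mul1r// pnatr_eq0.
  by move=> z y _ _; exact: wsq_antisym.
have EEMS i : EE i (fun z y => M i z y + 2^-1 * S i z y) = EE i (M i).
  rewrite (pair_meanD mu A c i _ _ (bM i) (bS2M _ _ (bS2_cst _) (bS' i))).
  by rewrite (pair_meanZ mu A c i _ _ (bS' i)) EES mulr0 addr0.
have EEN2 i : EE i (fun z y => 2^-1 * N i z y) = E (fun z => G z * Tt i (wsq i) z).
  by rewrite (pair_meanZ mu A c i _ _ (bN i)) EEN mulrA mulVf ?mul1r// pnatr_eq0.
have up i : vv * EE i (L i) <= EE i (M i) - E (fun z => G z * Tt i (wsq i) z).
  rewrite -(pair_meanZ mu A c i _ _ (bL i)) -EEMS -EEN2 -(pair_meanB mu A c i _ _ (bMS i) (bN2 i)).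
  apply: le_pair_mean; [exact: bvL|exact: (bS2B _ _ (bMS i) (bN2 i))|].
  by move=> z y _ _; have [] := pt i z y.
have lo i : EE i (M i) + E (fun z => G z * Tt i (wsq i) z) <= vv * EE i (L i).
  rewrite -(pair_meanZ mu A c i _ _ (bL i)) -EEMS -EEN2 -(pair_meanD mu A c i _ _ (bMS i) (bN2 i)).
  apply: le_pair_mean; [exact: (bS2D _ _ (bMS i) (bN2 i))|exact: bvL|].
  by move=> z y _ _; have [] := pt i z y.
have sumM : \sum_i EE i (M i) = E (fun z => F z * \sum_i q i ^+ 2 * (resid z i ^+ 2 + cvar i z)).
  have bb i : bS (fun z => F z * (q i ^+ 2 * (resid z i ^+ 2 + cvar i z))).
    apply: bdmM => //; apply: bdmM; first exact: bdm_cst.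
    by apply: bdmD; [apply: bdmX; exact: bS_site_resid|exact: bS_site_var].
  under eq_bigr do rewrite EEM.
  by rewrite -gibbs_mean_sum//; apply: eq_gibbs_mean => z _; rewrite mulr_sumr.
have bGT i : bS (fun z => G z * Tt i (wsq i) z).
  by apply: bdmM => //; exact: (bS_resample mu A c i _ (b_wsq i)).
have sumG : \sum_i E (fun z => G z * Tt i (wsq i) z) = E (fun z => G z * Zs z).
  by rewrite -gibbs_mean_sum//; apply: eq_gibbs_mean => z _; rewrite mulr_sumr.
have sumL : 2 * (vv * E (fun z => f (Tstat z) * dotp q (resid z))) = \sum_i vv * EE i (L i).
  by rewrite (E_linear_part f B mf fB) -mulr_sumr; field.
have GZ : `|E (fun z => G z * Zs z)| <= 2 * (6 * Q + 4 * Num.sqrt al).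
  have bGZ : bS (fun z => G z * Zs z) := bdmM _ _ bG b_Zs.
  have bZ : bS (fun z => `|Zs z|) := bdm_norm _ b_Zs.
  apply: le_trans (abs_gibbs_mean_le mu A c _ bGZ) _.
  apply: le_trans (_ : 2 * E (fun z => `|Zs z|) <= _); last by rewrite ler_wpM2l.
  rewrite -(gibbs_meanZ mu A c _ _ bZ); apply: le_gibbs_mean.
  - exact: (bdm_norm _ bGZ).
  - exact: (bdmM _ _ (bdm_cst _) bZ).
  move=> z _; rewrite normrM ler_wpM2r// /G (le_trans (ler_normB _ _))//.
  by rewrite (_ : 2 = 1 + 1)// lerD//; exact: kB.
have U : \sum_i vv * EE i (L i) <=
    \sum_i EE i (M i) - \sum_i E (fun z => G z * Tt i (wsq i) z).
  by rewrite -sumrB; apply: ler_sum => i _; exact: up.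
have L' : \sum_i EE i (M i) + \sum_i E (fun z => G z * Tt i (wsq i) z) <=
    \sum_i vv * EE i (L i).
  by rewrite -big_split; apply: ler_sum => i _; exact: lo.
rewrite sumM sumG -sumL in U L'.
move: U L' GZ; set x1 := 2 * _; set x2 := E (fun z => F z * _); set x3 := E (fun z => G z * _).
move=> U L' GZ.
suff : `|x1 - x2| <= 2 * (6 * Q + 4 * Num.sqrt al) by [].
apply: le_trans GZ; have n1 := ler_norm x3; have := ler_norm (- x3); rewrite normrN => n2.
by rewrite ler_norml; apply/andP; split; lra.
Qed.

(** The error is bounded after multiplication by upsilon >= kappa. The limiting variance satisfies
    vv (1 - lam upsilon) = upsilon, which matches the coefficient of [Tstat] in [stat_err]. *)
Lemma normal_approximation (kappa : R) : 0 < kappa -> kappa <= free_upsilon -> forall t,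
  `|E (fun z => (Tstat z <= t)%R%:R) -
    fine (normal_prob 0 (Num.sqrt (free_upsilon / (1 - lam * free_upsilon))) `]-oo, t]%classic)| <=
  (2 * E (fun z => `|var_err z|) + (6 * Q + 4 * Num.sqrt al) +
   2 / del * E (fun z => `|stat_err z|)) / kappa.
Proof.
move=> k0 kv t.
pose D := 1 - lam * free_upsilon; have D0 : 0 < D by exact: lt_le_trans one_minus_lamv.
have v00 : 0 < free_upsilon by exact: lt_le_trans kv.
pose vv := free_upsilon / D; have vv0 : 0 < vv by rewrite divr_gt0.
have [f [mf fB kB inc]] := stein_solution vv vv0 t.
set P := fine _ in inc; rewrite -/D -/vv -/P.
pose h (x : R) : R := (x <= t)%R%:R.
have hB x : `|h x| <= 1 by rewrite /h; case: (x <= t)%R; rewrite ?normr1 ?normr0.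
have mh : measurable_fun [set: R] h.
  rewrite (_ : h = fun x => if x <= t then 1 else 0); last first.
    by apply/funext => x; rewrite /h; case: ifP.
  apply: measurable_fun_ifT; [|exact: measurable_cst|exact: measurable_cst].
  by apply: measurable_fun_ler; [exact: measurable_id|exact: measurable_cst].
have main := stein_pair_bound vv P _ f h mf mh fB kB hB inc.
pose k x := x * f x.
have mk : measurable_fun [set: R] k by apply: measurable_funM => //; exact: measurable_id.
have bf := b_comp f _ mf fB; have bk := b_comp k 1 mk kB; have bh := b_comp h 1 mh hB.
have P01 : 0 <= P <= 1.
  apply/andP; split; first by rewrite fine_ge0.
  by rewrite -lee_fin /P fineK ?fin_num_measure// probability_le1.
pose F z := Tstat z * f (Tstat z) + h (Tstat z) - P.
have bF : bS F by apply: bdmB; [exact: (bdmD _ _ bk bh)|exact: bdm_cst].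
have FB z : `|F z| <= 2.
  rewrite /F -addrA (le_trans (ler_normD _ _))// (_ : 2 = 1 + 1)// lerD//.
  have /andP[? ?] := P01; rewrite ler_norml /h.
  by case: (Tstat z <= t)%R; rewrite /= ?mulr1n ?mulr0n; apply/andP; split; lra.
pose W z := \sum_i q i ^+ 2 * (resid z i ^+ 2 + cvar i z).
have bxf : bS (fun z => f (Tstat z) * dotp q (resid z)).
  by apply: bdmM => //; exact: (bS_lstat mu A c q).
have bsf : bS (fun z => f (Tstat z) * stat_err z).
  by apply: bdmM => //; exact: bS_stat_err.
have bFv : bS (fun z => F z * var_err z) by apply: bdmM => //; exact: bS_var_err.
have bFW : bS (fun z => F z * W z) := bdmM _ _ bF b_quad.
have e1 : E F = E (fun z => k (Tstat z)) + E (fun z => h (Tstat z)) - P.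
  rewrite /F (gibbs_meanB mu A c (fun z => k (Tstat z) + h (Tstat z)) (fun=> P)).
  - by rewrite gibbs_mean_cst (gibbs_meanD mu A c _ _ bk bh).
  - exact: (bdmD _ _ bk bh).
  - exact: bdm_cst.
have e2 : D * E (fun z => k (Tstat z)) = E (fun z => f (Tstat z) * stat_err z) +
    E (fun z => f (Tstat z) * dotp q (resid z)).
  rewrite -(gibbs_meanZ mu A c _ _ bk) -(gibbs_meanD mu A c _ _ bsf bxf).
  apply: eq_gibbs_mean => z _; rewrite /k /stat_err -/D.
  by move: (Tstat z) (f _) (dotp _ _) => a b d; ring.
have e3 : E (fun z => F z * var_err z) = free_upsilon * E F - 2^-1 * E (fun z => F z * W z).
  have bvF : bS (fun z => free_upsilon * F z) by apply: bdmM => //; exact: bdm_cst.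
  have bFW2 : bS (fun z => 2^-1 * (F z * W z)) by apply: bdmM => //; exact: bdm_cst.
  rewrite -(gibbs_meanZ mu A c _ _ bF) -(gibbs_meanZ mu A c _ _ bFW) -(gibbs_meanB mu A c _ _ bvF bFW2).
  apply: eq_gibbs_mean => z _; rewrite /var_err -/(W z).
  by move: (F z) (W z) => a b; ring.
have i1 : `|E (fun z => F z * var_err z)| <= 2 * E (fun z => `|var_err z|).
  have bV : bS (fun z => `|var_err z|) by apply: bdm_norm; exact: bS_var_err.
  apply: le_trans (abs_gibbs_mean_le mu A c _ bFv) _.
  rewrite -(gibbs_meanZ mu A c _ _ bV); apply: le_gibbs_mean.
  - exact: (bdm_norm _ bFv).
  - exact: (bdmM _ _ (bdm_cst _) bV).
  by move=> z _; rewrite normrM ler_wpM2r.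
pose B := Num.sqrt (2 / vv).
have i2 : `|E (fun z => f (Tstat z) * stat_err z)| <= B * E (fun z => `|stat_err z|).
  have bV : bS (fun z => `|stat_err z|) by apply: bdm_norm; exact: bS_stat_err.
  apply: le_trans (abs_gibbs_mean_le mu A c _ bsf) _.
  rewrite -(gibbs_meanZ mu A c _ _ bV); apply: le_gibbs_mean.
  - exact: (bdm_norm _ bsf).
  - exact: (bdmM _ _ (bdm_cst _) bV).
  by move=> z _; rewrite normrM ler_wpM2r.
have Ese0 : 0 <= E (fun z => `|stat_err z|).
  by apply: gibbs_mean_ge0 => //; apply: bdm_norm; exact: bS_stat_err.
(* The left side is sqrt(2 vv), and vv <= 1 / (1 - rho). *)
have vB : vv * B <= 2 / del.
  have del1 : del <= 1 by rewrite /del gerBl ltW//; have /andP[] := rho01.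
  have id1 : 1 <= del^-1 by rewrite invf_ge1.
  have vvle : vv <= del^-1.
    have /andP[_ v1] := v01.
    rewrite /vv -[leRHS]mul1r ler_pM ?invr_ge0 ?(ltW v00) ?(ltW D0)//.
    by rewrite lef_pV2 ?posrE// one_minus_lamv.
  have vB0 : 0 <= vv * B by rewrite mulr_ge0 ?sqrtr_ge0// ltW.
  rewrite -(@ler_pXn2r _ 2) ?nnegrE//; last by rewrite mulr_ge0// invr_ge0 ltW.
  rewrite exprMn /B sqr_sqrtr; last by rewrite divr_ge0// ltW.
  rewrite (_ : vv ^+ 2 * (2 / vv) = 2 * vv); last by field; rewrite gt_eqF.
  move: (del^-1) id1 vvle => i id1 vvle.
  by apply: le_trans (_ : 2 * i <= _); [lra|nra].
rewrite ler_pdivlMr//; apply: le_trans (_ : `|E (fun z => h (Tstat z)) - P| * free_upsilon <= _).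
  by rewrite ler_wpM2l.
(* Three errors remain: upsilon against half the squared increments, the remainder of the exchange
   argument, and the linearization defect. *)
have e4 : (E (fun z => h (Tstat z)) - P) * free_upsilon =
    E (fun z => F z * var_err z) +
    - 2^-1 * (2 * (vv * E (fun z => f (Tstat z) * dotp q (resid z))) - E (fun z => F z * W z)) -
    vv * E (fun z => f (Tstat z) * stat_err z).
  have vD : free_upsilon = vv * D by rewrite /vv divfK// gt_eqF.
  have e2' : vv * D * E (fun z => k (Tstat z)) =
    vv * E (fun z => f (Tstat z) * stat_err z) + vv * E (fun z => f (Tstat z) * dotp q (resid z)).
    by rewrite -mulrA e2 mulrDr.
  rewrite e3 e1 mulrBl mulrBr mulrDr {2 3 4}vD e2' -vD.
  by move: (E _) (E _) (E _) (E _) => a b d e; field.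
rewrite -[leLHS](_ : `|(E (fun z => h (Tstat z)) - P) * free_upsilon| = _); last first.
  by rewrite normrM (ger0_norm (ltW v00)).
rewrite e4; apply: le_trans (ler_normB _ _) _; rewrite lerD//; last first.
  rewrite normrM (gtr0_norm vv0).
  apply: le_trans (_ : vv * (B * E (fun z => `|stat_err z|)) <= _).
    by rewrite ler_pM2l.
  by rewrite mulrA ler_wpM2r.
apply: le_trans (ler_normD _ _) _; rewrite lerD//.
have half (x : R) : `|- 2^-1 * x| = `|x| / 2.
  have i0 : (0 : R) <= 2^-1 by rewrite invr_ge0.
  by rewrite normrM normrN (ger0_norm i0) mulrC.
by rewrite half ler_pdivrMr// [leRHS]mulrC.
Qed.

End normal_approximation.

(** * Proof of the theorem *)

Section model_quantities.
Context {R : realType} {n : nat}.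
Variables (mu : 'I_n -> probability R R) (A : 'M[R]_n) (c q : 'cV[R]_n) (lam : R).
Hypothesis hmu : forall i, base_measure (mu i).
Hypothesis symA : forall i j, A i j = A j i.

Notation cf := (fun i => c i 0).
Notation qf := (fun i => q i 0).

Lemma dpsiE i t : dpsi mu i t = tilt (mu i) clip t clip.
Proof. by rewrite /dpsi derive1_psi. Qed.

Lemma ddpsiE i t : ddpsi mu i t = tilt_var (mu i) clip t.
Proof. by rewrite /ddpsi derive2_psi. Qed.

Lemma dPsiE i : dPsi mu c i 0 = free_mean mu cf i.
Proof. by rewrite mxE dpsiE. Qed.

Lemma upsilonE : upsilon mu c q = free_upsilon mu cf qf.
Proof. by apply: eq_bigr => i _; rewrite ddpsiE. Qed.

Lemma nuE i : nu mu A c i = mv A (free_mean mu cf) i.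
Proof. by apply: eq_bigr => j _; rewrite dpsiE. Qed.

Lemma R1E : R1 mu A c q = sqs (var_defect mu A cf qf).
Proof.
apply: eq_bigr => i _; congr (_ ^+ 2); apply: eq_bigr => j _.
by rewrite ddpsiE upsilonE.
Qed.

Lemma R2E : R2 mu A c = sqs (mv A (free_mean mu cf)).
Proof. by apply: eq_bigr => i _; rewrite nuE. Qed.

Lemma R3E : R3 mu A c = qds (mv A (free_mean mu cf)).
Proof. by apply: eq_bigr => i _; rewrite nuE. Qed.

Lemma R4E : R4 mu A c q = `|dotp (var_defect mu A cf qf) (free_mean mu cf)|.
Proof.
congr (`| _ |); rewrite exchange_big/=; apply: eq_bigr => j _.
rewrite mulr_suml; apply: eq_bigr => i _.
by rewrite ddpsiE dpsiE upsilonE symA.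
Qed.

Lemma epsE i : (A *m q - lam *: q) i 0 = eigen_defect A qf lam i.
Proof. by rewrite /eigen_defect mxE mvE !mxE. Qed.

Lemma eps_dPsiE :
  ((A *m q - lam *: q)^T *m dPsi mu c) 0 0 = dotp (eigen_defect A qf lam) (free_mean mu cf).
Proof. by rewrite mxE; apply: eq_bigr => i _; rewrite dPsiE mxE epsE. Qed.

Lemma lpnorm_epsE : lpnorm 2 (A *m q - lam *: q) = Num.sqrt (sqs (eigen_defect A qf lam)).
Proof.
rewrite lpnorm2E; congr (Num.sqrt _); apply: eq_bigr => i _.
by rewrite epsE.
Qed.

Lemma linfnorm_ge i : `|q i 0| <= linfnorm q.
Proof. by rewrite /linfnorm; apply: le_bigmax. Qed.

Lemma alpha_ge i : \sum_j A i j ^+ 2 <= alpha A.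
Proof. by rewrite /alpha; apply: (le_bigmax _ (fun i => \sum_j A i j ^+ 2)). Qed.

Lemma alpha_ge0 : 0 <= alpha A.
Proof. by rewrite /alpha bigmax_idl le_max lexx. Qed.

Lemma linfnorm_ge0 : 0 <= linfnorm q.
Proof. by rewrite /linfnorm bigmax_idl le_max lexx. Qed.

(** Since 1 = |q|^2 <= n |q|_inf^2, either sqrt(n alpha) >= 1 and sqrt(alpha) <= sqrt(n) alpha, or
    sqrt(alpha) < 1 / sqrt(n) <= |q|_inf. The variance bounds leave a bare sqrt(alpha), which this
    turns into terms of the conclusion. *)
Lemma sqrt_alpha_le : sqs qf = 1 ->
  Num.sqrt (alpha A) <= Num.sqrt n%:R * alpha A + linfnorm q.
Proof.
move=> q1; have Q0 := linfnorm_ge0; have a0 := alpha_ge0.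
have nQ : 1 <= n%:R * linfnorm q ^+ 2.
  rewrite -[leLHS]q1 /sqs; apply: le_trans (_ : \sum_(i < n) linfnorm q ^+ 2 <= _).
    apply: ler_sum => i _; rewrite -real_normK ?num_real//.
    by rewrite lerXn2r ?nnegrE// linfnorm_ge.
  by rewrite sumr_const card_ord mulr_natl.
have rQ : 1 <= Num.sqrt n%:R * linfnorm q.
  rewrite -(@ler_pXn2r _ 2) ?nnegrE ?mulr_ge0 ?sqrtr_ge0//.
  by rewrite exprMn sqr_sqrtr// expr1n.
have r0 := sqrtr_ge0 (n%:R : R); have s0 := sqrtr_ge0 (alpha A).
have aE : alpha A = Num.sqrt (alpha A) ^+ 2 by rewrite sqr_sqrtr.
rewrite [X in _ * X]aE; move: (Num.sqrt n%:R) (Num.sqrt (alpha A)) rQ r0 s0 => r s rQ r0 s0.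
have [rs|rs] := leP 1 (r * s); first by nra.
have sQ : s <= linfnorm q.
  have r00 : 0 < r by nra.
  by rewrite -(ler_pM2l r00); lra.
have h2 : 0 <= r * s ^+ 2 by rewrite mulr_ge0 ?sqr_ge0.
by lra.
Qed.

End model_quantities.

(** * Identification of the law of the model with [gibbs_mean] *)

Section gibbs_law.
Context {R : realType} {n : nat}.
Variables (mu : 'I_n -> probability R R) (A : 'M[R]_n) (c : 'cV[R]_n).
Hypothesis hmu : forall i, base_measure (mu i).

Notation cf := (fun i => c i 0).
Notation P0 := (product_prob mu).

Let cubeT : set (n.-tuple R) := [set x | forall i, `[-1, 1]%classic (tnth x i)].

Let m_cubeT : measurable cubeT.
Proof.
rewrite (_ : cubeT = \bigcap_(i in [set: 'I_n])
    ((fun x : n.-tuple R => tnth x i) @^-1` `[-1, 1]%classic)).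
  apply: fin_bigcap_measurable => // i _.
  by rewrite -[X in measurable X]setTI; exact: measurable_tnth.
by apply/seteqP; split => x /= h i; [move=> _|]; exact: h.
Qed.

Let P0_cube : P0 (~` cubeT) = 0%E.
Proof.
rewrite probability_setC// (_ : P0 cubeT = 1%E) ?subee//.
have -> := @product_probE R n mu (fun=> `[-1, 1]%classic) (fun=> measurable_itv _).
by apply: big1 => i _; exact: (base_supported (hmu i)).
Qed.

Let on_cube x : (~` (~` cubeT)) x -> clip_state x = tnth x.
Proof.
rewrite setCK => h; apply/funext => i; rewrite /clip_state clip_id//.
by have := h i; rewrite /= in_itv.
Qed.

Let ham_vec x : hamiltonian A c (vec x) = ham A cf (tnth x).
Proof.
rewrite hamiltonianE; congr ham; apply/funext => i; by rewrite mxE.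
Qed.

Let m_ham : measurable_fun [set: n.-tuple R] (fun x => ham A cf (tnth x)).
Proof.
have mc i : measurable_fun [set: n.-tuple R] (fun x => tnth x i).
  exact: measurable_tnth.
have md (a : 'I_n -> R) : measurable_fun [set: n.-tuple R] (fun x => dotp a (tnth x)).
  apply: measurable_sum => i; apply: measurable_funM; [exact: measurable_cst|exact: mc].
apply: measurable_funD; last exact: md.
apply: measurable_funM; first exact: measurable_cst.
apply: measurable_sum => i; apply: measurable_funM; [exact: mc|exact: md].
Qed.

(** Off the cube the two integrands may differ, but the product measure gives that set mass 0. *)
Let ge0_integral_cube (f g : n.-tuple R -> \bar R) :
  measurable_fun [set: n.-tuple R] f -> measurable_fun [set: n.-tuple R] g ->
  (forall x, 0 <= f x)%E -> (forall x, 0 <= g x)%E ->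
  (forall x, clip_state x = tnth x -> f x = g x) ->
  (\int[P0]_x f x = \int[P0]_x g x)%E.
Proof.
move=> mf mg f0 g0 fg; apply: ge0_ae_eq_integral => //.
exists (~` cubeT); split => //; first exact: measurableC.
move=> x /= h Nx; apply: h => _; apply: fg; apply: on_cube.
by move=> /(_ Nx).
Qed.

Lemma partition_functionE : partition_function mu A c = gibbs_norm mu A cf.
Proof.
rewrite /partition_function /gibbs_norm /Rintegral; congr fine.
apply: ge0_integral_cube.
- apply/measurable_EFinP; under eq_fun do rewrite ham_vec.
  exact: measurableT_comp.
- by apply/measurable_EFinP; have [] := bS_gibbs_weight A cf.
- by move=> x; rewrite lee_fin expR_ge0.
- by move=> x; rewrite lee_fin expR_ge0.
- by move=> x xE; rewrite /gibbs_weight xE ham_vec.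
Qed.

Lemma quadratic_modelE (T : ('I_n -> R) -> R) (t : R) :
  measurable_fun [set: n.-tuple R] (fun x => T (tnth x)) -> bS T ->
  fine (quadratic_model mu A c [set x | T (tnth x) <= t]) =
  gibbs_mean mu A cf (fun z => (T z <= t)%R%:R).
Proof.
move=> mT [mTc _]; rewrite /quadratic_model partition_functionE.
have mB (f : n.-tuple R -> R) : measurable_fun [set: n.-tuple R] f ->
    measurable_fun [set: n.-tuple R] (fun x => (f x <= t)%R%:R : R).
  move=> mf; rewrite (_ : (fun x => _) = fun x => if f x <= t then 1 else 0); last first.
    by apply/funext => x; case: ifP.
  apply: measurable_fun_ifT; [|exact: measurable_cst|exact: measurable_cst].
  by apply: measurable_fun_ler => //; exact: measurable_cst.
have Z0 := gibbs_norm_gt0 mu A cf.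
rewrite integral_mkcond (_ : (\int[P0]_x _)%E =
  (\int[P0]_x ((gibbs_norm mu A cf)^-1 * ((T (clip_state x) <= t)%R%:R * gibbs_weight A cf (clip_state x)))%:E)%E); last first.
  apply: ge0_integral_cube.
  - rewrite (_ : _ \_ _ = fun x => ((T (tnth x) <= t)%R%:R *
        ((gibbs_norm mu A cf)^-1 * expR (ham A cf (tnth x))))%:E); last first.
      apply/funext => x; rewrite patchE ham_vec; case: ifPn => [/set_mem/= ->|].
        by rewrite mul1r.
      rewrite notin_setE/= => /negP/negbTE ->.
      by rewrite mul0r.
    apply/measurable_EFinP; apply: measurable_funM; first exact: mB.
    apply: measurable_funM; first exact: measurable_cst.
    exact: measurableT_comp.
  - apply/measurable_EFinP; apply: measurable_funM; first exact: measurable_cst.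
    apply: measurable_funM; first exact: mB.
    by have [] := bS_gibbs_weight A cf.
  - move=> x; apply: erestrict_ge0 => y _.
    by rewrite lee_fin mulr_ge0 ?expR_ge0// invr_ge0 ltW.
  - by move=> x; rewrite lee_fin !mulr_ge0 ?expR_ge0// invr_ge0 ltW.
  - move=> x xE; rewrite /gibbs_weight xE patchE ham_vec; case: ifPn => [/set_mem/= ->|].
      by rewrite mul1r.
    rewrite notin_setE/= => /negP/negbTE ->.
    by rewrite mul0r mulr0.
rewrite /gibbs_mean mulrC -IbdmZl//.
apply: bdmM; last exact: (bS_gibbs_weight A cf).
by split; [exact: mB|exists 1 => x; case: (T (clip_state x) <= t)%R; rewrite ?normr1 ?normr0].
Qed.

End gibbs_law.

(** Here i is (1 - rho)^-1, k is kappa, x is sqrt(R3), y is sqrt(n) alpha, a is the sum of the two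
    inner products with psi'(c), N is sqrt(R2), e is |eps|, r is sqrt(R1) and sa is sqrt(alpha). The
    dominant coefficient is 36 x 170 = 6120, for y, from (4 + 32 i^2) S4; 7000 leaves room for the
    rest. *)
Lemma ks_constant_le {R : realType} (k i EV ES S4 Q sa y x a N e r : R) :
  0 < k -> 1 <= i -> 0 <= Q -> 0 <= y -> 0 <= x -> 0 <= a -> 0 <= N -> 0 <= e -> 0 <= r ->
  0 <= S4 -> EV <= 2 * (Q + S4) + 2^-1 * (6 * Q + 4 * sa) ->
  ES <= 16 * i * S4 + (a + (e + r) * N * i) + 8 * (e + r) * i ->
  S4 <= (3 * x + 170 * y) * i ^+ 2 -> sa <= y + Q ->
  (2 * EV + (6 * Q + 4 * sa) + 2 * i * ES) / k <=
  7000 * i ^+ 4 * (1 + k^-1) * (N * (r + e) + r + x + y + Q + a + e).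
Proof.
move=> k0 i1 Q0 y0 x0 a0 N0 e0 r0 S0 hEV hES hS hs.
have i0 : 0 <= i by lra.
have j1 : 1 <= i ^+ 2 by rewrite exprn_ege1.
have j2 : i <= i ^+ 2 by rewrite expr2 ler_peMl.
have j4 : i ^+ 2 <= i ^+ 4 by rewrite (exprD i 2 2) ler_peMl// sqr_ge0.
have k1 : 0 < k^-1 by rewrite invr_gt0.
have ub : 2 * EV + (6 * Q + 4 * sa) + 2 * i * ES <=
    7000 * i ^+ 4 * (N * (r + e) + r + x + y + Q + a + e).
  have s1 : 2 * i * ES <= 2 * i * (16 * i * S4 + (a + (e + r) * N * i) + 8 * (e + r) * i).
    by rewrite ler_wpM2l// mulr_ge0.
  have s2 : (4 + 32 * i ^+ 2) * S4 <= 36 * i ^+ 2 * ((3 * x + 170 * y) * i ^+ 2).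
    by rewrite ler_pM//; lra.
  have -> : i ^+ 4 = i ^+ 2 * i ^+ 2 by rewrite -exprD.
  have jj : i ^+ 2 <= i ^+ 2 * i ^+ 2 by rewrite ler_peMl// sqr_ge0.
  have eN : 0 <= (e + r) * N by rewrite mulr_ge0// addr_ge0.
  move: j1 j2 jj s1 s2; rewrite (_ : 36 * i ^+ 2 * ((3 * x + 170 * y) * i ^+ 2) =
    (i ^+ 2 * i ^+ 2) * (108 * x + 6120 * y)); last by ring.
  rewrite (_ : 2 * i * (16 * i * S4 + (a + (e + r) * N * i) + 8 * (e + r) * i) =
    32 * i ^+ 2 * S4 + 2 * (i * a) + 2 * (i ^+ 2 * ((e + r) * N)) + 16 * (i ^+ 2 * (e + r))); last by ring.
  move: (i ^+ 2 * i ^+ 2) => J; move: (i ^+ 2) {j4} => j j1 j2 jj s1 s2.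
  have J1 : 1 <= J := le_trans j1 jj.
  have J0 : 0 <= J := le_trans ler01 J1.
  have p1 : i * a <= J * a by rewrite ler_wpM2r// (le_trans j2).
  have p2 : j * ((e + r) * N) <= J * ((e + r) * N) by rewrite ler_wpM2r.
  have p3 : j * (e + r) <= J * (e + r) by rewrite ler_wpM2r// addr_ge0.
  have p4 : Q <= J * Q by rewrite ler_peMl.
  have p5 : y <= J * y by rewrite ler_peMl.
  have z1 : 0 <= J * x := mulr_ge0 J0 x0.
  have z2 : 0 <= J * a := mulr_ge0 J0 a0.
  have z3 : 0 <= J * ((e + r) * N) := mulr_ge0 J0 eN.
  have z4 : 0 <= J * e := mulr_ge0 J0 e0.
  have z5 : 0 <= J * r := mulr_ge0 J0 r0.
  have -> : 7000 * J * (N * (r + e) + r + x + y + Q + a + e) =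
    7000 * (J * ((e + r) * N)) + 7000 * (J * r) + 7000 * (J * x) + 7000 * (J * y) +
    7000 * (J * Q) + 7000 * (J * a) + 7000 * (J * e) by ring.
  move: p3; rewrite mulrDr => p3.
  by lra.
have W0 : 0 <= 7000 * i ^+ 4 * (N * (r + e) + r + x + y + Q + a + e).
  apply: mulr_ge0; first exact: mulr_ge0 (ler0n R _) (exprn_ge0 4 i0).
  by rewrite !addr_ge0// mulr_ge0// addr_ge0.
apply: le_trans (_ : 7000 * i ^+ 4 * (N * (r + e) + r + x + y + Q + a + e) / k <= _).
  by rewrite ler_pM2r.
move: W0; move: (N * (r + e) + r + x + y + Q + a + e) (7000 * i ^+ 4) => w c W0.
by rewrite (_ : c * (1 + k^-1) * w = c * w + c * w / k) ?lerDr//; ring.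
Qed.

(** Counterpart for part (a), where no probabilistic error occurs: M is the squared l4 norm of the
    field of the optimizer, and 16 is the constant of [centering_error_le]. *)
Lemma mean_constant_le {R : realType} (K k i M x a1 a2 N e r : R) :
  16 <= K -> 0 < k -> 1 <= i -> 0 <= x -> 0 <= a1 -> 0 <= a2 -> 0 <= N -> 0 <= e -> 0 <= r ->
  M <= x * i ^+ 2 ->
  (16 * i * M + (a1 + a2 + (e + r) * N * i)) * i <=
  K * i ^+ 4 * (1 + k^-1) * (r * N + x + a2 + N * e + a1).
Proof.
move=> hK k0 i1 x0 a10 a20 N0 e0 r0 hM.
have i0 : 0 <= i by exact: le_trans ler01 i1.
have j1 : 1 <= i ^+ 2 by rewrite exprn_ege1.
have j2 : i <= i ^+ 2 by rewrite expr2 ler_peMl.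
have jj : i ^+ 2 <= i ^+ 2 * i ^+ 2 by rewrite ler_peMl// sqr_ge0.
set w := r * N + x + a2 + N * e + a1.
have w0 : 0 <= w by rewrite /w !addr_ge0// mulr_ge0.
have ub : (16 * i * M + (a1 + a2 + (e + r) * N * i)) * i <= 16 * i ^+ 4 * w.
  have s1 : i ^+ 2 * M <= i ^+ 2 * (x * i ^+ 2) by rewrite ler_wpM2l// sqr_ge0.
  have -> : i ^+ 4 = i ^+ 2 * i ^+ 2 by rewrite -exprD.
  have -> : (16 * i * M + (a1 + a2 + (e + r) * N * i)) * i =
    16 * (i ^+ 2 * M) + i * (a1 + a2) + i ^+ 2 * ((e + r) * N) by ring.
  move: s1; rewrite (_ : i ^+ 2 * (x * i ^+ 2) = (i ^+ 2 * i ^+ 2) * x); last by ring.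
  move: jj; move: (i ^+ 2 * i ^+ 2) => J jj s1.
  have iJ : i <= J := le_trans j2 jj.
  have J0 : 0 <= J := le_trans i0 iJ.
  have eN : 0 <= (e + r) * N by rewrite mulr_ge0// addr_ge0.
  have p1 : i * (a1 + a2) <= J * (a1 + a2) by rewrite ler_wpM2r// addr_ge0.
  have p2 : i ^+ 2 * ((e + r) * N) <= J * ((e + r) * N) by rewrite ler_wpM2r.
  have z1 : 0 <= J * (a1 + a2) by rewrite mulr_ge0// addr_ge0.
  have z2 : 0 <= J * ((e + r) * N) by rewrite mulr_ge0.
  have -> : 16 * J * w = 16 * (J * x) + 16 * (J * (a1 + a2)) + 16 * (J * ((e + r) * N)).
    by rewrite /w; ring.
  by lra.
apply: le_trans ub _; rewrite ler_wpM2r//.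
have J0 : 0 <= i ^+ 4 by rewrite exprn_ge0.
apply: (@le_trans _ _ (K * i ^+ 4)); first by rewrite ler_wpM2r.
rewrite ler_peMr ?lerDl ?invr_ge0 ?(ltW k0)// mulr_ge0//.
exact: le_trans (ler0n R 16) hK.
Qed.

Theorem theorem2p5 (R : realType) (rho kappa : R)
  (hrho : 0 < rho < 1) (hkappa : 0 < kappa) :
  exists C : R, forall (n : nat) (mu : 'I_n -> probability R R)
    (A : 'M[R]_n) (c q u : 'cV[R]_n) (lambda : R),
  (forall i, base_measure (mu i)) ->
  A^T = A -> (forall i, A i i = 0) ->
  opnorm 4 A <= rho ->
  lpnorm 2 q = 1 ->
  mean_field_optimizer mu A c u ->
  kappa <= upsilon mu c q ->
  `|lambda| <= rho ->
  let eps := A *m q - lambda *: q in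
  let v := upsilon mu c q in
  `| (q^T *m (u - (1 - lambda * v)^-1 *: dPsi mu c)) 0 0 |
    <= C * (Num.sqrt (R1 mu A c q * R2 mu A c) + Num.sqrt (R3 mu A c)
            + R4 mu A c q + Num.sqrt (R2 mu A c) * lpnorm 2 eps
            + `| (eps^T *m dPsi mu c) 0 0 |)
  /\
  forall (d d' : measure_display)
    (T : measurableType d) (P : probability T R)
    (T' : measurableType d') (P' : probability T' R)
    (sigma : {RV P >-> n.-tuple R}) (W : {RV P' >-> R}),
  has_quadratic_law sigma mu A c ->
  has_centered_normal_law W (v / (1 - lambda * v)) ->
  dKS P P'
      (fun w => \sum_(i < n)
         q i 0 * (tnth (sigma w) i - dpsi mu i (c i 0) / (1 - lambda * v))) W
    <= C * (Num.sqrt (R2 mu A c)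
              * (Num.sqrt (R1 mu A c q) + Num.sqrt (alpha A) + lpnorm 2 eps)
            + Num.sqrt (R1 mu A c q) + Num.sqrt (R3 mu A c)
            + Num.sqrt n%:R * alpha A + linfnorm q + R4 mu A c q
            + `| (eps^T *m dPsi mu c) 0 0 | + lpnorm 2 eps).
Proof.
(* Fixed by [ks_constant_le] for part (b); [mean_constant_le] accepts every numerical factor from 16
   on. *)
exists (7000 * (1 - rho)^-1 ^+ 4 * (1 + kappa^-1)).
move=> n mu A c q u lam hmu AT A0 hA hq hu hk hlam eps v.
have /andP[rho0 rho1] := hrho.
have symA i j : A i j = A j i by rewrite -[in LHS]AT mxE.
have A4 := opnorm4_contract A rho hA.
have A2 := sym_contract2 n A rho rho0 symA A4.
pose cf i := c i 0; pose qf i := q i 0.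
have q1 : sqs qf = 1.
  by rewrite -[LHS]sqr_sqrtr ?sqs_ge0// -lpnorm2E hq expr1n.
have qQ := linfnorm_ge q; have rowA := alpha_ge A.
have Q0 := linfnorm_ge0 q; have al0 := alpha_ge0 A.
have vE : v = free_upsilon mu cf qf by rewrite /v upsilonE.
have kv : kappa <= free_upsilon mu cf qf by rewrite -vE.
have del0 : 0 < 1 - rho by rewrite subr_gt0.
have i1 : 1 <= (1 - rho)^-1 by rewrite invf_ge1//; lra.
have Dge : 1 - rho <= 1 - lam * free_upsilon mu cf qf := one_minus_lamv mu cf qf rho lam hrho q1 hlam.
have D0 : 0 < 1 - lam * free_upsilon mu cf qf by exact: lt_le_trans Dge.
have e0 := sqrtr_ge0 (sqs (eigen_defect A qf lam)).
have rr0 := sqrtr_ge0 (sqs (var_defect mu A cf qf)).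
have N0 := sqrtr_ge0 (sqs (mv A (free_mean mu cf))).
have x0 := sqrtr_ge0 (qds (mv A (free_mean mu cf))).
rewrite R1E// R2E// R3E// R4E// lpnorm_epsE eps_dPsiE// -/cf -/qf vE.
have k1 : 0 < kappa^-1 by rewrite invr_gt0.
split.
  have uE := mean_field_fixed_point mu A c u hmu symA A0 hu.
  pose uf i := u i 0.
  have uE' i : uf i = site_mean mu A cf i uf by rewrite /uf uE.
  have d01 i : 0 <= free_var mu cf i <= 1.
    exact: (tilt_var_bounds _ _ measurable_clip abs_clip_le).
  have [w1 w1E] := resolvent_exists n A rho hrho symA A2 (free_var mu cf) (eigen_defect A qf lam) d01.
  have [w2 w2E] := resolvent_exists n A rho hrho symA A2 (free_var mu cf) (var_defect mu A cf qf) d01.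
  have rem_le i : `|uf i - free_mean mu cf i - free_var mu cf i * mv A uf i| <= 4 * mv A uf i ^+ 2.
    have := tilt_mean_taylor2 (mu i) _ measurable_clip abs_clip_le (site_field A cf uf i) (cf i).
    by rewrite /site_field addrK [uf i]uE'.
  have gb i : `|uf i - free_mean mu cf i| <= `|mv A uf i|.
    have := tilt_mean_lip (mu i) _ measurable_clip abs_clip_le (site_field A cf uf i) (cf i).
    by rewrite /site_field addrK [uf i]uE'.
  have main := centering_error_le A rho (free_mean mu cf) (free_var mu cf) qf (eigen_defect A qf lam) (var_defect mu A cf qf)
    lam (free_upsilon mu cf qf) hrho symA A2 d01 (v01 mu cf qf q1) hlam q1 (fun=> erefl) (fun=> erefl)
    w1 w2 uf uf w1E w2E rem_le.
  have z0 : (fun i => uf i - uf i) = fun=> 0 by apply/funext => i; rewrite subrr.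
  have dz (a : 'I_n -> R) : dotp a (fun=> 0) = 0 by apply: big1 => i _; rewrite mulr0.
  rewrite z0 !dz normr0 !addr0 subr0 in main.
  have Mle : Num.sqrt (qds (mv A uf)) <= Num.sqrt (qds (mv A (free_mean mu cf))) * (1 - rho)^-1 ^+ 2.
    have := qds_local_field n A rho (free_mean mu cf) uf uf hrho A4 gb.
    have -> : (fun i => mv A (free_mean mu cf) i + mv A (fun i => uf i - uf i) i) = mv A (free_mean mu cf).
      by apply/funext => i; rewrite z0 [mv A (fun=> 0) i]dz addr0.
    move=> h; apply: le_trans (ler_wsqrtr h) _.
    rewrite sqrtrM ?qds_ge0// sqrtrV ?exprn_ge0 ?(ltW del0)//.
    rewrite (_ : (1 - rho) ^+ 4 = ((1 - rho) ^+ 2) ^+ 2); last by rewrite -exprM.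
    by rewrite sqrtr_sqr ger0_norm ?sqr_ge0// exprVn.
  have -> : (q^T *m (u - (1 - lam * free_upsilon mu cf qf)^-1 *: dPsi mu c)) 0 0 =
      ((1 - lam * free_upsilon mu cf qf) * dotp qf uf - dotp qf (free_mean mu cf)) / (1 - lam * free_upsilon mu cf qf).
    rewrite mulrBl mulrAC divff ?mul1r ?gt_eqF// mxE /dotp mulr_suml -sumrB.
    apply: eq_bigr => i _.
    have -> : (u - (1 - lam * free_upsilon mu cf qf)^-1 *: dPsi mu c) i 0 =
       uf i - (1 - lam * free_upsilon mu cf qf)^-1 * free_mean mu cf i by rewrite -[free_mean _ _ _]dPsiE// !mxE.
    rewrite mxE -/(qf i); move: (_^-1) => D; ring.
  rewrite normrM normfV (gtr0_norm D0).
  have iD : (1 - lam * free_upsilon mu cf qf)^-1 <= (1 - rho)^-1 by rewrite lef_pV2 ?posrE.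
  apply: le_trans (ler_pM _ _ main iD) _; rewrite ?normr_ge0 ?invr_ge0 ?(ltW D0)//.
  rewrite sqrtrM ?sqs_ge0//.
  have h16 : 16 <= 7000 :> R by rewrite ler_nat.
  exact: (mean_constant_le 7000 kappa _ _ _ _ _ _ _ _ h16 hkappa i1 x0
    (normr_ge0 _) (normr_ge0 _) N0 e0 rr0 Mle).
move=> dd dd' T P T' P' sigma W hsig hW.
have ge_all : forall t : R,
  `| fine (P [set w | \sum_(i < n) q i 0 * (tnth (sigma w) i -
        dpsi mu i (c i 0) / (1 - lam * free_upsilon mu cf qf)) <= t]) -
     fine (P' [set w | W w <= t]) | <=
  (2 * gibbs_mean mu A cf (fun z => `|var_err mu A cf qf z|) +
     (6 * linfnorm q + 4 * Num.sqrt (alpha A)) +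
   2 / (1 - rho) * gibbs_mean mu A cf (fun z => `|stat_err mu A cf qf lam z|)) / kappa.
  move=> t.
  have TE x : \sum_(i < n) q i 0 * (tnth x i -
        dpsi mu i (c i 0) / (1 - lam * free_upsilon mu cf qf)) = Tstat mu cf qf lam (tnth x).
    rewrite /Tstat /dotp mulr_suml -sumrB; apply: eq_bigr => i _.
    by rewrite dpsiE// mulrBr mulrA.
  have mT : measurable_fun [set: n.-tuple R] (fun x => Tstat mu cf qf lam (tnth x)).
    apply: measurable_funB; last exact: measurable_cst.
    apply: measurable_sum => i; apply: measurable_funM; first exact: measurable_cst.
    exact: measurable_tnth.
  have bT : bS (Tstat mu cf qf lam).
    by apply: bdmB; [exact: bS_dotp|exact: bdm_cst].
  have -> : fine (P [set w | \sum_(i < n) q i 0 * (tnth (sigma w) i -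
        dpsi mu i (c i 0) / (1 - lam * free_upsilon mu cf qf)) <= t]) =
      gibbs_mean mu A cf (fun z => (Tstat mu cf qf lam z <= t)%R%:R).
    have mBt : measurable [set x : n.-tuple R | Tstat mu cf qf lam (tnth x) <= t].
      rewrite (_ : mkset _ = [set: n.-tuple R] `&`
          (fun x : n.-tuple R => Tstat mu cf qf lam (tnth x)) @^-1` `]-oo, t]%classic).
        by apply: mT => //; exact: measurable_itv.
      by rewrite setTI; apply/seteqP; split => x /=; rewrite in_itv.
    rewrite -(quadratic_modelE mu A c hmu _ t mT bT) -hsig//.
    congr fine; rewrite /distribution /pushforward; congr (P _).
    by apply/seteqP; split => w /=; rewrite TE.
  have -> : fine (P' [set w | W w <= t]) =
      fine (normal_prob 0 (Num.sqrt (free_upsilon mu cf qf / (1 - lam * free_upsilon mu cf qf)))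
        `]-oo, t]%classic).
    rewrite (_ : [set w | W w <= t] = W @^-1` `]-oo, t]%classic); first by rewrite -hW.
    by apply/seteqP; split => w /=; rewrite in_itv.
  exact: (normal_approximation mu A cf qf rho lam (linfnorm q) (alpha A)
    hrho symA A0 q1 qQ rowA hlam kappa hkappa kv t).
have E1 := stat_err_le mu A cf qf rho lam hrho symA A0 A2 q1 hlam.
have E2 := var_err_le mu A cf qf (linfnorm q) (alpha A) symA A0 q1 qQ rowA.
have E3 := field_norm_le mu A cf rho (alpha A) hrho symA A0 A2 A4 al0 rowA.
have E4 := sqrt_alpha_le A q q1.
have y0 : 0 <= Num.sqrt n%:R * alpha A by rewrite mulr_ge0 ?sqrtr_ge0.
rewrite -exprVn in E3.
have S0 := field_norm_ge0 mu A cf.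
set bound := (_ + _ + _) / kappa in ge_all.
have hb : bound <= _ := ks_constant_le kappa (1 - rho)^-1 _ _ _ _ _
  (Num.sqrt n%:R * alpha A) (Num.sqrt (qds (mv A (free_mean mu cf))))
  (`|dotp (eigen_defect A qf lam) (free_mean mu cf)| +
   `|dotp (var_defect mu A cf qf) (free_mean mu cf)|)
  _ _ _ hkappa i1 Q0 y0 x0 (addr_ge0 (normr_ge0 _) (normr_ge0 _)) N0 e0 rr0 S0 E2 E1 E3 E4.
apply: (@le_trans _ _ bound).
  (* Bounding a supremum from above asks for a nonempty set; the value at t = 0 is the witness. *)
  rewrite /dKS; apply: ge_sup; first by exists (`| fine (P [set w | \sum_(i < n)
     q i 0 * (tnth (sigma w) i - dpsi mu i (c i 0) / (1 - lam * free_upsilon mu cf qf)) <= 0]) -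
     fine (P' [set w | W w <= 0]) |); exists 0.
  by move=> _ [t _ <-]; exact: ge_all.
apply: le_trans hb _.
set K := 7000 * _ * _.
have K0 : 0 <= K.
  apply: mulr_ge0; last by rewrite addr_ge0// ltW.
  by apply: mulr_ge0 (ler0n R _) (exprn_ge0 4 (le_trans ler01 i1)).
rewrite ler_wpM2l//.
(* Supplies the nonnegative summand sqrt(R2 alpha) of the target, absent from [hb]. *)
have Ns : 0 <= Num.sqrt (sqs (mv A (free_mean mu cf))) * Num.sqrt (alpha A).
  by rewrite mulr_ge0 ?sqrtr_ge0.
move: Ns; rewrite !mulrDr.
move: (Num.sqrt (sqs (mv A _)) * _) => w0.
lra.
Qed.
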